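(* Let $n\ge 2$ be an integer, let $\alpha\in[0,1)$, and let $\mathcal{E}_0,\mathcal{E}_1:[0,1)\to\mathbb{C}$ satisfy: $\mathcal{E}_0,\mathcal{E}_1\in C([0,1))\cap C^n((0,1))$; $x^\alpha\mathcal{E}_{0x},\,y^\alpha\mathcal{E}_{1y}\in C([0,1))$; $\mathcal{E}_0(0)=\mathcal{E}_1(0)=1$; $\operatorname{Re}\mathcal{E}_0(x)>0$ for $x\in[0,1)$; $\operatorname{Re}\mathcal{E}_1(y)>0$ for $y\in[0,1)$. For each $\delta>0$ the following hold. (a) Suppose the $2\times2$-matrix Riemann--Hilbert problem $$\begin{cases}m(x,y,\cdot)\text{ is analytic in }\mathbb{C}\setminus\Gamma,\\ m_+(x,y,z)=m_-(x,y,z)\,v(x,y,z)\text{ for all }z\in\Gamma,\\ m(x,y,z)=I+O(z^{-1})\text{ as }z\to\infty,\end{cases}$$ (with $\Gamma$ and $v$ as defined in the context) has a solution for all $(x,y)\in D_\delta$. Then there exists a $C^n$-solution of the Goursat problem for the hyperbolic Ernst equation in $D_\delta$ with data $\{\mathcal{E}_0|_{[0,1-\delta)},\mathcal{E}_1|_{[0,1-\delta)}\}$. (b) Whenever the $L^1$-norms of $\mathcal{E}_{0x}/\operatorname{Re}\mathcal{E}_0$ and $\mathcal{E}_{1y}/\operatorname{Re}\mathcal{E}_1$ on $[0,1-\delta)$ are sufficiently small (i.e. smaller than some constant $c_\delta>0$ depending on $\delta$ but not on the data), there exists a $C^n$-solution of the Goursat problem for the hyperbolic Ernst equation in $D_\delta$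 with data $\{\mathcal{E}_0|_{[0,1-\delta)},\mathcal{E}_1|_{[0,1-\delta)}\}$. (c) If $\mathcal{E}_0,\mathcal{E}_1>0$ on $[0,1-\delta)$ (i.e. they are real and positive there), then there exists a $C^n$-solution of the Goursat problem for the hyperbolic Ernst equation in $D_\delta$ with data $\{\mathcal{E}_0|_{[0,1-\delta)},\mathcal{E}_1|_{[0,1-\delta)}\}$.
   Context: $D=\{(x,y)\in\mathbb{R}^2: x\ge0,\ y\ge0,\ x+y<1\}$, $D_\delta=\{(x,y)\in D: x+y<1-\delta\}$, with interiors $\operatorname{int}D$, $\operatorname{int}D_\delta$; $\hat{\mathbb{C}}=\mathbb{C}\cup\{\infty\}$. Subscripts $x,y$ denote (partial) derivatives. Conditions such as ''$x^\alpha f_x\in C(S)$'' mean that the function has a continuous extension to $S$. The hyperbolic Ernst equation is $(\operatorname{Re}\mathcal{E})\Big(\mathcal{E}_{xy}-\frac{\mathcal{E}_x+\mathcal{E}_y}{2(1-x-y)}\Big)=\mathcal{E}_x\mathcal{E}_y$. $C^n$-solution in $D_\delta$: a function $\mathcal{E}:D_\delta\to\mathbb{C}$ is a $C^n$-solution of the Goursat problem in $D_\delta$ with data $\{\mathcal{E}_0|_{[0,1-\delta)},\mathcal{E}_1|_{[0,1-\delta)}\}$ if $\mathcal{E}\in C(D_\delta)\cap C^n(\operatorname{int}D_\delta)$; $\mathcal{E}$ satisfies the equation in $\operatorname{int}D_\delta$; $x^\alpha\mathcal{E}_x,\,y^\alpha\mathcal{E}_y,\,x^\alpha y^\alpha\mathcal{E}_{xy}\in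 C(D_\delta)$ for some $\alpha\in[0,1)$; $\mathcal{E}(x,0)=\mathcal{E}_0(x)$ for $x\in[0,1-\delta)$; $\mathcal{E}(0,y)=\mathcal{E}_1(y)$ for $y\in[0,1-\delta)$; and $\operatorname{Re}\mathcal{E}>0$ on $D_\delta$. Riemann surface: for $(x,y)\in D$, $\mathcal{S}_{(x,y)}$ is the compact genus-zero Riemann surface of points $P=(\lambda,k)\in\mathbb{C}^2$ with $\lambda^2=\frac{k-(1-y)}{k-x}$, together with $\infty^\pm=(\pm1,\infty)$ and the branch point $x\equiv(\infty,x)$. $\lambda(x,y,P)$ is the value of $\lambda$ at $P$. For $k\in\hat{\mathbb{C}}\setminus[x,1-y]$, $k^+$ and $k^-$ are the points over $k$ on the upper and lower sheet, where $\lambda(x,y,k^+)=\sqrt{\frac{k-(1-y)}{k-x}}=-\lambda(x,y,k^-)$ with $\operatorname{Re}\lambda(x,y,k^+)>0$. For $S\subset\mathbb{C}$, $S^\pm$ denotes the set in the upper/lower sheet projecting onto $S$. Put $\Sigma_0=[0,x]^+\cup[x,0]^-$, $\Sigma_1=[1,1-y]^-\cup[1-y,1]^+$. The map $F_{(x,y)}:\mathcal{S}_{(x,y)}\to\hat{\mathbb{C}}$, $F_{(x,y)}(P)=\frac{1+\lambda(x,y,P)}{1-\lambda(x,y,P)}$, is a biholomorphism, and $F_{(x,y)}(\Sigma_0)=\Big[-\frac{\sqrt{1-y}+\sqrt x}{\sqrt{1-y}-\sqrt x},-\frac{\sqrt{1-y}-\sqrt x}{\sqrt{1-y}+\sqrt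 x}\Big]$, $F_{(x,y)}(\Sigma_1)=\Big[\frac{\sqrt{1-x}-\sqrt y}{\sqrt{1-x}+\sqrt y},\frac{\sqrt{1-x}+\sqrt y}{\sqrt{1-x}-\sqrt y}\Big]$. Contour: $\Gamma=\Gamma_0\cup\Gamma_1$ (depending on $(x,y)$), where $\Gamma_0,\Gamma_1$ are two clockwise nonintersecting smooth loops in the $z$-plane, lying outside each other, encircling $F_{(x,y)}(\Sigma_0)$ and $F_{(x,y)}(\Sigma_1)$ respectively and not encircling $0$. $m_+$ and $m_-$ are the nontangential boundary values of $m$ from the left and right sides of $\Gamma$. Jump matrix: $\Phi_0,\Phi_1$ are the unique $2\times2$-matrix solutions of $\Phi_0(x,k^\pm)=I+\int_0^x(\mathsf{U}_0\Phi_0)(x',k^\pm)dx'$ and $\Phi_1(y,k^\pm)=I+\int_0^y(\mathsf{V}_1\Phi_1)(y',k^\pm)dy'$ for $x,y\in[0,1)$, $k\in\mathbb{C}\setminus[0,1]$, where $$\mathsf{U}_0(x,k^\pm)=\frac{1}{2\operatorname{Re}\mathcal{E}_0(x)}\begin{pmatrix}\overline{\mathcal{E}_{0x}(x)}&\lambda(x,0,k^\pm)\overline{\mathcal{E}_{0x}(x)}\\ \lambda(x,0,k^\pm)\mathcal{E}_{0x}(x)&\mathcal{E}_{0x}(x)\end{pmatrix},\quad \mathsf{V}_1(y,k^\pm)=\frac{1}{2\operatorname{Re}\mathcal{E}_1(y)}\begin{pmatrix}\overline{\mathcal{E}_{1y}(y)}&\frac{\overline{\mathcal{E}_{1y}(y)}}{\lambda(0,y,k^\pm)}\\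 \frac{\mathcal{E}_{1y}(y)}{\lambda(0,y,k^\pm)}&\mathcal{E}_{1y}(y)\end{pmatrix}.$$ Then $v(x,y,z)=\Phi_0\big(x,F_{(x,y)}^{-1}(z)\big)$ for $z\in\Gamma_0$ and $v(x,y,z)=\Phi_1\big(y,F_{(x,y)}^{-1}(z)\big)$ for $z\in\Gamma_1$. Identification convention: a function of $k^\pm$, $k\in\hat{\mathbb{C}}\setminus[0,1]$, is regarded as a function on any of the surfaces $\mathcal{S}_{(x,y)}$ with the points over $[0,1]$ removed. Here $\Phi_0(x,\cdot)$ and $\Phi_1(y,\cdot)$, viewed this way on $\mathcal{S}_{(x,y)}$, extend continuously (and analytically) across the branch cut over $(x,1-y)$ to $\mathcal{S}_{(x,y)}\setminus(\Sigma_0\cup\Sigma_1)$; the values in $v$ are those of the extension. *)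

(* Defs.v *)
From Stdlib Require Import Reals Lra ZArith.
From Coquelicot Require Import Coquelicot.

Open Scope R_scope.
Open Scope C_scope.

(* Derivative of a complex-valued function of a real variable, componentwise
   because [Derive] is restricted to real-valued functions. *)
Definition deriv (f : R -> C) (t : R) : C :=
  (Derive (fun s => Re (f s)) t, Derive (fun s => Im (f s)) t).

Definition dx (f : R * R -> C) (p : R * R) : C :=
  deriv (fun t => f (t, snd p)) (fst p).
Definition dy (f : R * R -> C) (p : R * R) : C :=
  deriv (fun t => f (fst p, t)) (snd p).

(* Only meant for open sets [U]. *)
Fixpoint Cn1 (n : nat) (U : R -> Prop) (f : R -> C) : Prop :=
  match n with
  | O => continuous_on (U := C_UniformSpace) U f
  | S m => (forall t, U t -> ex_derive (V := C_R_NormedModule) f t) /\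
           Cn1 m U (deriv f)
  end.

(* Only meant for open sets [U]; for order at least 1 the continuity of [f]
   itself follows from that of its partial derivatives. *)
Fixpoint Cn2 (n : nat) (U : R * R -> Prop) (f : R * R -> C) : Prop :=
  match n with
  | O => continuous_on (U := C_UniformSpace) U f
  | S m =>
      (forall p, U p ->
         ex_derive (V := C_R_NormedModule) (fun t => f (t, snd p)) (fst p) /\
         ex_derive (V := C_R_NormedModule) (fun t => f (fst p, t)) (snd p)) /\
      Cn2 m U (dx f) /\ Cn2 m U (dy f)
  end.

(* [f], which is only considered on [S0], extends continuously to [S]. *)
Definition has_cont_ext {T : UniformSpace} (S0 S : T -> Prop) (f : T -> C)
  : Prop :=
  exists g : T -> C, continuous_on (U := C_UniformSpace) S g /\
    forall p, S0 p -> g p = f p.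

Definition interior {T : UniformSpace} (S : T -> Prop) (p : T) : Prop :=
  locally p S.

Definition D (p : R * R) : Prop :=
  0 <= fst p /\ 0 <= snd p /\ fst p + snd p < 1.

Definition Ddelta (delta : R) (p : R * R) : Prop :=
  D p /\ fst p + snd p < 1 - delta.

Definition Ernst_at (E : R * R -> C) (p : R * R) : Prop :=
  let (x, y) := p in
  RtoC (Re (E p)) *
    (dy (dx E) p - (dx E p + dy E p) / RtoC (2 * (1 - x - y)))
  = dx E p * dy E p.

Definition Cn_solution (n : nat) (delta : R) (E0 E1 : R -> C)
    (E : R * R -> C) : Prop :=
  let S := Ddelta delta in
  let S0 := interior S in
  continuous_on (U := C_UniformSpace) S E /\
  Cn2 n S0 E /\
  (forall p, S0 p -> Ernst_at E p) /\
  (exists alpha : R, (0 <= alpha < 1)%R /\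
     has_cont_ext S0 S (fun p => RtoC (Rpower (fst p) alpha) * dx E p) /\
     has_cont_ext S0 S (fun p => RtoC (Rpower (snd p) alpha) * dy E p) /\
     has_cont_ext S0 S
       (fun p => RtoC (Rpower (fst p) alpha * Rpower (snd p) alpha)
                 * dy (dx E) p)) /\
  (forall x : R, (0 <= x < 1 - delta)%R -> E (x, 0%R) = E0 x) /\
  (forall y : R, (0 <= y < 1 - delta)%R -> E (0%R, y) = E1 y) /\
  (forall p, S p -> 0 < Re (E p)).

Definition Goursat_datum (n : nat) (alpha : R) (f : R -> C) : Prop :=
  let J (t : R) := (0 <= t < 1)%R in
  let J0 (t : R) := (0 < t < 1)%R in
  continuous_on (U := C_UniformSpace) J f /\
  Cn1 n J0 f /\
  has_cont_ext J0 J (fun t => RtoC (Rpower t alpha) * deriv f t) /\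
  f 0%R = 1 /\
  (forall t, J t -> 0 < Re (f t)).

(* [l] is the L^1-norm of [f] on [0, b), for [f] continuous on (0, b).  The
   integral is improper because [f] may be unbounded at 0; for a nonnegative
   continuous integrand it agrees with the Lebesgue integral. *)
Definition is_L1_norm (f : R -> C) (b l : R) : Prop :=
  (b <= 0 /\ l = 0%R) \/
  (0 < b /\
   is_RInt_gen (V := R_NormedModule) (fun t => Cmod (f t))
     (at_right 0) (at_left b) l).

Inductive Chat : Type := Fin (z : C) | Infty.

Inductive sheet : Type := upper | lower.

(* The points (lambda, k) of the surface over (x, y). *)
Definition surface (x y : R) (P : Chat * Chat) : Prop :=
  match P with
  | (Fin l, Fin k) => k <> RtoC x /\ l * l = (k - RtoC (1 - y)) / (k - RtoC x)
  | (Fin l, Infty) => l = 1 \/ l = - (1)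
  | (Infty, Fin k) => k = RtoC x
  | (Infty, Infty) => False
  end.

(* Principal square root: nonnegative real part, cut along (-oo, 0). *)
Definition Csqrt (z : C) : C :=
  (sqrt ((Cmod z + Re z) / 2),
   ((if Rlt_dec (Im z) 0 then -1 else 1) * sqrt ((Cmod z - Re z) / 2))%R).

(* The value of lambda at k^+ and k^-, for k off the cut [x, 1-y]. *)
Definition lambda (x y : R) (k : C) (s : sheet) : C :=
  let r := Csqrt ((k - RtoC (1 - y)) / (k - RtoC x)) in
  match s with upper => r | lower => - r end.

Definition over (x y : R) (k : C) (s : sheet) : Chat * Chat :=
  (Fin (lambda x y k s), Fin k).

Definition Fmap (P : Chat * Chat) : Chat :=
  match fst P with
  | Fin l => if Ceq_dec l 1 then Infty else Fin ((1 + l) / (1 - l))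
  | Infty => Fin (- (1))
  end.

Definition in_segment (a b : R) (k : C) : Prop :=
  exists t : R, (a <= t <= b)%R /\ k = RtoC t.

(* The images under [Fmap] of Sigma_0 and Sigma_1, i.e. of all the points of
   the surface over [0, x] and over [1-y, 1] (on both sheets). *)
Definition FSigma0 (x y : R) (z : C) : Prop :=
  exists (l : Chat) (k : C),
    in_segment 0 x k /\ surface x y (l, Fin k) /\ Fmap (l, Fin k) = Fin z.
Definition FSigma1 (x y : R) (z : C) : Prop :=
  exists (l : Chat) (k : C),
    in_segment (1 - y) 1 k /\ surface x y (l, Fin k) /\
    Fmap (l, Fin k) = Fin z.

Definition smooth_loop (g : R -> C) : Prop :=
  (forall k : nat, Cn1 k (fun _ => True) g) /\
  (forall t, deriv g t <> 0) /\
  (forall t, g (t + 1)%R = g t) /\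
  (forall s t, (0 <= s < 1)%R -> (0 <= t < 1)%R -> g s = g t -> s = t).

(* [g] avoids [w] and has winding number [n] around it. *)
Definition winding (g : R -> C) (w : C) (n : Z) : Prop :=
  (forall t, g t <> w) /\
  is_RInt (V := C_R_NormedModule) (fun t => deriv g t / (g t - w)) 0 1
    (2 * RtoC PI * Ci * RtoC (IZR n)).

(* Being encircled clockwise is having winding number -1, being outside is
   having winding number 0. *)
Definition contour (x y : R) (g0 g1 : R -> C) : Prop :=
  smooth_loop g0 /\ smooth_loop g1 /\
  (forall t, winding g0 (g1 t) 0) /\
  (forall t, winding g1 (g0 t) 0) /\
  (forall z, FSigma0 x y z -> winding g0 z (-1)) /\
  (forall z, FSigma1 x y z -> winding g1 z (-1)) /\
  winding g0 0 0 /\ winding g1 0 0.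

Definition Mat2 : Type := @matrix C 2 2.

Definition entry (A : Mat2) (i j : nat) : C := coeff_mat (RtoC 0) A i j.

Definition mat2 (a b c d : C) : Mat2 :=
  mk_matrix 2 2 (fun i j =>
    match i, j with O, O => a | O, _ => b | _, O => c | _, _ => d end).

Definition I2 : Mat2 := Mone (T := C_Ring) (n := 2).

Definition mul2 (A B : Mat2) : Mat2 :=
  Mmult (T := C_Ring) (n := 2) (m := 2) (k := 2) A B.

Definition U0 (E0 : R -> C) (x : R) (k : C) (s : sheet) : Mat2 :=
  let r := 1 / RtoC (2 * Re (E0 x)) in
  let e := deriv E0 x in
  let l := lambda x 0 k s in
  mat2 (r * Cconj e)       (r * (l * Cconj e))
       (r * (l * e))       (r * e).

Definition V1 (E1 : R -> C) (y : R) (k : C) (s : sheet) : Mat2 :=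
  let r := 1 / RtoC (2 * Re (E1 y)) in
  let e := deriv E1 y in
  let l := lambda 0 y k s in
  mat2 (r * Cconj e)       (r * (Cconj e / l))
       (r * (e / l))       (r * e).

(* [Phi] solves Phi(t) = I + int_0^t A Phi on [0, 1), off the segment [0, 1] in
   the k-plane.  As [A] may be unbounded at 0 the integral is improper, which
   is why t = 0 (where it is 0) is treated apart. *)
Definition Volterra (A Phi : R -> C -> sheet -> Mat2) : Prop :=
  forall (k : C) (s : sheet), ~ in_segment 0 1 k ->
    Phi 0%R k s = I2 /\
    forall t : R, (0 < t < 1)%R -> forall i j : nat, (i < 2)%nat -> (j < 2)%nat ->
      is_RInt_gen (V := C_R_NormedModule)
        (fun t' => entry (mul2 (A t' k s) (Phi t' k s)) i j)
        (at_right 0) (at_point t)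
        (entry (Phi t k s) i j - entry I2 i j).

(* A function [phi] of the points k^+, k^- with k outside [0, 1] is transported
   to the surface over (x, y) by matching sheets, and read in the global chart
   z = F(P).  [W] is its continuous extension to the complement of
   Sigma_0 and Sigma_1, i.e. across the cut over (x, 1-y). *)
Definition surface_extension (x y : R) (phi : C -> sheet -> Mat2)
    (W : C -> Mat2) : Prop :=
  (forall (k : C) (s : sheet) (z : C), ~ in_segment 0 1 k ->
     Fmap (over x y k s) = Fin z -> W z = phi k s) /\
  (forall i j : nat, (i < 2)%nat -> (j < 2)%nat ->
     continuous_on (T := C_UniformSpace) (U := C_UniformSpace)
       (fun z => ~ FSigma0 x y z /\ ~ FSigma1 x y z)
       (fun z => entry (W z) i j)).

(* [phi0] and [phi1] stand for Phi_0(x, .) and Phi_1(y, .). *)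
Definition jump_matrix (x y : R) (phi0 phi1 : C -> sheet -> Mat2)
    (g0 g1 : R -> C) (v : C -> Mat2) : Prop :=
  (exists W0 : C -> Mat2, surface_extension x y phi0 W0 /\
     forall t, v (g0 t) = W0 (g0 t)) /\
  (exists W1 : C -> Mat2, surface_extension x y phi1 W1 /\
     forall t, v (g1 t) = W1 (g1 t)).

(* [L] is the nontangential boundary value at g(t) of [m] from the left
   ([side] = 1) or right ([side] = -1) of [g]: the limit inside each cone, of
   arbitrary aperture, around the corresponding normal direction. *)
Definition boundary_value (side : R) (g : R -> C) (t : R) (m : C -> Mat2)
    (L : Mat2) : Prop :=
  forall (c : R), 0 < c -> forall i j : nat, (i < 2)%nat -> (j < 2)%nat ->
    filterlim (fun z => entry (m z) i j)
      (within (fun z : C =>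
           (c * Cmod (z - g t) < side * Im ((z - g t) / deriv g t))%R)
         (locally (T := C_UniformSpace) (g t)))
      (locally (T := C_UniformSpace) (entry L i j)).

Definition RHP_solution (g0 g1 : R -> C) (v m : C -> Mat2) : Prop :=
  (forall z : C, (forall t, g0 t <> z) -> (forall t, g1 t <> z) ->
     forall i j : nat, (i < 2)%nat -> (j < 2)%nat ->
       ex_derive (K := C_AbsRing) (V := C_NormedModule)
         (fun w : C => entry (m w) i j) z) /\
  (forall g : R -> C, g = g0 \/ g = g1 -> forall t : R,
     exists mplus mminus : Mat2,
       boundary_value 1 g t m mplus /\ boundary_value (-1) g t m mminus /\
       mplus = mul2 mminus (v (g t))) /\
  (exists K r : R, forall z : C, r < Cmod z ->
     forall i j : nat, (i < 2)%nat -> (j < 2)%nat ->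
       Cmod (entry (m z) i j - entry I2 i j) <= K / Cmod z).

(* Main.v *)
(* The theorem holds because the Goursat problem is globally solvable for all data
   in the given class. Put r = 1 - x - y, u = sqrt r E_x / Re E and
   v = sqrt r E_y / Re E. The Ernst equation becomes the characteristic system
     u_y = i Im(v) / sqrt r u + v / (2 r),  v_x = i Im(u) / sqrt r v + u / (2 r),
   whose nonlinear terms only rotate u and v in the complex plane. Hence |u| and |v|
   obey linear inequalities and cannot blow up where r >= delta: solving for u with v
   given (and conversely) by means of the rotation as integrating factor is a
   contraction for a norm weighted by exp(- l (x + y)) on the whole domain.
   The substitution x = X^(m+1), y = Y^(m+1) turns the integrable singularities
   x^(-alpha), y^(-alpha) of the data into continuous data. The potential is
   recovered by integrating (log Re E)_y = Re(v) / sqrt r and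
   (Im E)_y = Im(v) Re E / sqrt r; the system is the integrability condition giving the
   corresponding formulas for the derivatives in x. *)

Require Import Defs.
From Stdlib Require Import Reals Lra Lia.
From Coquelicot Require Import Coquelicot.
Open Scope R_scope.

(** * Iterated partial derivatives *)

(** After the change of variables [u] and [v] are built from derivatives in X and Y, so the Jacobian
    enters the system only through the coupling term. All coefficients are truncated, so that the
    integral equations live on bounded continuous functions on the whole plane; the system has its
    true coefficients only where the truncations are inactive. Two weights are needed. The rotation
    angle depends on the unknown, so the contraction constant involves a bound for [v]: a first
    weight yields this bound from the linear estimate, and a second one, chosen afterwards, yields
    the contraction. Regularity is a separate difficulty: the fixed point is merely continuous, and
    the system gives u_y and v_x but not u_x. Smoothness in the first variable alone is read off the
    integral representation of u, on a domain that crosses the axis where the integration starts.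
    Smoothness in all directions then follows from the equation in y, with u and v gaining orders
    together. *)

Definition slice (d : bool) (f : R * R -> R) (p : R * R) : R -> R :=
  fun t => if d then f (t, snd p) else f (fst p, t).

Definition crd (d : bool) (p : R * R) : R := if d then fst p else snd p.

Definition is_pd (d : bool) (f : R * R -> R) (p : R * R) (l : R) : Prop :=
  is_derive (slice d f p) (crd d p) l.

(* [A] is the set of directions in which derivatives are taken: [true] stands
   for the first variable and [false] for the second one. *)
Fixpoint Ck (A : bool -> Prop) (k : nat) (U : R * R -> Prop) (f : R * R -> R)
  : Prop :=
  (forall p, U p -> continuous f p) /\
  match k with
  | O => True
  | S m => forall d, A d ->
      exists g, (forall p, U p -> is_pd d f p (g p)) /\ Ck A m U g
  end.

Lemma slice_crd (d : bool) (f : R * R -> R) (p : R * R) :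
  slice d f p (crd d p) = f p.
Proof. destruct d, p; reflexivity. Qed.

Lemma Ck_cont A k U f : Ck A k U f -> forall p, U p -> continuous f p.
Proof. destruct k; intros H; apply H. Qed.

Lemma Ck_intro A k U f :
  (forall p, U p -> continuous f p) ->
  (forall d, A d ->
     exists g, (forall p, U p -> is_pd d f p (g p)) /\ Ck A k U g) ->
  Ck A (S k) U f.
Proof. intros H1 H2; split; assumption. Qed.

Lemma Ck_pred A k U f : Ck A (S k) U f -> Ck A k U f.
Proof.
  revert f; induction k as [|k IH]; intros f [H1 H2]; split; auto.
  intros d Hd; destruct (H2 d Hd) as [g [Hg Hk]]; exists g; auto.
Qed.

Lemma Ck_le A j k U f : (j <= k)%nat -> Ck A k U f -> Ck A j U f.
Proof. induction 1; intros; auto using Ck_pred. Qed.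

Lemma Ck_sub (A B : bool -> Prop) k (U V : R * R -> Prop) f :
  (forall d, A d -> B d) -> (forall p, U p -> V p) -> Ck B k V f -> Ck A k U f.
Proof.
  intros HAB HUV; revert f; induction k as [|k IH]; intros f [H1 H2]; split; auto.
  intros d Hd; destruct (H2 d (HAB d Hd)) as [g [Hg Hk]]; exists g; auto.
Qed.

Lemma locally_slice d (p : R * R) (P : R * R -> Prop) :
  locally p P ->
  locally (crd d p) (fun t => P (if d then (t, snd p) else (fst p, t))).
Proof.
  intros [e He]; exists e; intros t Ht; apply He.
  destruct d; (split; [|]); simpl; auto using ball_center.
Qed.

Lemma is_pd_ext d U f g p l : open U -> U p -> (forall q, U q -> f q = g q) ->
  is_pd d f p l -> is_pd d g p l.
Proof.
  intros HU Hp Hfg H; unfold is_pd.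
  refine (is_derive_ext_loc _ _ _ _ _ H).
  refine (filter_imp _ _ _ (locally_slice d p _ (HU p Hp))).
  intros t Ht; unfold slice; destruct d; apply Hfg, Ht.
Qed.

Lemma continuous_ext_open (U : R * R -> Prop) (f g : R * R -> R) p :
  open U -> U p -> (forall q, U q -> f q = g q) ->
  continuous f p -> continuous g p.
Proof.
  intros HU Hp Hfg H; apply (continuous_ext_loc g f); auto.
  refine (filter_imp _ _ _ (HU p Hp)); auto.
Qed.

Lemma Ck_ext A k U f g : open U -> (forall p, U p -> f p = g p) ->
  Ck A k U f -> Ck A k U g.
Proof.
  intros HU Hfg H; destruct k; destruct H as [H1 H2]; split; auto.
  1, 2: intros p Hp; apply (continuous_ext_open U f g); auto.
  intros d Hd; destruct (H2 d Hd) as [h [Hh Hk]]; exists h; split; auto.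
  intros p Hp; apply (is_pd_ext d U f); auto.
Qed.

Lemma is_pd_unique d f p l : is_pd d f p l -> Derive (slice d f p) (crd d p) = l.
Proof. apply is_derive_unique. Qed.

(** Partial derivatives are unique, so any derivative of f inherits the order of the witness hidden
    in [Ck]. *)
Lemma Ck_pd A k U f g d : open U -> A d -> (forall p, U p -> is_pd d f p (g p)) ->
  Ck A (S k) U f -> Ck A k U g.
Proof.
  intros HU Hd Hg [_ H]; destruct (H d Hd) as [h [Hh Hk]].
  apply (Ck_ext A k U h); auto.
  intros p Hp; rewrite <- (is_pd_unique _ _ _ _ (Hh p Hp)).
  apply is_pd_unique; auto.
Qed.

Lemma is_pd_const d c p : is_pd d (fun _ => c) p 0.
Proof.
  unfold is_pd, slice; apply (is_derive_ext (fun _ => c)).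
  - intros t; destruct d; reflexivity.
  - apply (is_derive_const c).
Qed.

Lemma is_pd_plus d f g p l m : is_pd d f p l -> is_pd d g p m ->
  is_pd d (fun q => f q + g q) p (l + m).
Proof.
  intros Hf Hg; unfold is_pd.
  apply (is_derive_ext (fun t => plus (slice d f p t) (slice d g p t))).
  - intros t; unfold slice; destruct d; reflexivity.
  - apply (is_derive_plus _ _ _ l m); assumption.
Qed.

Lemma is_pd_mult d f g p l m : is_pd d f p l -> is_pd d g p m ->
  is_pd d (fun q => f q * g q) p (l * g p + f p * m).
Proof.
  intros Hf Hg; unfold is_pd.
  apply (is_derive_ext (fun t => mult (slice d f p t) (slice d g p t))).
  - intros t; unfold slice; destruct d; reflexivity.
  - rewrite <- (slice_crd d f p), <- (slice_crd d g p).
    apply (is_derive_mult (slice d f p) (slice d g p)); auto.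
    intros; apply Rmult_comm.
Qed.

Lemma is_pd_comp d (h : R -> R) f p l m : is_derive h (f p) m ->
  is_pd d f p l -> is_pd d (fun q => h (f q)) p (l * m).
Proof.
  intros Hh Hf; unfold is_pd.
  apply (is_derive_ext (fun t => h (slice d f p t))).
  - intros t; unfold slice; destruct d; reflexivity.
  - apply (is_derive_comp h (slice d f p)); auto.
    rewrite slice_crd; auto.
Qed.

Lemma is_pd_eq d f p l m : l = m -> is_pd d f p l -> is_pd d f p m.
Proof. intros ->; auto. Qed.

Lemma is_pd_minus d f g p l m : is_pd d f p l -> is_pd d g p m ->
  is_pd d (fun q => f q - g q) p (l - m).
Proof.
  intros Hf Hg; apply is_pd_eq with (l + m * -1); [ring|].
  apply (is_pd_plus d f (fun q => - g q)); auto.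
  apply (is_pd_comp d Ropp g p m (-1)); auto.
  auto_derive; auto.
Qed.

Lemma continuous_Rplus {T : UniformSpace} (f g : T -> R) p :
  continuous f p -> continuous g p -> continuous (fun q => f q + g q) p.
Proof. intros; apply (continuous_plus (V := R_NormedModule) f g); auto. Qed.

Lemma continuous_Rminus {T : UniformSpace} (f g : T -> R) p :
  continuous f p -> continuous g p -> continuous (fun q => f q - g q) p.
Proof. intros; apply (continuous_minus (V := R_NormedModule) f g); auto. Qed.

Lemma continuous_Rmult {T : UniformSpace} (f g : T -> R) p :
  continuous f p -> continuous g p -> continuous (fun q => f q * g q) p.
Proof. intros; apply (continuous_mult (K := R_AbsRing) f g); auto. Qed.

Lemma continuous_post {T : UniformSpace} (h : R -> R) (f : T -> R) p :
  continuous h (f p) -> continuous f p -> continuous (fun q => h (f q)) p.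
Proof. intros; apply (continuous_comp f h); auto. Qed.

Lemma continuous_diff (h : R -> R) x : ex_derive h x -> continuous h x.
Proof. apply (ex_derive_continuous (V := R_NormedModule) h). Qed.

Lemma Ck_const A k U c : Ck A k U (fun _ => c).
Proof.
  revert c; induction k as [|k IH]; intros c; split; auto.
  1, 2: intros; apply continuous_const.
  intros d _; exists (fun _ => 0); split; auto using is_pd_const.
Qed.

Lemma Ck_plus A k U f g : Ck A k U f -> Ck A k U g ->
  Ck A k U (fun p => f p + g p).
Proof.
  revert f g; induction k as [|k IH]; intros f g [F1 F2] [G1 G2]; split; auto.
  1, 2: intros; apply continuous_Rplus; auto.
  intros d Hd; destruct (F2 d Hd) as [f' [Hf Kf]], (G2 d Hd) as [g' [Hg Kg]].
  exists (fun p => f' p + g' p); split; auto.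
  intros; apply is_pd_plus; auto.
Qed.

Lemma Ck_mult A k U f g : Ck A k U f -> Ck A k U g ->
  Ck A k U (fun p => f p * g p).
Proof.
  revert f g; induction k as [|k IH]; intros f g [F1 F2] [G1 G2]; split; auto.
  1, 2: intros; apply continuous_Rmult; auto.
  intros d Hd; destruct (F2 d Hd) as [f' [Hf Kf]], (G2 d Hd) as [g' [Hg Kg]].
  exists (fun p => f' p * g p + f p * g' p); split.
  - intros; apply is_pd_mult; auto.
  - apply Ck_plus; apply IH; auto; apply Ck_pred; split; auto.
Qed.

Lemma Ck_minus A k U f g : Ck A k U f -> Ck A k U g ->
  Ck A k U (fun p => f p - g p).
Proof.
  revert f g; induction k as [|k IH]; intros f g [F1 F2] [G1 G2]; split; auto.
  1, 2: intros; apply continuous_Rminus; auto.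
  intros d Hd; destruct (F2 d Hd) as [f' [Hf Kf]], (G2 d Hd) as [g' [Hg Kg]].
  exists (fun p => f' p - g' p); split; auto.
  intros; apply is_pd_minus; auto.
Qed.

Lemma Ck_pow A k U f m : Ck A k U f -> Ck A k U (fun p => f p ^ m).
Proof.
  intros Hf; induction m as [|m IH]; simpl; auto using Ck_const, Ck_mult.
Qed.

Lemma Ck_inv A k U f : (forall p, U p -> f p <> 0) -> Ck A k U f ->
  Ck A k U (fun p => / f p).
Proof.
  intros H0; revert f H0; induction k as [|k IH]; intros f H0 Hf.
  all: assert (Hc : forall p, U p -> continuous (fun q => / f q) p)
    by (intros p Hp; apply continuous_post; [|apply (Ck_cont _ _ _ _ Hf p Hp)];
        apply continuous_diff; auto_derive; auto).
  - split; auto.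
  - apply Ck_intro; auto.
    intros d Hd; destruct Hf as [F1 F2]; destruct (F2 d Hd) as [f' [Hf' Kf']].
    assert (Kf : Ck A k U f) by (apply Ck_pred; split; auto).
    exists (fun p => f' p * (-1 * (/ f p * / f p))); split.
    + intros p Hp; apply (is_pd_comp d Rinv f p); auto.
      auto_derive; auto.
      field; auto.
    + auto 7 using Ck_mult, Ck_const.
Qed.

Lemma Ck_cos_sin A k U f : Ck A k U f ->
  Ck A k U (fun p => cos (f p)) /\ Ck A k U (fun p => sin (f p)).
Proof.
  revert f; induction k as [|k IH]; intros f Hf.
  all: assert (Hc : forall p, U p -> continuous (fun q => cos (f q)) p)
    by (intros p Hp; apply continuous_post; [|apply (Ck_cont _ _ _ _ Hf p Hp)];
        apply continuous_diff; auto_derive; auto).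
  all: assert (Hs : forall p, U p -> continuous (fun q => sin (f q)) p)
    by (intros p Hp; apply continuous_post; [|apply (Ck_cont _ _ _ _ Hf p Hp)];
        apply continuous_diff; auto_derive; auto).
  - split; split; auto.
  - assert (Kf : Ck A k U f) by (apply Ck_pred; auto).
    destruct (IH f Kf) as [Kc Ks], Hf as [F1 F2].
    split; apply Ck_intro; auto; intros d Hd;
      destruct (F2 d Hd) as [f' [Hf' Kf']].
    + exists (fun p => f' p * (-1 * sin (f p))); split.
      * intros p Hp; apply (is_pd_comp d cos f p); auto.
        auto_derive; auto; ring.
      * auto using Ck_mult, Ck_const.
    + exists (fun p => f' p * cos (f p)); split.
      * intros p Hp; apply (is_pd_comp d sin f p); auto.
        auto_derive; auto; ring.
      * auto using Ck_mult.
Qed.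

Lemma continuous_pair {T U V : UniformSpace} (f : T -> U) (g : T -> V) (p : T) :
  continuous f p -> continuous g p ->
  continuous (fun q => (f q, g q) : prod_UniformSpace U V) p.
Proof.
  intros Hf Hg P [e He].
  assert (Bf := Hf _ (locally_ball (f p) e)).
  assert (Bg := Hg _ (locally_ball (g p) e)).
  unfold filtermap in *.
  refine (filter_imp _ _ _ (filter_and _ _ Bf Bg)).
  intros q [H1 H2]; apply He; split; auto.
Qed.

Lemma continuous_Rfst (p : R * R) : continuous (fun q : R * R => fst q) p.
Proof. destruct p; apply continuous_fst. Qed.

Lemma continuous_Rsnd (p : R * R) : continuous (fun q : R * R => snd q) p.
Proof. destruct p; apply continuous_snd. Qed.

(** The map acts on each coordinate separately, so a derivative in direction d involves only
    [phi d]. A coordinate whose direction is outside A need only be mapped continuously, which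
    admits freezing the second coordinate. *)
Lemma Ck_change_vars A k (U V : R * R -> Prop) (phi dphi : bool -> R -> R) f :
  (forall p, U p -> V (phi true (fst p), phi false (snd p))) ->
  (forall d p, U p -> continuous (phi d) (crd d p)) ->
  (forall d p, A d -> U p -> is_derive (phi d) (crd d p) (dphi d (crd d p))) ->
  (forall d, A d -> Ck A k U (fun p => dphi d (crd d p))) ->
  Ck A k V f -> Ck A k U (fun p => f (phi true (fst p), phi false (snd p))).
Proof.
  intros HUV Hc Hd Hk; revert Hk f; induction k as [|k IH]; intros Hk f Hf.
  all: assert (Hcont : forall p, U p ->
      continuous (fun p => f (phi true (fst p), phi false (snd p))) p)
    by (intros p Hp; apply (continuous_comp _ f);
        [ apply continuous_pair;
          [ apply (continuous_comp (fun q : R * R => fst q) (phi true));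
            [apply continuous_Rfst|apply (Hc true p Hp)]
          | apply (continuous_comp (fun q : R * R => snd q) (phi false));
            [apply continuous_Rsnd|apply (Hc false p Hp)] ]
        | apply (Ck_cont _ _ _ _ Hf), HUV, Hp ]).
  - split; auto.
  - apply Ck_intro; auto.
    intros d Hd'; destruct Hf as [_ F2]; destruct (F2 d Hd') as [g [Hg Kg]].
    exists (fun p => dphi d (crd d p) *
                     g (phi true (fst p), phi false (snd p))); split.
    + intros p Hp; unfold is_pd.
      apply (is_derive_ext
        (fun t => slice d f (phi true (fst p), phi false (snd p)) (phi d t))).
      { intros t; destruct d; reflexivity. }
      apply (is_derive_comp (slice d f (phi true (fst p), phi false (snd p)))
               (phi d)); auto.
      specialize (Hg _ (HUV p Hp)); unfold is_pd in Hg.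
      destruct d; exact Hg.
    + apply Ck_mult; auto using Ck_pred.
Qed.

(** * Complex-valued functions and their real and imaginary parts *)

Lemma is_derive_C (f : R -> C) t l m :
  is_derive (fun s => Re (f s)) t l -> is_derive (fun s => Im (f s)) t m ->
  is_derive (V := C_R_NormedModule) f t (l, m).
Proof.
  intros Hl Hm.
  apply (is_derive_ext (V := C_R_NormedModule)
    (fun s => plus (scal (Re (f s)) (RtoC 1)) (scal (Im (f s)) Ci))).
  - intros s; destruct (f s) as [a b].
    apply injective_projections; cbn; ring.
  - replace (l, m) with (plus (scal l (RtoC 1)) (scal m Ci) : C_R_NormedModule).
    + apply (is_derive_plus (V := C_R_NormedModule)).
      * apply (is_derive_scal_l (fun s => Re (f s)) t l (RtoC 1 : C_R_NormedModule) Hl).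
      * apply (is_derive_scal_l (fun s => Im (f s)) t m (Ci : C_R_NormedModule) Hm).
    + apply injective_projections; cbn; ring.
Qed.

Lemma ex_derive_Re (f : R -> C) t : ex_derive (V := C_R_NormedModule) f t ->
  ex_derive (fun s => Re (f s)) t.
Proof.
  intros [[a b] H]; exists a.
  apply (filterdiff_comp' (V := C_R_NormedModule) f (fun z : C_R_NormedModule => fst z) t
    (fun y : R => scal y ((a, b) : C_R_NormedModule)) (fun z : C_R_NormedModule => fst z)).
  - exact H.
  - apply (filterdiff_linear (U := C_R_NormedModule)).
    split; [reflexivity|reflexivity|].
    exists 1; split; [lra|]; intros z; rewrite Rmult_1_l; rewrite <- Cmod_norm; apply re_le_Cmod.
Qed.

Lemma ex_derive_Im (f : R -> C) t : ex_derive (V := C_R_NormedModule) f t ->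
  ex_derive (fun s => Im (f s)) t.
Proof.
  intros [[a b] H]; exists b.
  apply (filterdiff_comp' (V := C_R_NormedModule) f (fun z : C_R_NormedModule => snd z) t
    (fun y : R => scal y ((a, b) : C_R_NormedModule)) (fun z : C_R_NormedModule => snd z)).
  - exact H.
  - apply (filterdiff_linear (U := C_R_NormedModule)).
    split; [reflexivity|reflexivity|].
    exists 1; split; [lra|]; intros z; rewrite Rmult_1_l, <- Cmod_norm.
    destruct z as [x y]; apply Rle_trans with (2 := Rmax_Cmod _), Rmax_r.
Qed.

Lemma continuous_C {T : UniformSpace} (F : T -> C) p :
  continuous (fun q => Re (F q)) p -> continuous (fun q => Im (F q)) p ->
  continuous (U := C_UniformSpace) F p.
Proof.
  intros H1 H2.
  apply (continuous_ext (U := C_UniformSpace) (fun q => (Re (F q), Im (F q)))).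
  - intros q; destruct (F q); reflexivity.
  - apply (continuous_pair (fun q => Re (F q)) (fun q => Im (F q)) p H1 H2).
Qed.

Lemma continuous_on_all {T U : UniformSpace} (S : T -> Prop) (f : T -> U) :
  (forall p, S p -> continuous f p) -> continuous_on S f.
Proof.
  intros H p Hp P HP; apply (filter_le_within (F := locally p)), (H p Hp P HP).
Qed.

(** Agreement with f1 and f2 is asked on U only, because the induction passes to [dx F] and [dy F],
    whose components are known there alone. *)
Lemma Cn2_Ck n (U : R * R -> Prop) (F : R * R -> C) (f1 f2 : R * R -> R) :
  open U ->
  (forall p, U p -> Re (F p) = f1 p) -> (forall p, U p -> Im (F p) = f2 p) ->
  Ck (fun _ => True) n U f1 -> Ck (fun _ => True) n U f2 -> Cn2 n U F.
Proof.
  intros HU; revert F f1 f2; induction n as [|n IH]; intros F f1 f2 E1 E2 K1 K2.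
  - apply continuous_on_all; intros p Hp; apply continuous_C.
    + apply (continuous_ext_open U f1); auto.
      * intros; symmetry; auto.
      * apply (Ck_cont _ _ _ _ K1 p Hp).
    + apply (continuous_ext_open U f2); auto.
      * intros; symmetry; auto.
      * apply (Ck_cont _ _ _ _ K2 p Hp).
  - destruct K1 as [_ K1], K2 as [_ K2].
    assert (H : forall d, exists g1 g2,
      (forall p, U p -> is_pd d (fun q => Re (F q)) p (g1 p)) /\
      (forall p, U p -> is_pd d (fun q => Im (F q)) p (g2 p)) /\
      Ck (fun _ => True) n U g1 /\ Ck (fun _ => True) n U g2).
    { intros d; destruct (K1 d I) as [g1 [G1 L1]], (K2 d I) as [g2 [G2 L2]].
      exists g1, g2; split; [|split; [|split]]; auto; intros p Hp.
      - apply (is_pd_ext d U f1); auto; intros; symmetry; auto.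
      - apply (is_pd_ext d U f2); auto; intros; symmetry; auto. }
    destruct (H true) as [a1 [a2 [A1 [A2 [A3 A4]]]]].
    destruct (H false) as [b1 [b2 [B1 [B2 [B3 B4]]]]].
    split; [|split].
    + intros p Hp; split.
      * exists (a1 p, a2 p); apply is_derive_C; [apply A1|apply A2]; auto.
      * exists (b1 p, b2 p); apply is_derive_C; [apply B1|apply B2]; auto.
    + apply (IH _ a1 a2); auto; intros p Hp; apply is_derive_unique;
        [apply A1|apply A2]; auto.
    + apply (IH _ b1 b2); auto; intros p Hp; apply is_derive_unique;
        [apply B1|apply B2]; auto.
Qed.

Definition xdir (d : bool) : Prop := d = true.
Definition alldir (d : bool) : Prop := True.

(** Reading a function of one variable as a function on the plane, differentiated in the first
    direction, puts the boundary data in the same calculus as u and v. *)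
Lemma Ck_Cn1 n (J : R -> Prop) (f : R -> C) : open J -> Cn1 n J f ->
  Ck xdir n (fun p => J (fst p)) (fun p => Re (f (fst p))) /\
  Ck xdir n (fun p => J (fst p)) (fun p => Im (f (fst p))).
Proof.
  intros HJ; revert f; induction n as [|n IH]; intros f Hf.
  - split; (split; [|exact I]); intros p Hp.
    + apply (continuous_comp (fun q : R * R => fst q) (fun t => Re (f t)));
        [apply continuous_Rfst|].
      apply (continuous_comp f (fun z : C_UniformSpace => fst z)).
      * apply (continuous_continuous_on J); auto.
      * destruct (f (fst p)); apply continuous_fst.
    + apply (continuous_comp (fun q : R * R => fst q) (fun t => Im (f t)));
        [apply continuous_Rfst|].
      apply (continuous_comp f (fun z : C_UniformSpace => snd z)).
      * apply (continuous_continuous_on J); auto.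
      * destruct (f (fst p)); apply continuous_snd.
  - destruct Hf as [H1 H2]; destruct (IH _ H2) as [I1 I2].
    split; apply Ck_intro.
    + intros p Hp.
      apply (continuous_comp (fun q : R * R => fst q) (fun t => Re (f t)));
        [apply continuous_Rfst|apply continuous_diff, ex_derive_Re; auto].
    + intros d ->; exists (fun p => Re (deriv f (fst p))); split; auto.
      intros p Hp; apply Derive_correct, ex_derive_Re; auto.
    + intros p Hp.
      apply (continuous_comp (fun q : R * R => fst q) (fun t => Im (f t)));
        [apply continuous_Rfst|apply continuous_diff, ex_derive_Im; auto].
    + intros d ->; exists (fun p => Im (deriv f (fst p))); split; auto.
      intros p Hp; apply Derive_correct, ex_derive_Im; auto.
Qed.

(** * Integrals along vertical segments *)

Definition clamp (t : R) : R := Rmax 0 (Rmin t 1).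

Lemma clamp_bounds t : 0 <= clamp t <= 1.
Proof. unfold clamp, Rmax, Rmin; repeat destruct Rle_dec; lra. Qed.

Lemma clamp_id t : 0 <= t <= 1 -> clamp t = t.
Proof. unfold clamp, Rmax, Rmin; repeat destruct Rle_dec; lra. Qed.

Lemma clamp_lip s t : Rabs (clamp s - clamp t) <= Rabs (s - t).
Proof. unfold clamp, Rmax, Rmin, Rabs; repeat destruct Rle_dec; repeat destruct Rcase_abs; lra. Qed.

Lemma clamp_mono s t : s <= t -> clamp s <= clamp t.
Proof. unfold clamp, Rmax, Rmin; repeat destruct Rle_dec; lra. Qed.

Lemma continuous_eps (f : R * R -> R) p :
  (forall eps, 0 < eps -> exists d, 0 < d /\ forall q,
     Rabs (fst q - fst p) < d -> Rabs (snd q - snd p) < d ->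
     Rabs (f q - f p) < eps) -> continuous f p.
Proof.
  intros H; apply filterlim_locally; intros [e He].
  destruct (H e He) as [d [Hd H']].
  exists (mkposreal d Hd); intros q [Q1 Q2]; apply H'; assumption.
Qed.

Lemma continuous_slice (f : R * R -> R) d p :
  continuous f p -> continuous (slice d f p) (crd d p).
Proof.
  intros H; destruct p as [x y]; destruct d; unfold slice; simpl.
  - apply (continuous_comp (fun t => (t, y)) f); auto.
    apply continuous_pair; [apply continuous_id|apply continuous_const].
  - apply (continuous_comp (fun t => (x, t)) f); auto.
    apply continuous_pair; [apply continuous_const|apply continuous_id].
Qed.

Lemma continuous_vert (f : R * R -> R) x y :
  continuous f (x, y) -> continuous (fun s => f (x, s)) y.
Proof. apply (continuous_slice f false (x, y)). Qed.

Lemma continuous_2d (f : R * R -> R) x y :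
  continuous f (x, y) -> continuity_2d_pt (fun u v => f (u, v)) x y.
Proof.
  intros H; apply continuity_2d_pt_filterlim.
  apply (continuous_ext f (fun z => f (fst z, snd z)) (x, y)); auto.
  intros [u v]; reflexivity.
Qed.

Lemma clamp_continuous t : continuous clamp t.
Proof.
  apply filterlim_locally; intros e; exists e; intros s Hs.
  apply Rle_lt_trans with (2 := Hs), clamp_lip.
Qed.

Lemma ball_box (U : R * R -> Prop) x y : open U -> U (x, y) ->
  exists e, 0 < e /\ forall u v, Rabs (u - x) < e -> Rabs (v - y) < e -> U (u, v).
Proof.
  intros HU Hp; destruct (HU _ Hp) as [[e He] H]; exists e; split; auto.
  intros u v Hu Hv; apply H; split; assumption.
Qed.

(* Clamping makes functions built from such integrals total on the plane and
   constant in y for y <= 0, so that points of the axis y = 0 can be treated as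
   interior points when differentiating in x. *)
Definition vint (h : R * R -> R) (p : R * R) : R :=
  RInt (fun s => h (fst p, s)) 0 (clamp (snd p)).

(** The domain of dependence of [vint]. With [clamp y] instead of y, a point with y <= 0 only
    requires the axis point (x, 0), so that a closed-off domain may still be open across y = 0. *)
Definition colclosed (W : R * R -> Prop) : Prop :=
  forall x y s, W (x, y) -> 0 <= s <= clamp y -> W (x, s).

Lemma ex_RInt_col (W : R * R -> Prop) (h : R * R -> R) x y : colclosed W -> W (x, y) ->
  (forall p, W p -> continuous h p) ->
  forall a b, 0 <= a <= clamp y -> 0 <= b <= clamp y -> ex_RInt (fun s => h (x, s)) a b.
Proof.
  intros HW Hp Hh a b Ha Hb; apply (ex_RInt_continuous (V := R_CompleteNormedModule)).
  intros s Hs; apply continuous_vert, Hh, (HW x y); auto.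
  revert Hs; unfold Rmin, Rmax; repeat destruct Rle_dec; lra.
Qed.

(** Moving x changes the integrand, which uniform continuity on a compact rectangle controls; moving
    y changes the endpoint, which a bound for the integrand on the central column controls. *)
Lemma vint_continuous (W : R * R -> Prop) (h : R * R -> R) : open W -> colclosed W ->
  (forall p, W p -> continuous h p) -> forall p, W p -> continuous (vint h) p.
Proof.
  intros HO HW Hh [x0 y0] Hp; apply continuous_eps; intros eps Heps; simpl.
  set (Y := clamp y0).
  assert (HY := clamp_bounds y0); fold Y in HY.
  destruct (ball_box W x0 Y HO) as [e [He HB]].
  { apply (HW x0 y0); auto; fold Y; lra. }
  (* The rectangle has to reach slightly above Y in order to contain the endpoints [clamp y] of
     nearby points. *)
  set (T := clamp (Y + e / 2)).
  assert (HT : Y <= T <= 1).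
  { split; [|apply clamp_bounds].
    unfold T; rewrite <- (clamp_id Y) at 1; auto; apply clamp_mono; lra. }
  assert (Hrect : forall x s, x0 - e / 2 <= x <= x0 + e / 2 -> 0 <= s <= T -> W (x, s)).
  { intros x s Hx Hs; apply (HW x (Y + e / 2)); auto.
    apply HB; apply Rabs_def1; lra. }
  destruct (uniform_continuity_2d (fun u v => h (u, v)) (x0 - e / 2) (x0 + e / 2) 0 T)
    with (eps := mkposreal (eps / 2) (is_pos_div_2 (mkposreal eps Heps)))
    as [[d Hd] HUC].
  { intros x s Hx Hs; apply continuous_2d, Hh; auto. }
  simpl in HUC.
  destruct (continuity_ab_maj (fun s => Rabs (h (x0, s))) 0 T) as [sM [HM _]].
  { lra. }
  { intros s Hs; apply continuity_pt_filterlim, (continuous_comp (fun s => h (x0, s)) Rabs).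
    - apply continuous_vert, Hh, Hrect; lra.
    - apply continuous_Rabs. }
  set (M := Rabs (h (x0, sM))) in HM.
  assert (M0 : 0 <= M) by apply Rabs_pos.
  exists (Rmin (e / 2) (Rmin d (eps / 2 / (M + 1)))); split.
  { repeat apply Rmin_pos; try lra; apply Rdiv_lt_0_compat; lra. }
  intros [x y] Hx Hy; simpl in Hx, Hy.
  assert (Hx1 := Rlt_le_trans _ _ _ Hx (Rmin_l _ _)).
  assert (Hx2 := Rlt_le_trans _ _ _ Hx (Rle_trans _ _ _ (Rmin_r _ _) (Rmin_l _ _))).
  assert (Hy1 := Rlt_le_trans _ _ _ Hy (Rmin_l _ _)).
  assert (Hy2 := Rlt_le_trans _ _ _ Hy (Rle_trans _ _ _ (Rmin_r _ _) (Rmin_r _ _))).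
  apply Rabs_lt_between in Hx1.
  assert (HyT : 0 <= clamp y <= T).
  { split; [apply clamp_bounds|].
    unfold T; rewrite <- (clamp_id (clamp y)) by apply clamp_bounds; apply clamp_mono.
    assert (L := clamp_lip y y0); fold Y in L.
    assert (L2 := Rle_abs (clamp y - Y)); lra. }
  assert (Hc : forall x s, x0 - e / 2 <= x <= x0 + e / 2 -> 0 <= s <= T ->
              continuous (fun s => h (x, s)) s)
    by (intros; apply continuous_vert, Hh, Hrect; auto).
  assert (Hex : forall x a b, x0 - e / 2 <= x <= x0 + e / 2 -> 0 <= a <= T -> 0 <= b <= T ->
              ex_RInt (fun s => h (x, s)) a b).
  { intros x' a b Hx' Ha Hb; apply (ex_RInt_continuous (V := R_CompleteNormedModule)).
    intros s Hs; apply Hc; auto.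
    revert Hs; unfold Rmin, Rmax; repeat destruct Rle_dec; lra. }
  unfold vint; simpl; fold Y.
  replace (RInt (fun s => h (x, s)) 0 (clamp y) - RInt (fun s => h (x0, s)) 0 Y)
    with (RInt (fun s => h (x, s) - h (x0, s)) 0 (clamp y)
          + RInt (fun s => h (x0, s)) Y (clamp y)).
  - apply Rle_lt_trans with (1 := Rabs_triang _ _).
    assert (I1 : Rabs (RInt (fun s => h (x, s) - h (x0, s)) 0 (clamp y)) <= (clamp y - 0) * (eps / 2)).
    { apply abs_RInt_le_const; [lra| |].
      - apply (ex_RInt_minus (V := R_NormedModule)); apply Hex; lra.
      - intros s Hs; left; apply HUC; try lra.
        rewrite Rminus_diag, Rabs_R0; auto. }
    assert (I2 : Rabs (RInt (fun s => h (x0, s)) Y (clamp y)) <= Rabs (clamp y - Y) * M).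
    { destruct (Rle_dec Y (clamp y)).
      - rewrite (Rabs_pos_eq (clamp y - Y)) by lra.
        apply abs_RInt_le_const; [lra|apply Hex; lra|].
        intros; apply HM; lra.
      - rewrite <- (opp_RInt_swap (V := R_CompleteNormedModule)) by (apply Hex; lra).
        change (Rabs (- RInt (fun s => h (x0, s)) (clamp y) Y) <= Rabs (clamp y - Y) * M).
        rewrite Rabs_Ropp, (Rabs_minus_sym (clamp y)), (Rabs_pos_eq (Y - clamp y)) by lra.
        apply abs_RInt_le_const; [lra|apply Hex; lra|].
        intros; apply HM; lra. }
    assert (L := clamp_lip y y0); fold Y in L.
    assert (I3 : Rabs (clamp y - Y) * M < eps / 2).
    { apply Rle_lt_trans with (Rabs (clamp y - Y) * (M + 1)).
      - apply Rmult_le_compat_l; [apply Rabs_pos|lra].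
      - apply Rmult_lt_reg_r with (/ (M + 1)).
        + apply Rinv_0_lt_compat; lra.
        + rewrite Rmult_assoc, Rinv_r, Rmult_1_r by lra.
          unfold Rdiv in Hy2 at 2; lra. }
    assert (clamp y <= 1) by apply clamp_bounds.
    nra.
  - rewrite (RInt_minus (V := R_CompleteNormedModule)) by (apply Hex; lra).
    rewrite <- (RInt_Chasles (V := R_CompleteNormedModule) (fun s => h (x0, s)) 0 Y (clamp y))
      by (apply Hex; lra).
    unfold plus, minus, opp; simpl; unfold plus; simpl.
    ring.
Qed.

Lemma vint_pd_y (W : R * R -> Prop) (h : R * R -> R) p : open W -> colclosed W ->
  (forall p, W p -> continuous h p) -> W p -> 0 < snd p < 1 ->
  is_pd false (vint h) p (h p).
Proof.
  intros HO HW Hh Hp Hy; destruct p as [x y]; unfold is_pd, slice, vint; simpl in *.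
  destruct (ball_box W x y HO Hp) as [e [He HB]].
  assert (He' : 0 < Rmin e (Rmin y (1 - y))) by (repeat apply Rmin_pos; lra).
  assert (Hl : forall t, Rabs (t - y) < Rmin e (Rmin y (1 - y)) -> W (x, t) /\ 0 <= t <= 1).
  { intros t Ht.
    assert (T1 := Rlt_le_trans _ _ _ Ht (Rmin_l _ _)).
    assert (T2 := Rlt_le_trans _ _ _ Ht (Rle_trans _ _ _ (Rmin_r _ _) (Rmin_l _ _))).
    assert (T3 := Rlt_le_trans _ _ _ Ht (Rle_trans _ _ _ (Rmin_r _ _) (Rmin_r _ _))).
    split.
    - apply HB; auto; rewrite Rminus_diag, Rabs_R0; auto.
    - apply Rabs_lt_between in T2; apply Rabs_lt_between in T3; lra. }
  apply (is_derive_ext_loc (fun t => RInt (fun s => h (x, s)) 0 t)).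
  { exists (mkposreal _ He'); intros t Ht; apply Hl in Ht; rewrite clamp_id; tauto. }
  apply (is_derive_RInt (V := R_NormedModule) (fun s => h (x, s)) _ 0).
  - exists (mkposreal _ He'); intros t Ht; apply Hl in Ht; destruct Ht as [H1 H2].
    apply (RInt_correct (V := R_CompleteNormedModule)).
    apply (ex_RInt_col W h x t); auto; rewrite clamp_id; lra.
  - apply continuous_vert; auto.
Qed.

Lemma is_derive_RInt_x (W : R * R -> Prop) (h g : R * R -> R) x a b : open W ->
  (forall s, Rmin a b <= s <= Rmax a b -> W (x, s)) ->
  (exists e, 0 < e /\ forall u, Rabs (u - x) < e ->
     forall s, Rmin a b <= s <= Rmax a b -> W (u, s)) ->
  (forall p, W p -> continuous h p) -> (forall p, W p -> continuous g p) ->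
  (forall p, W p -> is_pd true h p (g p)) ->
  is_derive (fun u => RInt (fun s => h (u, s)) a b) x (RInt (fun s => g (x, s)) a b).
Proof.
  intros HO Hx [e [He Hn]] Hh Hg Hd.
  rewrite (RInt_ext (fun s => g (x, s)) (fun s => Derive (fun u => h (u, s)) x)).
  2: { intros s Hs; symmetry; apply (is_pd_unique true h (x, s)), Hd, Hx; lra. }
  apply is_derive_RInt_param.
  - exists (mkposreal e He); intros u Hu s Hs; exists (g (u, s)).
    apply (Hd (u, s)); auto.
  - intros s Hs; apply (continuous_2d (fun p => Derive (fun z => h (z, snd p)) (fst p))).
    apply (continuous_ext_open W g); auto.
    intros q Hq; symmetry; apply (is_pd_unique true h q); auto.
  - exists (mkposreal e He); intros u Hu.
    apply (ex_RInt_continuous (V := R_CompleteNormedModule)).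
    intros s Hs; apply continuous_vert; auto.
Qed.

Lemma vint_pd_x (W : R * R -> Prop) (h g : R * R -> R) p : open W -> colclosed W ->
  (forall p, W p -> continuous h p) -> (forall p, W p -> continuous g p) ->
  (forall p, W p -> is_pd true h p (g p)) -> W p ->
  is_pd true (vint h) p (vint g p).
Proof.
  intros HO HW Hh Hg Hd Hp; destruct p as [x y]; unfold is_pd, slice, vint; simpl.
  assert (Hc := clamp_bounds y).
  apply (is_derive_RInt_x W); auto.
  - rewrite Rmin_left, Rmax_right by lra.
    intros s Hs; apply (HW x y); auto.
  - destruct (ball_box W x y HO Hp) as [e [He HB]]; exists e; split; auto.
    rewrite Rmin_left, Rmax_right by lra.
    intros u Hu s Hs; apply (HW u y); auto.
    apply HB; auto; rewrite Rminus_diag, Rabs_R0; auto.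
Qed.

Lemma Ck_vint k (W : R * R -> Prop) (h : R * R -> R) : open W -> colclosed W ->
  Ck xdir k W h -> Ck xdir k W (vint h).
Proof.
  intros HO HW; revert h; induction k as [|k IH]; intros h Hh.
  - split; auto; apply vint_continuous; auto; apply (Ck_cont _ _ _ _ Hh).
  - apply Ck_intro.
    + apply vint_continuous; auto; apply (Ck_cont _ _ _ _ Hh).
    + intros d ->; destruct Hh as [H1 H2], (H2 true eq_refl) as [g [Hg Kg]].
      exists (vint g); split; auto.
      intros p Hp; apply (vint_pd_x W); auto; apply (Ck_cont _ _ _ _ Kg).
Qed.

Lemma is_pd_RInt_derive (U : R * R -> Prop) (w f : R * R -> R) x a b :
  (forall s, Rmin a b <= s <= Rmax a b -> U (x, s)) ->
  (forall p, U p -> is_pd false w p (f p)) -> (forall p, U p -> continuous f p) ->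
  RInt (fun s => f (x, s)) a b = w (x, b) - w (x, a).
Proof.
  intros HU Hw Hf; apply is_RInt_unique.
  apply (is_RInt_derive (V := R_CompleteNormedModule) (fun s => w (x, s))).
  - intros s Hs; apply (Hw (x, s)); auto.
  - intros s Hs; apply continuous_vert; auto.
Qed.

(** An asymmetric Schwarz theorem: the derivative of g = w_x in y is not assumed to exist.
    Differentiating w(u, t) = w(u, y) + int_y^t f(u, s) ds in u gives g(x, t) = g(x, y) + int_y^t
    k(x, s) ds, whose derivative in t is k. *)
Lemma pd_swap (U : R * R -> Prop) (w g f k : R * R -> R) p : open U ->
  (forall p, U p -> is_pd true w p (g p)) ->
  (forall p, U p -> is_pd false w p (f p)) ->
  (forall p, U p -> is_pd true f p (k p)) ->
  (forall p, U p -> continuous f p) -> (forall p, U p -> continuous k p) ->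
  U p -> is_pd false g p (k p).
Proof.
  intros HO Hg Hf Hk Cf Cg Hp; destruct p as [x y]; unfold is_pd, slice; simpl.
  destruct (ball_box U x y HO Hp) as [e [He HB]].
  assert (Hseg : forall u t s, Rabs (u - x) < e -> Rabs (t - y) < e ->
            Rmin y t <= s <= Rmax y t -> U (u, s)).
  { intros u t s Hu Ht Hs; apply HB; auto; apply Rabs_def1;
      apply Rabs_lt_between in Ht; revert Hs; unfold Rmin, Rmax; destruct Rle_dec; lra. }
  assert (Hxx : Rabs (x - x) < e) by (rewrite Rminus_diag, Rabs_R0; auto).
  assert (Hyy : Rabs (y - y) < e) by (rewrite Rminus_diag, Rabs_R0; auto).
  apply (is_derive_ext_loc (fun t => g (x, y) + RInt (fun s => k (x, s)) y t)).
  - exists (mkposreal e He); intros t Ht.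
    assert (D1 : is_derive (fun u => w (u, y) + RInt (fun s => f (u, s)) y t) x
                   (g (x, y) + RInt (fun s => k (x, s)) y t)).
    { apply (is_derive_plus (V := R_NormedModule) (fun u => w (u, y))).
      - apply (Hg (x, y)); auto.
      - apply (is_derive_RInt_x U); auto.
        + intros s Hs; apply (Hseg x t); auto.
        + exists e; split; auto; intros u Hu s Hs; apply (Hseg u t); auto. }
    assert (D2 : is_derive (fun u => w (u, t)) x (g (x, y) + RInt (fun s => k (x, s)) y t)).
    { refine (is_derive_ext_loc _ _ _ _ _ D1).
      exists (mkposreal e He); intros u Hu.
      assert (Eq := is_pd_RInt_derive U w f u y t
                      (fun s => Hseg u t s Hu Ht) Hf Cf).
      refine (eq_trans (f_equal (Rplus (w (u, y))) Eq) _).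
      change (w (u, y) + (w (u, t) - w (u, y)) = w (u, t) :> R); ring. }
    rewrite <- (is_derive_unique _ _ _ D2).
    apply (is_pd_unique true w (x, t)), Hg, HB; auto.
  - rewrite <- (Rplus_0_l (k (x, y))).
    apply (is_derive_plus (V := R_NormedModule) (fun _ => g (x, y))).
    + apply (is_derive_const (g (x, y) : R_NormedModule)).
    + apply (is_derive_RInt (V := R_NormedModule) (fun s => k (x, s)) _ y).
      * exists (mkposreal e He); intros t Ht.
        apply (RInt_correct (V := R_CompleteNormedModule)).
        apply (ex_RInt_continuous (V := R_CompleteNormedModule)).
        intros s Hs; apply continuous_vert, Cg, (Hseg x t); auto.
      * apply continuous_vert; auto.
Qed.

(** * The characteristic system *)

Lemma half_pow_small K : 0 <= K -> forall eps, 0 < eps ->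
  exists n : nat, K * (/ 2) ^ n < eps.
Proof.
  intros HK eps He.
  destruct (pow_lt_1_zero (/ 2)) with (y := eps / (K + 1)) as [n Hn].
  - rewrite Rabs_pos_eq; lra.
  - apply Rdiv_lt_0_compat; lra.
  - exists n; specialize (Hn n (le_n n)).
    assert (P : 0 < (/ 2) ^ n) by (apply pow_lt; lra).
    rewrite Rabs_pos_eq in Hn by lra.
    apply Rle_lt_trans with ((K + 1) * (/ 2) ^ n); [nra|].
    apply Rmult_lt_compat_l with (r := K + 1) in Hn; [|lra].
    replace ((K + 1) * (eps / (K + 1))) with eps in Hn by (field; lra); exact Hn.
Qed.

Lemma geometric_limit (x : nat -> R) K :
  (forall n, Rabs (x (S n) - x n) <= K * (/ 2) ^ n) ->
  forall n, Rabs (real (Lim_seq x) - x n) <= 2 * K * (/ 2) ^ n.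
Proof.
  intros Hx.
  assert (HK : 0 <= K) by (assert (H := Hx O); assert (H' := Rabs_pos (x 1%nat - x O));
                           simpl in H; lra).
  assert (Htail : forall n k, Rabs (x (n + k)%nat - x n) <= 2 * K * ((/ 2) ^ n - (/ 2) ^ (n + k))).
  { intros n k; induction k as [|k IH].
    - rewrite Nat.add_0_r, Rminus_diag, Rabs_R0; lra.
    - rewrite Nat.add_succ_r.
      replace (x (S (n + k)) - x n) with ((x (S (n + k)) - x (n + k)%nat) + (x (n + k)%nat - x n)) by ring.
      apply Rle_trans with (1 := Rabs_triang _ _).
      specialize (Hx (n + k)%nat); simpl; lra. }
  assert (Htail' : forall n k, (n <= k)%nat -> Rabs (x k - x n) <= 2 * K * (/ 2) ^ n).
  { intros n k Hk; replace k with (n + (k - n))%nat by lia.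
    apply Rle_trans with (1 := Htail _ _).
    assert (0 < (/ 2) ^ (n + (k - n))) by (apply pow_lt; lra); nra. }
  assert (Hcv : ex_finite_lim_seq x).
  { apply ex_lim_seq_cauchy_corr; intros [eps He]; simpl.
    destruct (half_pow_small (4 * K)) with (eps := eps) as [N HN]; [lra|auto|].
    exists N; intros n m Hn Hm.
    replace (x n - x m) with ((x n - x N) - (x m - x N)) by ring.
    apply Rle_lt_trans with (1 := Rabs_triang _ _); rewrite Rabs_Ropp.
    assert (H1 := Htail' N n Hn); assert (H2 := Htail' N m Hm); lra. }
  apply Lim_seq_correct' in Hcv.
  intros n.
  apply (is_lim_seq_le_loc (fun k => Rabs (x k - x n)) (fun _ => 2 * K * (/ 2) ^ n)
           (Rabs (real (Lim_seq x) - x n)) (2 * K * (/ 2) ^ n)).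
  - exists n; intros k Hk; auto.
  - apply (is_lim_seq_abs (fun k => x k - x n) (Finite (real (Lim_seq x) - x n))).
    apply is_lim_seq_minus'; auto; apply is_lim_seq_const.
  - apply is_lim_seq_const.
Qed.

(** Banach's theorem for the sup norm with weight w, on an invariant class K closed under uniform
    limits. The limit is taken pointwise with [Lim_seq], so no complete function space has to be
    built, and the bound W turns weighted into uniform convergence. The fixed-point equation is
    pointwise, in the absence of functional extensionality. *)
Lemma contraction_fixpoint {I T : Type} (w : T -> R) (W : R)
    (K : (I -> T -> R) -> Prop) (F : (I -> T -> R) -> I -> T -> R)
    (v0 : I -> T -> R) (d0 : R) :
  (forall t, 0 <= w t <= W) -> 0 <= d0 ->
  K v0 -> (forall v, K v -> K (F v)) ->
  (forall vn v, (forall n : nat, K (vn n)) ->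
     (forall eps, 0 < eps -> exists n, forall i t, Rabs (v i t - vn n i t) <= eps) ->
     K v) ->
  (forall v v' d, 0 <= d -> K v -> K v' ->
     (forall i t, Rabs (v i t - v' i t) <= d * w t) ->
     forall i t, Rabs (F v i t - F v' i t) <= d / 2 * w t) ->
  (forall i t, Rabs (F v0 i t - v0 i t) <= d0 * w t) ->
  exists v, K v /\ forall i t, F v i t = v i t.
Proof.
  intros Hw Hd0 HK0 HKF HKlim Hc H0.
  set (vn := fix vn n := match n with O => v0 | S m => F (vn m) end).
  assert (HK : forall n, K (vn n)) by (induction n; simpl; auto).
  assert (Hp : forall n, 0 < (/ 2) ^ n) by (intros; apply pow_lt; lra).
  assert (Hstep : forall n i t, Rabs (vn (S n) i t - vn n i t) <= (d0 * (/ 2) ^ n) * w t).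
  { induction n as [|n IH]; intros i t.
    - simpl; rewrite Rmult_1_r; apply H0.
    - replace (d0 * (/ 2) ^ S n) with (d0 * (/ 2) ^ n / 2) by (simpl; field).
      apply (Hc (vn (S n)) (vn n)); auto.
      assert (P := Hp n); nra. }
  set (v := fun i t => real (Lim_seq (fun n => vn n i t))).
  assert (Hv : forall n i t, Rabs (v i t - vn n i t) <= (2 * d0 * (/ 2) ^ n) * w t).
  { intros n i t; replace (2 * d0 * (/ 2) ^ n * w t) with (2 * (d0 * w t) * (/ 2) ^ n) by ring.
    apply (geometric_limit (fun n => vn n i t)); intros m.
    replace (d0 * w t * (/ 2) ^ m) with (d0 * (/ 2) ^ m * w t) by ring; apply Hstep. }
  exists v.
  assert (HKv : K v).
  { apply (HKlim vn); auto; intros eps He.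
    (* T may be empty, so W itself is not known to be nonnegative. *)
    destruct (half_pow_small (2 * d0 * Rmax W 0)) with (eps := eps) as [n Hn]; auto.
    { apply Rmult_le_pos; [lra|apply Rmax_r]. }
    exists n; intros i t; apply Rle_trans with (1 := Hv n i t).
    apply Rlt_le, Rle_lt_trans with (2 := Hn).
    replace (2 * d0 * Rmax W 0 * (/ 2) ^ n) with (2 * d0 * (/ 2) ^ n * Rmax W 0) by ring.
    apply Rmult_le_compat_l; [assert (P := Hp n); nra|].
    apply Rle_trans with W; [apply Hw|apply Rmax_l]. }
  split; auto.
  intros i t; apply cond_eq; intros eps He.
  destruct (half_pow_small (2 * d0 * w t)) with (eps := eps) as [n Hn]; auto.
  { assert (P := Hw t); nra. }
  replace (F v i t - v i t) with ((F v i t - vn (S n) i t) - (v i t - vn (S n) i t)) by ring.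
  apply Rle_lt_trans with (1 := Rabs_triang _ _); rewrite Rabs_Ropp.
  assert (H1 : Rabs (F v i t - vn (S n) i t) <= 2 * d0 * (/ 2) ^ n / 2 * w t).
  { apply (Hc v (vn n)); auto; assert (P := Hp n); nra. }
  assert (H2 := Hv (S n) i t); simpl pow in H2.
  assert (E : 2 * d0 * (/ 2) ^ n / 2 * w t + 2 * d0 * (/ 2 * (/ 2) ^ n) * w t
              = 2 * d0 * w t * (/ 2) ^ n) by field.
  lra.
Qed.

(** * Weighted estimates and the solution operator of one characteristic equation *)

Definition wt (l : R) (p : R * R) : R := exp (l * (clamp (fst p) + clamp (snd p))).

Lemma exp_mono x y : x <= y -> exp x <= exp y.
Proof. intros [H | ->]; [left; apply exp_increasing; auto|right; auto]. Qed.

Lemma wt_bounds l p : 0 <= l -> 1 <= wt l p <= exp (2 * l).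
Proof.
  intros Hl; unfold wt.
  assert (B1 := clamp_bounds (fst p)); assert (B2 := clamp_bounds (snd p)).
  split.
  - rewrite <- exp_0; apply exp_mono; nra.
  - apply exp_mono; nra.
Qed.

Definition everywhere (p : R * R) : Prop := True.

Lemma open_everywhere : open everywhere.
Proof. intros p _; apply filter_forall; intros; exact I. Qed.

Lemma colclosed_everywhere : colclosed everywhere.
Proof. intros x y s _ _; exact I. Qed.

Lemma vint_cont f : (forall p, continuous f p) -> forall p, continuous (vint f) p.
Proof.
  intros Hf p; apply (vint_continuous everywhere);
    auto using open_everywhere, colclosed_everywhere; exact I.
Qed.

Lemma ex_RInt_cont (f : R * R -> R) x a b : (forall p, continuous f p) ->
  ex_RInt (fun s => f (x, s)) a b.
Proof.
  intros Hf; apply (ex_RInt_continuous (V := R_CompleteNormedModule)); intros.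
  apply continuous_vert, Hf.
Qed.

Lemma vint_minus f g p : (forall p, continuous f p) -> (forall p, continuous g p) ->
  vint f p - vint g p = vint (fun q => f q - g q) p.
Proof.
  intros Hf Hg; symmetry.
  apply (RInt_minus (V := R_CompleteNormedModule) (fun s => f (fst p, s))
           (fun s => g (fst p, s))); apply ex_RInt_cont; auto.
Qed.

(** The exponential weight reproduces itself under integration from 0, divided by l; a large l
    therefore makes any bounded integral coupling small. The weight is symmetric in the two
    variables and serves both equations. *)
Lemma vint_bound f C l p : 0 < l -> 0 <= C -> (forall p, continuous f p) ->
  (forall p, Rabs (f p) <= C * wt l p) -> Rabs (vint f p) <= C / l * wt l p.
Proof.
  intros Hl HC Hf Hb; destruct p as [x y]; unfold vint; simpl.
  assert (By := clamp_bounds y).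
  set (G := fun s => C / l * exp (l * (clamp x + s))).
  assert (HG : is_RInt (fun s => C * exp (l * (clamp x + s))) 0 (clamp y) (G (clamp y) - G 0)).
  { apply (is_RInt_derive (V := R_CompleteNormedModule) G).
    - intros s _; unfold G; auto_derive; auto; field; lra.
    - intros s _; apply continuous_diff; auto_derive; auto. }
  apply Rle_trans with (1 := abs_RInt_le _ _ _ (proj1 By) (ex_RInt_cont f x 0 (clamp y) Hf)).
  apply Rle_trans with (G (clamp y) - G 0).
  - rewrite <- (is_RInt_unique _ _ _ _ HG); apply RInt_le; try lra.
    + apply (ex_RInt_cont (fun q => Rabs (f q))).
      intros q; apply continuous_post; auto; apply continuous_Rabs.
    + eexists; exact HG.
    + intros s Hs; apply Rle_trans with (1 := Hb (x, s)); unfold wt; simpl.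
      rewrite (clamp_id s) by lra; lra.
  - unfold G, wt; simpl.
    assert (0 <= C / l) by (apply Rdiv_le_0_compat; auto).
    assert (0 < exp (l * (clamp x + 0))) by apply exp_pos; nra.
Qed.

Lemma vint_bound_const f C p : 0 <= C -> (forall p, continuous f p) ->
  (forall p, Rabs (f p) <= C) -> Rabs (vint f p) <= C.
Proof.
  intros HC Hf Hb; unfold vint; assert (By := clamp_bounds (snd p)).
  apply Rle_trans with ((clamp (snd p) - 0) * C); [|nra].
  apply abs_RInt_le_const; auto; try lra; apply ex_RInt_cont; auto.
Qed.

(* A pair of real functions, the components [true] and [false] being the real
   and imaginary parts of a complex function. *)
Definition field2 : Type := bool -> R * R -> R.

Definition phase (rho : R * R -> R) (v : field2) : R * R -> R :=
  vint (fun q => rho q * v false q).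

(** In complex notation this is h exp(- i phase) v, and [unrotated] is exp(- i phase) u for the
    solution u. *)
Definition source (rho h : R * R -> R) (v : field2) (i : bool) (q : R * R) : R :=
  h q * (if i then cos (phase rho v q) * v true q + sin (phase rho v q) * v false q
         else cos (phase rho v q) * v false q - sin (phase rho v q) * v true q).

Definition unrotated (rho h : R * R -> R) (a : bool -> R -> R) (v : field2)
    (i : bool) (p : R * R) : R :=
  a i (fst p) + vint (source rho h v i) p.

(* The solution u of u_y = i rho Im(v) u + h v with u = a on the axis y = 0,
   for a given v: the integrating factor is a rotation, so that the nonlinear
   term does not contribute to the growth of u. *)
Definition vsolve (rho h : R * R -> R) (a : bool -> R -> R) (v : field2) : field2 :=
  fun i p =>
    let c := cos (phase rho v p) in let s := sin (phase rho v p) in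
    let b := unrotated rho h a v in
    if i then c * b true p - s * b false p else s * b true p + c * b false p.

Definition fcont (v : field2) : Prop := forall i p, continuous (v i) p.

Definition swap (p : R * R) : R * R := (snd p, fst p).

Definition fswap (v : field2) : field2 := fun i p => v i (swap p).

Lemma continuous_swap (f : R * R -> R) p :
  continuous f (swap p) -> continuous (fun q => f (swap q)) p.
Proof.
  intros H; apply (continuous_comp swap f); auto.
  apply continuous_pair; [apply continuous_Rsnd|apply continuous_Rfst].
Qed.

Lemma fcont_swap v : fcont v -> fcont (fswap v).
Proof. intros H i p; apply continuous_swap, H. Qed.

Lemma wt_swap l p : wt l (swap p) = wt l p.
Proof. unfold wt, swap; simpl; f_equal; ring. Qed.

Lemma Rabs_cos_le x : Rabs (cos x) <= 1.
Proof. apply Rabs_le, COS_bound. Qed.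

Lemma Rabs_sin_le x : Rabs (sin x) <= 1.
Proof. apply Rabs_le, SIN_bound. Qed.

Lemma cos_lip x y : Rabs (cos x - cos y) <= Rabs (x - y).
Proof.
  destruct (MVT_gen cos y x (fun t => - sin t)) as [c [_ ->]].
  - intros; auto_derive; auto; ring.
  - intros; apply continuity_pt_filterlim, continuous_diff; auto_derive; auto.
  - rewrite Rabs_mult, Rabs_Ropp; assert (H := Rabs_sin_le c).
    assert (H' := Rabs_pos (x - y)); nra.
Qed.

Lemma sin_lip x y : Rabs (sin x - sin y) <= Rabs (x - y).
Proof.
  destruct (MVT_gen sin y x cos) as [c [_ ->]].
  - intros; auto_derive; auto; ring.
  - intros; apply continuity_pt_filterlim, continuous_diff; auto_derive; auto.
  - rewrite Rabs_mult; assert (H := Rabs_cos_le c).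
    assert (H' := Rabs_pos (x - y)); nra.
Qed.

Lemma Rabs_lin2 c s x y X Y : Rabs c <= 1 -> Rabs s <= 1 ->
  Rabs x <= X -> Rabs y <= Y ->
  Rabs (c * x + s * y) <= X + Y /\ Rabs (c * x - s * y) <= X + Y.
Proof.
  intros Hc Hs Hx Hy.
  assert (H1 : Rabs (c * x) <= X)
    by (rewrite Rabs_mult; assert (P := Rabs_pos x); assert (P' := Rabs_pos c); nra).
  assert (H2 : Rabs (s * y) <= Y)
    by (rewrite Rabs_mult; assert (P := Rabs_pos y); assert (P' := Rabs_pos s); nra).
  split; [apply Rle_trans with (1 := Rabs_triang _ _)|
          apply Rle_trans with (1 := Rabs_triang _ _); rewrite Rabs_Ropp]; lra.
Qed.

Lemma Rabs_prod_diff c c' x x' e X d : Rabs (c - c') <= e -> Rabs c' <= 1 ->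
  Rabs x <= X -> Rabs (x - x') <= d ->
  Rabs (c * x - c' * x') <= e * X + d.
Proof.
  intros He Hc Hx Hd.
  replace (c * x - c' * x') with ((c - c') * x + c' * (x - x')) by ring.
  apply Rle_trans with (1 := Rabs_triang _ _); rewrite !Rabs_mult.
  assert (P1 := Rabs_pos x); assert (P2 := Rabs_pos (c - c'));
    assert (P3 := Rabs_pos (x - x')); assert (P4 := Rabs_pos c'); nra.
Qed.

Lemma bound_nonneg {T : Type} (t : T) (f : T -> R) M :
  (forall x, Rabs (f x) <= M) -> 0 <= M.
Proof. intros H; apply Rle_trans with (2 := H t), Rabs_pos. Qed.

Section Vsolve.

Variables (rho h : R * R -> R) (a : bool -> R -> R) (rhoM H A : R).
Hypothesis rho_cont : forall p, continuous rho p.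
Hypothesis h_cont : forall p, continuous h p.
Hypothesis a_cont : forall i x, continuous (a i) x.
Hypothesis rho_bound : forall p, Rabs (rho p) <= rhoM.
Hypothesis h_bound : forall p, Rabs (h p) <= H.
Hypothesis a_bound : forall i x, Rabs (a i x) <= A.

Lemma phase_cont v : fcont v -> forall p, continuous (phase rho v) p.
Proof.
  intros Hv; apply vint_cont; intros p; apply continuous_Rmult; auto; apply Hv.
Qed.

Lemma continuous_cos_comp f p : continuous f p ->
  continuous (fun q : R * R => cos (f q)) p.
Proof.
  intros; apply continuous_post; auto; apply continuous_diff; auto_derive; auto.
Qed.

Lemma continuous_sin_comp f p : continuous f p ->
  continuous (fun q : R * R => sin (f q)) p.
Proof.
  intros; apply continuous_post; auto; apply continuous_diff; auto_derive; auto.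
Qed.

Lemma source_cont v : fcont v -> forall i p, continuous (source rho h v i) p.
Proof.
  intros Hv i p; unfold source; apply continuous_Rmult; auto.
  assert (Hc := continuous_cos_comp _ p (phase_cont v Hv p)).
  assert (Hs := continuous_sin_comp _ p (phase_cont v Hv p)).
  destruct i; [apply continuous_Rplus|apply continuous_Rminus];
    apply continuous_Rmult; auto; apply Hv.
Qed.

Lemma unrotated_cont v : fcont v -> forall i p, continuous (unrotated rho h a v i) p.
Proof.
  intros Hv i p; apply continuous_Rplus.
  - apply (continuous_post (a i)); auto; apply continuous_Rfst.
  - apply vint_cont, source_cont, Hv.
Qed.

Lemma vsolve_cont v : fcont v -> fcont (vsolve rho h a v).
Proof.
  intros Hv i p; unfold vsolve.
  assert (Hc := continuous_cos_comp _ p (phase_cont v Hv p)).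
  assert (Hs := continuous_sin_comp _ p (phase_cont v Hv p)).
  assert (Hb := unrotated_cont v Hv).
  destruct i; [apply continuous_Rminus|apply continuous_Rplus];
    apply continuous_Rmult; auto.
Qed.

Lemma source_le v i p V : (forall i, Rabs (v i p) <= V) ->
  Rabs (source rho h v i p) <= 2 * H * V.
Proof.
  intros Hv; unfold source; rewrite Rabs_mult.
  assert (HH := bound_nonneg (0, 0) _ _ h_bound); assert (P := Rabs_pos (h p)); assert (P' := h_bound p).
  assert (V0 : 0 <= V) by (apply Rle_trans with (2 := Hv true), Rabs_pos).
  assert (L := Rabs_lin2 (cos (phase rho v p)) (sin (phase rho v p)) _ _ V V
                 (Rabs_cos_le _) (Rabs_sin_le _) (Hv true) (Hv false)).
  assert (L' := Rabs_lin2 (cos (phase rho v p)) (sin (phase rho v p)) _ _ V V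
                 (Rabs_cos_le _) (Rabs_sin_le _) (Hv false) (Hv true)).
  destruct L as [L _], L' as [_ L'].
  replace (2 * H * V) with (H * (V + V)) by ring.
  apply Rmult_le_compat; auto using Rabs_pos; destruct i; auto using Rabs_pos.
Qed.

Lemma vsolve_le_unrotated v i p X : (forall i, Rabs (unrotated rho h a v i p) <= X) ->
  Rabs (vsolve rho h a v i p) <= 2 * X.
Proof.
  intros HX.
  assert (L := Rabs_lin2 (cos (phase rho v p)) (sin (phase rho v p)) _ _ X X
                 (Rabs_cos_le _) (Rabs_sin_le _) (HX true) (HX false)).
  assert (L' := Rabs_lin2 (sin (phase rho v p)) (cos (phase rho v p)) _ _ X X
                 (Rabs_sin_le _) (Rabs_cos_le _) (HX true) (HX false)).
  unfold vsolve; destruct i; lra.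
Qed.

(** A rotation preserves the modulus, so the bound is linear in A and B and independent of the
    rotation rate [rho]. Treating the two components separately costs only constant factors. *)
Lemma vsolve_bound v B l : 0 < l -> fcont v ->
  (forall i p, Rabs (v i p) <= B * wt l p) ->
  forall i p, Rabs (vsolve rho h a v i p) <= (2 * A + 4 * H * B / l) * wt l p.
Proof.
  intros Hl Hv HB i p.
  assert (W1 := wt_bounds l p (Rlt_le _ _ Hl)).
  assert (B0 : 0 <= B).
  { assert (P := Rle_trans _ _ _ (Rabs_pos _) (HB true p)); nra. }
  replace ((2 * A + 4 * H * B / l) * wt l p)
    with (2 * (A * wt l p + 2 * H * B / l * wt l p)) by (field; lra).
  apply vsolve_le_unrotated; clear i; intros i.
  apply Rle_trans with (1 := Rabs_triang _ _); apply Rplus_le_compat.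
  - assert (P := a_bound i (fst p)); assert (P' := bound_nonneg 0 _ _ (a_bound true)); nra.
  - apply vint_bound; auto.
    + assert (HH := bound_nonneg (0, 0) _ _ h_bound); nra.
    + apply source_cont, Hv.
    + intros q; rewrite Rmult_assoc; apply source_le; auto.
Qed.

(** Here the rotation rate does matter: changing v changes the angle, and this change is multiplied
    by the size of what is rotated. Hence the prior bound V; every contribution still passes through
    one integration and gains 1 / l. *)
Lemma vsolve_lip v v' V d l : 1 <= l -> 0 <= d -> fcont v -> fcont v' ->
  (forall i p, Rabs (v i p) <= V) ->
  (forall i p, Rabs (v i p - v' i p) <= d * wt l p) ->
  forall i p, Rabs (vsolve rho h a v i p - vsolve rho h a v' i p)
    <= (2 * rhoM * (A + 2 * H * V) + 4 * H * (rhoM * V + 1)) / l * (d * wt l p).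
Proof.
  intros Hl Hd Hv Hv' HV Hdiff.
  assert (H0 := bound_nonneg (0, 0) _ _ h_bound); assert (R0 := bound_nonneg (0, 0) _ _ rho_bound); assert (A0 := bound_nonneg 0 _ _ (a_bound true)).
  assert (V0 : 0 <= V) by (apply Rle_trans with (2 := HV true (0, 0)), Rabs_pos).
  assert (Hwt : forall p, 0 < wt l p) by (intros; apply exp_pos).
  assert (Hphase : forall p, Rabs (phase rho v p - phase rho v' p)
                             <= rhoM * d / l * wt l p).
  { intros p; unfold phase; rewrite vint_minus;
      try (intros; apply continuous_Rmult; auto; apply Hv || apply Hv').
    apply vint_bound; [lra|nra| |].
    - intros q; apply continuous_Rminus; apply continuous_Rmult; auto; apply Hv || apply Hv'.
    - intros q; rewrite <- Rmult_minus_distr_l, Rabs_mult, Rmult_assoc.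
      apply Rmult_le_compat; auto using Rabs_pos. }
  (* Inside the source the gain 1 / l of the phase is given up, because the integral of the source
     supplies its own. *)
  assert (Hrl : forall p, rhoM * d / l * wt l p <= rhoM * (d * wt l p)).
  { intros p; replace (rhoM * d / l * wt l p) with (rhoM * d * wt l p / l) by (field; lra).
    apply Rle_div_l; [lra|].
    assert (0 <= rhoM * (d * wt l p)) by (apply Rmult_le_pos; [auto|specialize (Hwt p); nra]).
    nra. }
  assert (Hc : forall p, Rabs (cos (phase rho v p) - cos (phase rho v' p))
                 <= rhoM * d / l * wt l p)
    by (intros p; apply Rle_trans with (1 := cos_lip _ _); auto).
  assert (Hs : forall p, Rabs (sin (phase rho v p) - sin (phase rho v' p))
                 <= rhoM * d / l * wt l p)
    by (intros p; apply Rle_trans with (1 := sin_lip _ _); auto).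
  assert (Hsource : forall i p, Rabs (source rho h v i p - source rho h v' i p)
                      <= 2 * H * (rhoM * V + 1) * d * wt l p).
  { intros i p; unfold source; rewrite <- Rmult_minus_distr_l, Rabs_mult.
    replace (2 * H * (rhoM * V + 1) * d * wt l p)
      with (H * ((rhoM * (d * wt l p) * V + d * wt l p)
                 + (rhoM * (d * wt l p) * V + d * wt l p))) by ring.
    apply Rmult_le_compat; auto using Rabs_pos.
    assert (P : forall j, Rabs (cos (phase rho v p) * v j p - cos (phase rho v' p) * v' j p)
              <= rhoM * (d * wt l p) * V + d * wt l p).
    { intros j; apply Rabs_prod_diff; auto using Rabs_cos_le.
      apply Rle_trans with (2 := Hrl p); auto. }
    assert (Q : forall j, Rabs (sin (phase rho v p) * v j p - sin (phase rho v' p) * v' j p)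
              <= rhoM * (d * wt l p) * V + d * wt l p).
    { intros j; apply Rabs_prod_diff; auto using Rabs_sin_le.
      apply Rle_trans with (2 := Hrl p); auto. }
    destruct i.
    - replace (_ - _) with
        ((cos (phase rho v p) * v true p - cos (phase rho v' p) * v' true p)
         + (sin (phase rho v p) * v false p - sin (phase rho v' p) * v' false p)) by ring.
      apply Rle_trans with (1 := Rabs_triang _ _), Rplus_le_compat; auto.
    - replace (_ - _) with
        ((cos (phase rho v p) * v false p - cos (phase rho v' p) * v' false p)
         - (sin (phase rho v p) * v true p - sin (phase rho v' p) * v' true p)) by ring.
      apply Rle_trans with (1 := Rabs_triang _ _); rewrite Rabs_Ropp.
      apply Rplus_le_compat; auto. }
  set (G := 2 * H * (rhoM * V + 1)) in Hsource.
  assert (G0 : 0 <= G) by (unfold G; assert (0 <= rhoM * V) by nra; nra).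
  assert (Hun : forall i p, Rabs (unrotated rho h a v i p - unrotated rho h a v' i p)
                  <= G * d / l * wt l p).
  { intros i p; unfold unrotated.
    replace (_ - _) with (vint (source rho h v i) p - vint (source rho h v' i) p) by ring.
    rewrite vint_minus by (apply source_cont; auto).
    apply vint_bound; auto; [lra|nra|].
    intros q; apply continuous_Rminus; apply source_cont; auto. }
  assert (Hub : forall i p, Rabs (unrotated rho h a v i p) <= A + 2 * H * V).
  { intros i p; apply Rle_trans with (1 := Rabs_triang _ _), Rplus_le_compat; auto.
    apply vint_bound_const; [nra|apply source_cont; auto|].
    intros q; apply source_le; auto. }
  intros i p.
  set (e := rhoM * d / l * wt l p * (A + 2 * H * V) + G * d / l * wt l p).
  replace (_ / l * (d * wt l p)) with (e + e) by (unfold e, G; field; lra).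
  assert (P : forall j, Rabs (cos (phase rho v p) * unrotated rho h a v j p
                              - cos (phase rho v' p) * unrotated rho h a v' j p) <= e)
    by (intros j; apply Rabs_prod_diff; auto using Rabs_cos_le).
  assert (Q : forall j, Rabs (sin (phase rho v p) * unrotated rho h a v j p
                              - sin (phase rho v' p) * unrotated rho h a v' j p) <= e)
    by (intros j; apply Rabs_prod_diff; auto using Rabs_sin_le).
  unfold vsolve; destruct i.
  - replace (_ - _) with
      ((cos (phase rho v p) * unrotated rho h a v true p
        - cos (phase rho v' p) * unrotated rho h a v' true p)
       - (sin (phase rho v p) * unrotated rho h a v false p
          - sin (phase rho v' p) * unrotated rho h a v' false p)) by ring.
    apply Rle_trans with (1 := Rabs_triang _ _); rewrite Rabs_Ropp.
    apply Rplus_le_compat; auto.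
  - replace (_ - _) with
      ((sin (phase rho v p) * unrotated rho h a v true p
        - sin (phase rho v' p) * unrotated rho h a v' true p)
       + (cos (phase rho v p) * unrotated rho h a v false p
          - cos (phase rho v' p) * unrotated rho h a v' false p)) by ring.
    apply Rle_trans with (1 := Rabs_triang _ _), Rplus_le_compat; auto.
Qed.

End Vsolve.

(** The fixed point is sought for v alone: v determines u by one equation, and u determines a new v
    by the other one, read in reflected coordinates. *)
Lemma characteristic_system (rho h : R * R -> R) (a b : bool -> R -> R) rhoM H A :
  (forall p, continuous rho p) -> (forall p, continuous h p) ->
  (forall i x, continuous (a i) x) -> (forall i x, continuous (b i) x) ->
  (forall p, Rabs (rho p) <= rhoM) -> (forall p, Rabs (h p) <= H) ->
  (forall i x, Rabs (a i x) <= A) -> (forall i x, Rabs (b i x) <= A) ->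
  exists u v : field2, fcont u /\ fcont v /\
    (forall i p, u i p = vsolve rho h a v i p) /\
    (forall i p, fswap v i p = vsolve rho h b (fswap u) i p).
Proof.
  intros Crho Ch Ca Cb Brho Bh Ba Bb.
  assert (H0 := (bound_nonneg (0, 0) _ _ Bh)); assert (R0 := (bound_nonneg (0, 0) _ _ Brho));
    assert (A0 := (bound_nonneg 0 _ _ (Ba true))).
  (* With B = 4 A this gives 2 A + 4 H B / l <= B, so by [vsolve_bound] the fields bounded by B
     times the weight form an invariant class. *)
  set (l := 8 * H + 1).
  set (B := 4 * A).
  set (V := B * exp (2 * l)).
  assert (El := exp_pos (2 * l)).
  set (L := 2 * rhoM * (A + 2 * H * V) + 4 * H * (rhoM * V + 1)).
  assert (V0 : 0 <= V) by (unfold V, B; nra).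
  assert (L0 : 0 <= L).
  { unfold L; assert (0 <= H * V) by nra; assert (0 <= rhoM * V) by nra; nra. }
  (* L is the constant of [vsolve_lip] before division by the weight parameter; the parameter 2 m
     makes it at most 1/2. It can only be chosen here, since L depends on V and hence on l. *)
  set (m := L + 1).
  set (F := fun v => fswap (vsolve rho h b (fswap (vsolve rho h a v)))).
  set (K := fun v : field2 => fcont v /\ forall i p, Rabs (v i p) <= B * wt l p).
  assert (KV : forall v, K v -> forall i p, Rabs (v i p) <= V).
  { intros v [_ Hv] i p; apply Rle_trans with (1 := Hv i p).
    apply Rmult_le_compat_l; [unfold B; lra|apply wt_bounds; unfold l; lra]. }
  assert (Kstep : forall c v, (forall i x, continuous (c i) x) ->
            (forall i x, Rabs (c i x) <= A) -> K v -> K (vsolve rho h c v)).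
  { intros c v Cc Bc [Cv Bv]; split.
    - apply vsolve_cont; auto.
    - intros i p.
      apply Rle_trans with (1 := vsolve_bound rho h c H A Crho Ch Bh Bc v B l
                                   ltac:(unfold l; lra) Cv Bv i p).
      apply Rmult_le_compat_r; [apply Rlt_le, exp_pos|].
      assert (4 * H * B / l <= 2 * A); [|unfold B at 2; lra].
      apply Rle_div_l; unfold l, B; nra. }
  assert (Kswap : forall v, K v -> K (fswap v)).
  { intros v [Cv Bv]; split; [apply fcont_swap; auto|].
    intros i p; unfold fswap; rewrite <- (wt_swap l p); auto. }
  assert (Hlip : forall c v v' d, (forall i x, continuous (c i) x) ->
     (forall i x, Rabs (c i x) <= A) -> K v -> K v' -> 0 <= d ->
     (forall i p, Rabs (v i p - v' i p) <= d * wt (2 * m) p) ->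
     forall i p, Rabs (vsolve rho h c v i p - vsolve rho h c v' i p) <= d / 2 * wt (2 * m) p).
  { intros c v v' d Cc Bc Kv Kv' Hd Hdiff i p.
    apply Rle_trans with (1 := vsolve_lip rho h c rhoM H A Crho Ch Brho Bh Bc v v' V d (2 * m)
      ltac:(unfold m; lra) Hd (proj1 Kv) (proj1 Kv') (KV v Kv) Hdiff i p).
    replace (d / 2 * wt (2 * m) p) with (/ 2 * (d * wt (2 * m) p)) by field.
    apply Rmult_le_compat_r; [apply Rmult_le_pos; auto; apply Rlt_le, exp_pos|].
    apply Rle_div_l; unfold m; fold L; lra. }
  destruct (contraction_fixpoint (wt (2 * m)) (exp (2 * (2 * m))) K F
              (fun _ _ => 0) (2 * V)) as [v [Kv Hv]].
  - intros p; assert (W := wt_bounds (2 * m) p ltac:(unfold m; lra)); lra.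
  - lra.
  - split.
    + intros i p; apply continuous_const.
    + intros i p; rewrite Rabs_R0.
      apply Rmult_le_pos; [unfold B; lra|apply Rlt_le, exp_pos].
  - intros v Kv; unfold F; auto.
  - intros vn v Kn Hlim; split.
    + intros i p; apply continuous_eps; intros eps He.
      destruct (Hlim (eps / 3) ltac:(lra)) as [n Hn].
      destruct (proj1 (filterlim_locally _ _) (proj1 (Kn n) i p)
                  (mkposreal (eps / 3) ltac:(lra))) as [[d Hd] Hball].
      exists d; split; auto; intros q Q1 Q2.
      specialize (Hball q (conj Q1 Q2)).
      change (Rabs (vn n i q - vn n i p) < eps / 3) in Hball.
      assert (N1 := Hn i q); assert (N2 := Hn i p).
      replace (v i q - v i p) with ((v i q - vn n i q) - (v i p - vn n i p)
                                    + (vn n i q - vn n i p)) by ring.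
      apply Rle_lt_trans with (1 := Rabs_triang _ _).
      assert (T : Rabs ((v i q - vn n i q) - (v i p - vn n i p))
                  <= Rabs (v i q - vn n i q) + Rabs (v i p - vn n i p))
        by (apply Rle_trans with (1 := Rabs_triang _ _); rewrite Rabs_Ropp; lra).
      lra.
    + intros i p; apply le_epsilon; intros eps He.
      destruct (Hlim eps He) as [n Hn].
      replace (v i p) with ((v i p - vn n i p) + vn n i p) by ring.
      apply Rle_trans with (1 := Rabs_triang _ _).
      assert (N1 := Hn i p); assert (N2 := proj2 (Kn n) i p); lra.
  - intros v v' d Hd Kv Kv' Hdiff i p; unfold F.
    (* Each of the two solves that make up F contributes a factor 1/2. *)
    apply Rle_trans with (d / 2 / 2 * wt (2 * m) p).
    + unfold fswap at 1 3; rewrite <- (wt_swap _ p).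
      apply Hlip; auto; [lra|].
      intros j q; unfold fswap; rewrite <- (wt_swap _ q); auto.
    + apply Rmult_le_compat_r; [apply Rlt_le, exp_pos|lra].
  - intros i p; rewrite Rminus_0_r.
    assert (Kz : K (fun _ _ => 0)).
    { split.
      - intros j q; apply continuous_const.
      - intros j q; rewrite Rabs_R0.
        apply Rmult_le_pos; [unfold B; lra|apply Rlt_le, exp_pos]. }
    apply Rle_trans with V; [apply KV; unfold F; auto|].
    assert (W := wt_bounds (2 * m) p ltac:(unfold m; lra)); nra.
  - exists (vsolve rho h a v), v; split; [|split; [|split]]; auto.
    + apply vsolve_cont; auto; apply Kv.
    + apply Kv.
    + intros i p; unfold fswap at 1; rewrite <- Hv; unfold F, fswap, swap; simpl.
      rewrite <- surjective_pairing; reflexivity.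
Qed.

(** * Reflection symmetry and differential form of the characteristic system *)

Definition char_sol (rho h : R * R -> R) (a b : bool -> R -> R) (u v : field2)
  : Prop :=
  fcont u /\ fcont v /\
  (forall i p, u i p = vsolve rho h a v i p) /\
  (forall i p, fswap v i p = vsolve rho h b (fswap u) i p).

Lemma swap_swap p : swap (swap p) = p.
Proof. destruct p; reflexivity. Qed.

(** Both equations use the same [vsolve], the second one in reflected coordinates, so a reflection
    exchanges the roles of u and v. Each result about u in y thereby yields one about v in x. *)
Lemma char_sol_swap rho h a b u v : char_sol rho h a b u v ->
  char_sol rho h b a (fswap v) (fswap u).
Proof.
  intros [Cu [Cv [Hu Hv]]]; repeat split; auto using fcont_swap.
  intros i p; unfold fswap at 1 2; rewrite swap_swap, Hu.
  destruct p; reflexivity.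
Qed.

Lemma is_pd_swap d f p l : is_pd (negb d) f (swap p) l ->
  is_pd d (fun q => f (swap q)) p l.
Proof. destruct p, d; auto. Qed.

Lemma Ck_swap A k (U : R * R -> Prop) f : Ck (fun d => A (negb d)) k U f ->
  Ck A k (fun p => U (swap p)) (fun p => f (swap p)).
Proof.
  revert f; induction k as [|k IH]; intros f Hf.
  - split; auto; intros p Hp; apply continuous_swap, (Ck_cont _ _ _ _ Hf), Hp.
  - apply Ck_intro.
    + intros p Hp; apply continuous_swap, (Ck_cont _ _ _ _ Hf), Hp.
    + intros d Hd; destruct Hf as [_ H], (H (negb d)) as [g [Hg Kg]].
      { rewrite Bool.negb_involutive; auto. }
      exists (fun p => g (swap p)); split; auto.
      intros p Hp; apply is_pd_swap; auto.
Qed.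

Lemma is_pd_fst d (f : R -> R) p l : is_derive f (fst p) l ->
  is_pd d (fun q => f (fst q)) p (if d then l else 0).
Proof.
  intros H; destruct p as [x y], d; [exact H|].
  apply (is_derive_const (f x : R_NormedModule)).
Qed.

Lemma is_pd_snd d (f : R -> R) p l : is_derive f (snd p) l ->
  is_pd d (fun q => f (snd q)) p (if d then 0 else l).
Proof.
  intros H; destruct p as [x y], d; [|exact H].
  apply (is_derive_const (f y : R_NormedModule)).
Qed.

Section CharSol.

Variables (rho h : R * R -> R).
Hypothesis rho_cont : forall p, continuous rho p.
Hypothesis h_cont : forall p, continuous h p.

Lemma vsolve_axis a v i x : vsolve rho h a v i (x, 0) = a i x.
Proof.
  assert (Z : forall f, vint f (x, 0) = 0).
  { intros f; unfold vint; simpl; rewrite clamp_id by lra.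
    apply (RInt_point (V := R_CompleteNormedModule)). }
  unfold vsolve, unrotated, phase; rewrite !Z, cos_0, sin_0; simpl.
  destruct i; ring.
Qed.

Lemma vint_pd_y_everywhere f p : (forall p, continuous f p) -> 0 < snd p < 1 ->
  is_pd false (vint f) p (f p).
Proof.
  intros Hf Hp; apply (vint_pd_y everywhere); auto using open_everywhere, colclosed_everywhere.
  exact I.
Qed.

Lemma vsolve_pd a v p : fcont v -> 0 < snd p < 1 ->
  is_pd false (vsolve rho h a v true) p
    (- (rho p * v false p) * vsolve rho h a v false p + h p * v true p) /\
  is_pd false (vsolve rho h a v false) p
    (rho p * v false p * vsolve rho h a v true p + h p * v false p).
Proof.
  intros Hv Hp.
  assert (Hph : is_pd false (phase rho v) p (rho p * v false p)).
  { apply (vint_pd_y_everywhere (fun q => rho q * v false q)); auto.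
    intros q; apply continuous_Rmult; auto; apply Hv. }
  assert (Hb : forall i, is_pd false (unrotated rho h a v i) p (source rho h v i p)).
  { intros i; apply is_pd_eq with (0 + source rho h v i p); [ring|].
    apply (is_pd_plus false (fun q => a i (fst q))).
    - destruct p as [x y]; apply (is_derive_const (a i x : R_NormedModule)).
    - apply vint_pd_y_everywhere; auto; apply source_cont; auto. }
  assert (Hc : is_pd false (fun q => cos (phase rho v q)) p
                 (rho p * v false p * - sin (phase rho v p))).
  { apply (is_pd_comp false cos); auto; auto_derive; auto; ring. }
  assert (Hs : is_pd false (fun q => sin (phase rho v q)) p
                 (rho p * v false p * cos (phase rho v p))).
  { apply (is_pd_comp false sin); auto; auto_derive; auto; ring. }
  assert (T := sin2_cos2 (phase rho v p)); unfold Rsqr in T.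
  split.
  - eapply is_pd_eq; [|apply (is_pd_minus false
      (fun q => cos (phase rho v q) * unrotated rho h a v true q)
      (fun q => sin (phase rho v q) * unrotated rho h a v false q)); apply is_pd_mult; eauto].
    unfold vsolve, source; simpl.
    (* Rotating the unrotated source back produces sin^2 + cos^2, which is made explicit so that
       [ring] can treat the trigonometric values as atoms. *)
    replace (h p * v true p) with
      (h p * v true p * (sin (phase rho v p) * sin (phase rho v p)
                         + cos (phase rho v p) * cos (phase rho v p)))
      by (rewrite T; ring); ring.
  - eapply is_pd_eq; [|apply (is_pd_plus false
      (fun q => sin (phase rho v q) * unrotated rho h a v true q)
      (fun q => cos (phase rho v q) * unrotated rho h a v false q)); apply is_pd_mult; eauto].
    unfold vsolve, source; simpl.
    replace (h p * v false p) with
      (h p * v false p * (sin (phase rho v p) * sin (phase rho v p)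
                         + cos (phase rho v p) * cos (phase rho v p)))
      by (rewrite T; ring); ring.
Qed.

Lemma is_pd_eta d f g p l : (forall q, f q = g q) -> is_pd d f p l -> is_pd d g p l.
Proof.
  intros Hfg; apply (is_pd_ext d everywhere); auto using open_everywhere; exact I.
Qed.

Lemma char_sol_pd_y a b u v p : char_sol rho h a b u v -> 0 < snd p < 1 ->
  is_pd false (u true) p (- (rho p * v false p) * u false p + h p * v true p) /\
  is_pd false (u false) p (rho p * v false p * u true p + h p * v false p).
Proof.
  intros [Cu [Cv [Hu _]]] Hp; destruct (vsolve_pd a v p Cv Hp) as [H1 H2].
  rewrite !Hu; split; (eapply is_pd_eta; [|eassumption]); intros; rewrite Hu; auto.
Qed.

Hypothesis rho_sym : forall p, rho (swap p) = rho p.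

Lemma char_sol_pd_x a b u v p : char_sol rho h a b u v -> 0 < fst p < 1 ->
  is_pd true (v true) p (- (rho p * u false p) * v false p + h (swap p) * u true p) /\
  is_pd true (v false) p (rho p * u false p * v true p + h (swap p) * u false p).
Proof.
  intros HS Hp; apply char_sol_swap in HS.
  destruct (char_sol_pd_y b a _ _ (swap p) HS) as [H1 H2]; auto.
  unfold fswap in H1, H2; rewrite swap_swap, rho_sym in H1, H2.
  split.
  - apply (is_pd_eta true (fun q => v true (swap (swap q)))).
    + intros [x y]; reflexivity.
    + apply (is_pd_swap true (fun q => v true (swap q))); exact H1.
  - apply (is_pd_eta true (fun q => v false (swap (swap q)))).
    + intros [x y]; reflexivity.
    + apply (is_pd_swap true (fun q => v false (swap q))); exact H2.
Qed.

Lemma char_sol_axis_y a b u v i x : char_sol rho h a b u v -> u i (x, 0) = a i x.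
Proof. intros [_ [_ [Hu _]]]; rewrite Hu; apply vsolve_axis. Qed.

Lemma char_sol_axis_x a b u v i y : char_sol rho h a b u v -> v i (0, y) = b i y.
Proof. intros HS; apply char_sol_swap in HS; apply (char_sol_axis_y _ _ _ _ i y HS). Qed.

End CharSol.

(* In complex form the equation is w_y = i sg w + s. Derivatives of w in y come
   from the equation, and its derivative in x is an equation of the same form for
   w_x. *)
Lemma rotation_ode_Ck k (U : R * R -> Prop) : open U ->
  forall sg s1 s2 sgx s1x s2x w1 w2 : R * R -> R,
  Ck alldir k U sg -> Ck alldir k U s1 -> Ck alldir k U s2 ->
  Ck alldir k U sgx -> Ck alldir k U s1x -> Ck alldir k U s2x ->
  (forall p, U p -> is_pd true sg p (sgx p)) ->
  (forall p, U p -> is_pd true s1 p (s1x p)) ->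
  (forall p, U p -> is_pd true s2 p (s2x p)) ->
  Ck xdir (S k) U w1 -> Ck xdir (S k) U w2 ->
  (forall p, U p -> is_pd false w1 p (- sg p * w2 p + s1 p)) ->
  (forall p, U p -> is_pd false w2 p (sg p * w1 p + s2 p)) ->
  Ck alldir (S k) U w1 /\ Ck alldir (S k) U w2.
Proof.
  intros HO; induction k as [|k IH];
    intros sg s1 s2 sgx s1x s2x w1 w2 Ksg Ks1 Ks2 Ksgx Ks1x Ks2x Dsg Ds1 Ds2
      Kw1 Kw2 Dw1 Dw2.
  - assert (C1 : Ck alldir 0 U w1) by (split; [apply (Ck_cont _ _ _ _ Kw1)|exact I]).
    assert (C2 : Ck alldir 0 U w2) by (split; [apply (Ck_cont _ _ _ _ Kw2)|exact I]).
    split; apply Ck_intro; try apply (Ck_cont _ _ _ _ C1); try apply (Ck_cont _ _ _ _ C2);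
      intros d _; destruct d.
    + destruct Kw1 as [_ H], (H true eq_refl) as [g [Hg Kg]]; exists g; auto.
    + exists (fun p => -1 * sg p * w2 p + s1 p); split.
      * intros p Hp; eapply is_pd_eq; [|apply Dw1; auto]; ring.
      * auto using Ck_plus, Ck_mult, Ck_const.
    + destruct Kw2 as [_ H], (H true eq_refl) as [g [Hg Kg]]; exists g; auto.
    + exists (fun p => sg p * w1 p + s2 p); split; auto using Ck_plus, Ck_mult.
  - destruct (IH sg s1 s2 sgx s1x s2x w1 w2) as [A1 A2]; auto using Ck_pred.
    destruct (proj2 Kw1 true eq_refl) as [g1 [Hg1 Kg1]].
    destruct (proj2 Kw2 true eq_refl) as [g2 [Hg2 Kg2]].
    destruct (proj2 Ksgx true I) as [sgxx [Hsgxx Ksgxx]].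
    destruct (proj2 Ks1x true I) as [s1xx [Hs1xx Ks1xx]].
    destruct (proj2 Ks2x true I) as [s2xx [Hs2xx Ks2xx]].
    (* The equation for w_x has a source containing w, whose own x-derivative contains w_x again.
       Order k for w_x, known from the previous level for w, is enough to feed the induction
       hypothesis, which raises it to [S k]. *)
    assert (L1 : Ck alldir k U g1) by (apply (Ck_pd alldir k U w1 g1 true); auto; exact I).
    assert (L2 : Ck alldir k U g2) by (apply (Ck_pd alldir k U w2 g2 true); auto; exact I).
    assert (B1 := Ck_pred _ _ _ _ A1); assert (B2 := Ck_pred _ _ _ _ A2).
    assert (Bsg := Ck_pred _ _ _ _ Ksg); assert (Bs1 := Ck_pred _ _ _ _ Ks1).
    assert (Bs2 := Ck_pred _ _ _ _ Ks2); assert (Bsgx := Ck_pred _ _ _ _ Ksgx).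
    assert (Bs1x := Ck_pred _ _ _ _ Ks1x); assert (Bs2x := Ck_pred _ _ _ _ Ks2x).
    assert (G : Ck alldir (S k) U g1 /\ Ck alldir (S k) U g2).
    { apply (IH sg (fun p => s1x p - sgx p * w2 p) (fun p => s2x p + sgx p * w1 p)
               sgx (fun p => s1xx p - (sgxx p * w2 p + sgx p * g2 p))
               (fun p => s2xx p + (sgxx p * w1 p + sgx p * g1 p)));
        auto using Ck_plus, Ck_minus, Ck_mult.
      - intros p Hp; apply is_pd_minus; auto; apply is_pd_mult; auto.
      - intros p Hp; apply is_pd_plus; auto; apply is_pd_mult; auto.
      - intros p Hp.
        apply (pd_swap U w1 g1 (fun p => -1 * sg p * w2 p + s1 p)
                 (fun p => - sg p * g2 p + (s1x p - sgx p * w2 p))); auto.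
        + intros q Hq; eapply is_pd_eq; [|apply Dw1; auto]; ring.
        + intros q Hq; eapply is_pd_eq.
          2: apply (is_pd_plus true (fun p => -1 * sg p * w2 p)); [|apply Ds1; auto].
          2: apply (is_pd_mult true (fun p => -1 * sg p)); [|apply Hg2; auto].
          2: apply (is_pd_mult true (fun _ => -1)); [apply is_pd_const|apply Dsg; auto].
          simpl; ring.
        + apply (Ck_cont alldir k); auto using Ck_plus, Ck_mult, Ck_const.
        + apply (Ck_cont alldir k).
          apply (Ck_ext alldir k U (fun p => -1 * sg p * g2 p + (s1x p - sgx p * w2 p)));
            auto using Ck_plus, Ck_minus, Ck_mult, Ck_const.
          intros; ring.
      - intros p Hp.
        apply (pd_swap U w2 g2 (fun p => sg p * w1 p + s2 p)
                 (fun p => sg p * g1 p + (s2x p + sgx p * w1 p))); auto.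
        + intros q Hq; eapply is_pd_eq.
          2: apply (is_pd_plus true (fun p => sg p * w1 p)); [|apply Ds2; auto].
          2: apply (is_pd_mult true); [apply Dsg; auto|apply Hg1; auto].
          simpl; ring.
        + apply (Ck_cont alldir k); auto using Ck_plus, Ck_mult.
        + apply (Ck_cont alldir k); auto using Ck_plus, Ck_mult. }
    destruct G as [G1 G2].
    split; apply Ck_intro; try apply (Ck_cont _ _ _ _ A1); try apply (Ck_cont _ _ _ _ A2);
      intros d _; destruct d.
    + exists g1; auto.
    + exists (fun p => -1 * sg p * w2 p + s1 p); split.
      * intros p Hp; eapply is_pd_eq; [|apply Dw1; auto]; ring.
      * auto using Ck_plus, Ck_mult, Ck_const.
    + exists g2; auto.
    + exists (fun p => sg p * w1 p + s2 p); split; auto using Ck_plus, Ck_mult.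
Qed.

(** * Regularity of the solution of the characteristic system *)

Section Coefficients.

Variables (delta : R) (m : nat).
Hypothesis delta_pos : 0 < delta.

(* In the variables x = X^(m+1), y = Y^(m+1), this is 1 - x - y. *)
Definition gap (p : R * R) : R := 1 - clamp (fst p) ^ S m - clamp (snd p) ^ S m.

(** The maximum freezes 1 / sqrt(1 - x - y) where it would become singular, so that the coefficient
    is bounded and continuous on the whole plane. *)
Definition rho (p : R * R) : R := / sqrt (Rmax delta (gap p)).

(* Half of the derivative of t^(m+1). *)
Definition xi (t : R) : R := INR (S m) * clamp t ^ m / 2.

(** The term v / (2 r) of the system after u and v are multiplied by dx/dX and dy/dY: the factor
    dy/dY is absorbed by v, and dx/dX remains. *)
Definition coupling (p : R * R) : R := xi (fst p) * (rho p * rho p).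

(* In the variables X, Y: the domain without the axis X = 0, extended to all
   Y <= 0 so as to be open. *)
Definition Wdom (p : R * R) : Prop := 0 < fst p /\ delta < gap p.

Definition Udom (p : R * R) : Prop := Wdom p /\ 0 < snd p.

Lemma gap_cont p : continuous gap p.
Proof.
  unfold gap.
  assert (P : forall x, continuous (fun t => clamp t ^ S m) x).
  { intros x; apply (continuous_comp clamp (fun t => t ^ S m)).
    - apply clamp_continuous.
    - apply continuous_diff; auto_derive; auto. }
  apply continuous_Rminus; [apply continuous_Rminus|].
  - apply continuous_const.
  - apply (continuous_post (fun t => clamp t ^ S m) (fun q : R * R => fst q)); auto.
    apply continuous_Rfst.
  - apply (continuous_post (fun t => clamp t ^ S m) (fun q : R * R => snd q)); auto.
    apply continuous_Rsnd.
Qed.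

Lemma Rmax_delta_pos p : 0 < Rmax delta (gap p).
Proof. apply Rlt_le_trans with delta; auto; apply Rmax_l. Qed.

Lemma continuous_Rmax_const c x : continuous (fun t => Rmax c t) x.
Proof.
  apply filterlim_locally; intros e; exists e; intros s Hs.
  apply Rle_lt_trans with (2 := Hs).
  change (Rabs (Rmax c s - Rmax c x) <= Rabs (s - x)).
  unfold Rmax, Rabs; repeat destruct Rle_dec; repeat destruct Rcase_abs; lra.
Qed.

Lemma rho_cont p : continuous rho p.
Proof.
  assert (H := Rmax_delta_pos p).
  apply (continuous_post (fun t => / sqrt t) (fun q => Rmax delta (gap q))).
  - apply continuous_diff; auto_derive; split; auto; split; auto.
    apply Rgt_not_eq, sqrt_lt_R0; auto.
  - apply (continuous_post (Rmax delta) gap); auto using gap_cont, continuous_Rmax_const.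
Qed.

Lemma rho_pos p : 0 < rho p.
Proof. apply Rinv_0_lt_compat, sqrt_lt_R0, Rmax_delta_pos. Qed.

Lemma rho_bound p : Rabs (rho p) <= / sqrt delta.
Proof.
  rewrite Rabs_pos_eq by apply Rlt_le, rho_pos.
  apply Rinv_le_contravar; [apply sqrt_lt_R0; auto|apply sqrt_le_1_alt, Rmax_l].
Qed.

Lemma rho_sym p : rho (swap p) = rho p.
Proof. unfold rho, gap, swap; simpl; do 3 f_equal; ring. Qed.

Lemma rho_sqr p : Wdom p -> rho p * rho p = / gap p.
Proof.
  intros [_ H]; unfold rho; rewrite Rmax_right by lra.
  rewrite <- Rinv_mult, sqrt_sqrt; auto; lra.
Qed.

Lemma xi_cont t : continuous xi t.
Proof.
  apply (continuous_comp clamp (fun t => INR (S m) * t ^ m / 2)).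
  - apply clamp_continuous.
  - apply continuous_diff; auto_derive; auto.
Qed.

Lemma xi_bound t : Rabs (xi t) <= INR (S m).
Proof.
  unfold xi; assert (B := clamp_bounds t); assert (N := pos_INR (S m)).
  assert (P := pow_le (clamp t) m (proj1 B)).
  assert (P' : clamp t ^ m <= 1) by (rewrite <- (pow1 m); apply pow_incr; auto).
  rewrite Rabs_pos_eq; [|apply Rmult_le_pos; [apply Rmult_le_pos|]; lra]; nra.
Qed.

Lemma coupling_cont p : continuous coupling p.
Proof.
  unfold coupling; apply continuous_Rmult.
  - apply (continuous_post xi (fun q : R * R => fst q));
      auto using xi_cont, continuous_Rfst.
  - apply continuous_Rmult; apply rho_cont.
Qed.

Lemma coupling_bound p : Rabs (coupling p) <= INR (S m) * (/ sqrt delta * / sqrt delta).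
Proof.
  unfold coupling; rewrite !Rabs_mult.
  apply Rmult_le_compat; auto using Rabs_pos, xi_bound.
  - apply Rmult_le_pos; apply Rabs_pos.
  - apply Rmult_le_compat; auto using Rabs_pos, rho_bound.
Qed.

Lemma open_Wdom : open Wdom.
Proof.
  apply open_and.
  - apply (open_comp fst (fun t => 0 < t)).
    + intros p _; apply continuous_Rfst.
    + apply open_gt.
  - apply (open_comp gap (fun t => delta < t)).
    + intros p _; apply gap_cont.
    + apply open_gt.
Qed.

Lemma open_Udom : open Udom.
Proof.
  apply open_and; [apply open_Wdom|].
  apply (open_comp snd (fun t => 0 < t)).
  - intros p _; apply continuous_Rsnd.
  - apply open_gt.
Qed.

Lemma colclosed_Wdom : colclosed Wdom.
Proof.
  intros x y s [H1 H2] Hs; split; auto; unfold gap in *; simpl fst in *; simpl snd in *.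
  assert (B := clamp_bounds y).
  rewrite (clamp_id s) by lra.
  assert (P := pow_incr s (clamp y) (S m) Hs); lra.
Qed.

Lemma clamp_lt_1 t : clamp t < 1 -> t < 1.
Proof. unfold clamp, Rmax, Rmin; repeat destruct Rle_dec; lra. Qed.

Lemma gap_lt_1 p : delta < gap p -> clamp (fst p) ^ S m < 1 - delta /\ clamp (snd p) ^ S m < 1 - delta.
Proof.
  unfold gap; intros H.
  assert (P1 := pow_le _ (S m) (proj1 (clamp_bounds (fst p)))).
  assert (P2 := pow_le _ (S m) (proj1 (clamp_bounds (snd p)))); lra.
Qed.

Lemma pow_lt_1_inv t : 0 <= t -> t ^ S m < 1 -> t < 1.
Proof.
  intros H0 H; destruct (Rlt_le_dec t 1) as [|H1]; auto.
  assert (P := pow_R1_Rle t (S m) H1); lra.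
Qed.

Lemma Wdom_fst p : Wdom p -> 0 < fst p < 1.
Proof.
  intros [H1 H2]; split; auto.
  apply clamp_lt_1, pow_lt_1_inv; [apply clamp_bounds|].
  apply gap_lt_1 in H2; lra.
Qed.

Lemma Udom_Wdom p : Udom p -> Wdom p.
Proof. intros H; apply H. Qed.

Lemma Udom_swap p : Udom p -> Udom (swap p).
Proof.
  intros [[H1 H2] H3]; repeat split; auto.
  unfold gap, swap in *; simpl fst in *; simpl snd in *; lra.
Qed.

Lemma Udom_crd d p : Udom p -> 0 < crd d p < 1.
Proof.
  intros H; destruct d.
  - apply Wdom_fst, Udom_Wdom, H.
  - apply (Wdom_fst (swap p)), Udom_Wdom, Udom_swap, H.
Qed.

(** On [Wdom] the function is the power -1/2 of [gap]; the factor 1/2 of the power rule is the one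
    contained in [xi]. *)
Lemma rho_pd d p : Wdom p -> 0 < crd d p < 1 ->
  is_pd d rho p (xi (crd d p) * rho p ^ 3).
Proof.
  intros Hp Hc.
  set (c := clamp (if d then snd p else fst p) ^ S m).
  assert (Hr : gap p = 1 - crd d p ^ S m - c).
  { unfold gap, c; rewrite <- (clamp_id (crd d p)) by lra; destruct d; simpl; ring. }
  unfold is_pd.
  apply (is_derive_ext_loc (fun t => / sqrt (1 - t ^ S m - c))).
  - assert (L1 := locally_slice d p _ (open_Wdom p Hp)).
    assert (L2 : locally (crd d p) (fun t => 0 < t < 1)).
    { apply (open_and (fun t => 0 < t) (fun t => t < 1)); auto.
      - apply open_gt.
      - apply open_lt. }
    refine (filter_imp _ _ _ (filter_and _ _ L1 L2)); intros t [[_ H1] H2].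
    unfold slice, rho, c; destruct d; cbv iota in H1 |- *;
      rewrite Rmax_right by (apply Rlt_le; exact H1); unfold gap; cbn [fst snd];
      rewrite (clamp_id t) by lra; do 2 f_equal; ring.
  - destruct Hp as [_ Hp].
    assert (Hpos : 0 < 1 - crd d p ^ S m - c) by lra.
    unfold rho; rewrite Rmax_right, Hr by lra.
    unfold xi; rewrite clamp_id by lra.
    auto_derive; change (pred (S m)) with m.
    + split; [|split; auto].
      * unfold Rminus in Hpos; simpl in Hpos |- *; lra.
      * apply Rgt_not_eq, sqrt_lt_R0.
        unfold Rminus in Hpos; simpl in Hpos |- *; lra.
    + replace (1 + - (crd d p * crd d p ^ m) + - c) with (1 - crd d p ^ S m - c)
        by (simpl; ring).
      change (crd d p * crd d p ^ m) with (crd d p ^ S m) in *.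
      assert (Q := sqrt_lt_R0 _ Hpos).
      change (match m with O => 1 | S _ => INR m + 1 end) with (INR (S m)).
      field; lra.
Qed.

Lemma Ck_crd A k V d : Ck A k V (crd d).
Proof.
  destruct k; (split; [intros p _; destruct d;
    [apply continuous_Rfst|apply continuous_Rsnd]|auto]).
  intros e _; exists (fun _ => if Bool.eqb d e then 1 else 0); split; [|apply Ck_const].
  intros p _; destruct d.
  - apply (is_pd_eq _ _ _ (if e then 1 else 0)); [destruct e; reflexivity|].
    apply (is_pd_fst e (fun t => t)), (is_derive_id (K := R_AbsRing)).
  - apply (is_pd_eq _ _ _ (if e then 0 else 1)); [destruct e; reflexivity|].
    apply (is_pd_snd e (fun t => t)), (is_derive_id (K := R_AbsRing)).
Qed.

Lemma Ck_xi A k V d : open V -> (forall p, V p -> 0 < crd d p < 1) ->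
  Ck A k V (fun p => xi (crd d p)).
Proof.
  intros HO HV; apply (Ck_ext A k V (fun p => INR (S m) / 2 * crd d p ^ m)); auto.
  - intros p Hp; specialize (HV p Hp); unfold xi; rewrite clamp_id by lra; field.
  - apply Ck_mult; [apply Ck_const|apply Ck_pow, Ck_crd].
Qed.

(** Because of the clamp, [xi (snd p)] need not be smooth across Y = 0, which [Wdom] crosses.
    Derivatives in X do not see this. *)
Lemma Ck_snd_only k V f : (forall t, continuous f t) ->
  Ck xdir k V (fun p => f (snd p)).
Proof.
  intros Hf; assert (C : forall p, V p -> continuous (fun q : R * R => f (snd q)) p).
  { intros p _; apply (continuous_post f (fun q : R * R => snd q));
      auto using continuous_Rsnd. }
  destruct k; split; auto.
  intros d ->; exists (fun _ => 0); split; [|apply Ck_const].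
  intros [x y] _; apply (is_derive_const (f y : R_NormedModule)).
Qed.

Lemma Ck_rho A k V : open V -> (forall p, V p -> Wdom p) ->
  (forall d p, A d -> V p -> 0 < crd d p < 1) -> Ck A k V rho.
Proof.
  intros HO HV HA; induction k as [|k IH].
  - split; auto; intros; apply rho_cont.
  - apply Ck_intro; [intros; apply rho_cont|].
    intros d Hd; exists (fun p => xi (crd d p) * rho p ^ 3); split.
    + intros p Hp; apply rho_pd; auto.
    + apply Ck_mult; [apply Ck_xi; auto|apply Ck_pow, IH].
Qed.

Lemma Ck_rho_Wdom k : Ck xdir k Wdom rho.
Proof.
  apply Ck_rho; auto using open_Wdom; intros d p -> Hp; apply Wdom_fst, Hp.
Qed.

Lemma Ck_rho_Udom k : Ck alldir k Udom rho.
Proof. apply Ck_rho; auto using open_Udom, Udom_Wdom; intros; apply Udom_crd; auto. Qed.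

Lemma Ck_coupling_Wdom k : Ck xdir k Wdom coupling.
Proof.
  apply (Ck_mult xdir k Wdom (fun p => xi (fst p))); auto using Ck_mult, Ck_rho_Wdom.
  apply (Ck_xi xdir k Wdom true open_Wdom); intros p; apply Wdom_fst.
Qed.

Lemma Ck_coupling_swap_Wdom k : Ck xdir k Wdom (fun p => coupling (swap p)).
Proof.
  apply (Ck_ext xdir k Wdom (fun p => xi (snd p) * (rho p * rho p))); auto using open_Wdom.
  - intros p _; unfold coupling; rewrite rho_sym; reflexivity.
  - apply (Ck_mult xdir k Wdom (fun p => xi (snd p))); auto using Ck_mult, Ck_rho_Wdom.
    apply Ck_snd_only, xi_cont.
Qed.

Lemma Ck_coupling_Udom k : Ck alldir k Udom coupling.
Proof.
  apply (Ck_mult alldir k Udom (fun p => xi (fst p))); auto using Ck_mult, Ck_rho_Udom.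
  apply (Ck_xi alldir k Udom true open_Udom); intros p; apply (Udom_crd true).
Qed.

Lemma Ck_coupling_swap_Udom k : Ck alldir k Udom (fun p => coupling (swap p)).
Proof.
  apply (Ck_sub alldir alldir k Udom (fun p => Udom (swap p))); auto using Udom_swap.
  apply Ck_swap, Ck_coupling_Udom.
Qed.

Section Solution.

Variables (a b : bool -> R -> R) (u v : field2) (k : nat).
Hypothesis sol : char_sol rho coupling a b u v.

(** The equation for v_x raises the order of v by one. The formula [vsolve] then passes this order
    to u, since integrals in Y commute with derivatives in X. No smoothness in Y is involved, so the
    argument covers the axis Y = 0. *)
Lemma Ck_char_x : (forall i, Ck xdir k Wdom (fun p => a i (fst p))) ->
  forall i, Ck xdir k Wdom (u i) /\ Ck xdir k Wdom (v i).
Proof.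
  intros Ha.
  assert (Cu := proj1 sol); assert (Cv := proj1 (proj2 sol)).
  assert (HW : forall p, Wdom p -> continuous (fun _ : R * R => 0) p)
    by (intros; apply continuous_const).
  assert (Claim : forall j, (j <= k)%nat ->
            forall i, Ck xdir j Wdom (u i) /\ Ck xdir j Wdom (v i)).
  { induction j as [|j IH]; intros Hj.
    - intros i; split; (split; [|exact I]); intros; [apply Cu|apply Cv].
    - assert (IH' := IH ltac:(lia)).
      assert (IHu := fun i => proj1 (IH' i)); assert (IHv := fun i => proj2 (IH' i)).
      assert (Hv : forall i, Ck xdir (S j) Wdom (v i)).
      { intros i; apply Ck_intro; [intros; apply Cv|].
        intros d ->; destruct i.
        - exists (fun p => -1 * (rho p * u false p) * v false p + coupling (swap p) * u true p); split.
          + intros p Hp.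
            destruct (char_sol_pd_x rho coupling rho_cont coupling_cont rho_sym a b u v p sol
                        (Wdom_fst p Hp)) as [H1 _].
            eapply is_pd_eq; [|exact H1]; ring.
          + auto 6 using Ck_plus, Ck_mult, Ck_const, Ck_rho_Wdom, Ck_coupling_swap_Wdom.
        - exists (fun p => rho p * u false p * v true p + coupling (swap p) * u false p); split.
          + intros p Hp;
              apply (char_sol_pd_x rho coupling rho_cont coupling_cont rho_sym a b u v); auto using Wdom_fst.
          + auto 6 using Ck_plus, Ck_mult, Ck_rho_Wdom, Ck_coupling_swap_Wdom. }
      assert (Hph : Ck xdir (S j) Wdom (phase rho v)).
      { apply Ck_vint; auto using open_Wdom, colclosed_Wdom, Ck_mult, Ck_rho_Wdom. }
      destruct (Ck_cos_sin _ _ _ _ Hph) as [Hc Hs].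
      assert (Hso : forall i, Ck xdir (S j) Wdom (source rho coupling v i)).
      { intros i; unfold source; destruct i;
          auto 6 using Ck_mult, Ck_plus, Ck_minus, Ck_coupling_Wdom. }
      assert (Hun : forall i, Ck xdir (S j) Wdom (unrotated rho coupling a v i)).
      { intros i; apply Ck_plus; [apply (Ck_le xdir (S j) k); auto|].
        apply Ck_vint; auto using open_Wdom, colclosed_Wdom. }
      intros i; split; auto.
      apply (Ck_ext _ _ _ (vsolve rho coupling a v i)); auto using open_Wdom.
      + intros p _; symmetry; apply sol.
      + unfold vsolve; destruct i; auto using Ck_mult, Ck_plus, Ck_minus. }
  apply Claim; auto.
Qed.

(** In Y, u solves a rotation equation with coefficients made from v. Their X-derivatives have order
    j as well, because v_x is a polynomial in u, v and the coefficients; [rotation_ode_Ck] then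
    gains one order from the X-smoothness of u. *)
Lemma Ck_char_step j : (j < k)%nat ->
  (forall i, Ck xdir k Wdom (fun p => a i (fst p))) ->
  (forall i, Ck alldir j Udom (u i)) -> (forall i, Ck alldir j Udom (v i)) ->
  forall i, Ck alldir (S j) Udom (u i).
Proof.
  intros Hj Ha Hu Hv.
  set (vx := fun (i : bool) p =>
    if i then -1 * (rho p * u false p) * v false p + coupling (swap p) * u true p
    else rho p * u false p * v true p + coupling (swap p) * u false p).
  assert (Kvx : forall i, Ck alldir j Udom (vx i)).
  { intros i; unfold vx; destruct i;
      auto 6 using Ck_plus, Ck_mult, Ck_const, Ck_rho_Udom, Ck_coupling_swap_Udom. }
  assert (Dvx : forall i p, Udom p -> is_pd true (v i) p (vx i p)).
  { intros i p Hp.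
    destruct (char_sol_pd_x rho coupling rho_cont coupling_cont rho_sym a b u v p sol
                (Udom_crd true p Hp)) as [H1 H2].
    destruct i; [|exact H2]; eapply is_pd_eq; [|exact H1]; unfold vx; ring. }
  destruct (proj2 (Ck_rho_Udom (S j)) true I) as [rx [Drx Krx]].
  destruct (proj2 (Ck_coupling_Udom (S j)) true I) as [cx [Dcx Kcx]].
  assert (Kx : forall i, Ck xdir (S j) Udom (u i)).
  { intros i; apply (Ck_sub xdir xdir (S j) Udom Wdom); auto using Udom_Wdom.
    apply (Ck_le xdir (S j) k); [lia|]; apply Ck_char_x; auto. }
  assert (R := rotation_ode_Ck j Udom open_Udom
    (fun p => rho p * v false p) (fun p => coupling p * v true p) (fun p => coupling p * v false p)
    (fun p => rx p * v false p + rho p * vx false p)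
    (fun p => cx p * v true p + coupling p * vx true p)
    (fun p => cx p * v false p + coupling p * vx false p)
    (u true) (u false)).
  destruct R as [R1 R2];
    auto using Ck_mult, Ck_plus, Ck_rho_Udom, Ck_coupling_Udom, is_pd_mult.
  - intros p Hp; apply (char_sol_pd_y rho coupling rho_cont coupling_cont a b u v); auto.
    apply (Udom_crd false p Hp).
  - intros p Hp; apply (char_sol_pd_y rho coupling rho_cont coupling_cont a b u v); auto.
    apply (Udom_crd false p Hp).
  - intros i; destruct i; auto.
Qed.

End Solution.

(** The two fields climb together, since the step for either of them uses order j of both; the step
    for v is the reflected one. *)
Lemma Ck_char (a b : bool -> R -> R) (u v : field2) (k : nat) :
  char_sol rho coupling a b u v ->
  (forall i, Ck xdir k Wdom (fun p => a i (fst p))) ->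
  (forall i, Ck xdir k Wdom (fun p => b i (fst p))) ->
  forall i, Ck alldir k Udom (u i) /\ Ck alldir k Udom (v i).
Proof.
  intros sol Ha Hb.
  assert (Hsw : forall j f, Ck alldir j Udom f -> Ck alldir j Udom (fun p => f (swap p))).
  { intros j f Hf; apply (Ck_sub alldir alldir j Udom (fun p => Udom (swap p)));
      auto using Udom_swap; apply Ck_swap; exact Hf. }
  assert (Claim : forall j, (j <= k)%nat ->
            (forall i, Ck alldir j Udom (u i)) /\ (forall i, Ck alldir j Udom (v i))).
  { induction j as [|j IH]; intros Hj.
    - split; intros i; (split; [|exact I]); intros; apply sol.
    - destruct (IH ltac:(lia)) as [Hu Hv]; split.
      + apply (Ck_char_step a b u v k); auto.
      + intros i.
        apply (Ck_ext _ _ _ (fun p => fswap v i (swap p))); auto using open_Udom.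
        * intros [x y] _; reflexivity.
        * apply Hsw.
          apply (Ck_char_step b a (fswap v) (fswap u) k); auto using char_sol_swap.
          -- intros; apply Hsw; auto.
          -- intros; apply Hsw; auto. }
  intros i; destruct (Claim k (le_n k)); auto.
Qed.

End Coefficients.

(** * The Ernst potential *)

(** The derivative of w is only required in the open interval, since the equations in Y are
    available for Y > 0 alone. The difference of the two sides is constant by the mean value
    theorem. *)
Lemma vint_FTC (h : R * R -> R) (w : R -> R) x y : 0 <= y <= 1 ->
  (forall p, continuous h p) -> (forall s, 0 <= s <= y -> continuous w s) ->
  (forall s, 0 < s < y -> is_derive w s (h (x, s))) ->
  vint h (x, y) = w y - w 0.
Proof.
  intros Hy Hh Hw Hd.
  destruct (Rle_lt_or_eq_dec 0 y) as [Hy0|<-]; [tauto| |].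
  2: { unfold vint; simpl; rewrite clamp_id by lra.
       rewrite (RInt_point (V := R_CompleteNormedModule)).
       change (0 = w 0 - w 0 :> R); ring. }
  destruct (MVT_gen (fun t => vint h (x, t) - w t) 0 y (fun _ => 0)) as [c [_ E]].
  - rewrite Rmin_left, Rmax_right by lra; intros s Hs.
    replace 0 with (h (x, s) - h (x, s)) by ring.
    apply (is_derive_minus (V := R_NormedModule) (fun t => vint h (x, t))); auto.
    apply (vint_pd_y_everywhere h (x, s) Hh); simpl; lra.
  - rewrite Rmin_left, Rmax_right by lra; intros s Hs.
    apply continuity_pt_filterlim.
    apply (continuous_Rminus (fun t => vint h (x, t)) w); auto.
    apply (continuous_vert (vint h)), vint_cont, Hh.
  - replace (vint h (x, 0)) with 0 in E.
    + lra.
    + unfold vint; simpl; rewrite clamp_id by lra.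
      symmetry; apply (RInt_point (V := R_CompleteNormedModule)).
Qed.

Section Potential.

Variables (delta : R) (m : nat) (a b : bool -> R -> R) (u v : field2)
  (R0 S0 : R -> R).
Hypothesis delta_pos : 0 < delta.

Let rho := rho delta m.
Let coef := coupling delta m.
Let xi := xi m.
Let W := Wdom delta m.
Let U := Udom delta m.

Hypothesis sol : char_sol rho coef a b u v.
Hypothesis R0_cont : forall x, continuous R0 x.
Hypothesis S0_cont : forall x, continuous S0 x.
Hypothesis R0_pos : forall x, 0 < R0 x.
Hypothesis R0_deriv : forall x, 0 < x -> x ^ S m < 1 - delta ->
  is_derive R0 x (rho (x, 0) * a true x * R0 x).
Hypothesis S0_deriv : forall x, 0 < x -> x ^ S m < 1 - delta ->
  is_derive S0 x (rho (x, 0) * a false x * R0 x).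

Definition potR (p : R * R) : R :=
  R0 (fst p) * exp (vint (fun q => rho q * v true q) p).

Definition potS (p : R * R) : R :=
  S0 (fst p) + vint (fun q => rho q * v false q * potR q) p.

Lemma rho_continuous p : continuous rho p.
Proof. apply rho_cont; auto. Qed.

Lemma coupling_cont' p : continuous coef p.
Proof. apply coupling_cont; auto. Qed.

Lemma v_cont i p : continuous (v i) p.
Proof. apply sol. Qed.

Lemma u_cont i p : continuous (u i) p.
Proof. apply sol. Qed.

Lemma rho_v_cont i p : continuous (fun q => rho q * v i q) p.
Proof. apply continuous_Rmult; [apply rho_continuous|apply v_cont]. Qed.

Lemma rho_u_cont i p : continuous (fun q => rho q * u i q) p.
Proof. apply continuous_Rmult; [apply rho_continuous|apply u_cont]. Qed.

Lemma potR_cont p : continuous potR p.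
Proof.
  apply continuous_Rmult.
  - apply (continuous_post R0 (fun q : R * R => fst q)); auto; apply continuous_Rfst.
  - apply continuous_post.
    + apply continuous_diff; auto_derive; auto.
    + apply vint_cont; intros q; apply rho_v_cont.
Qed.

Lemma potR_pos p : 0 < potR p.
Proof. apply Rmult_lt_0_compat; auto; apply exp_pos. Qed.

Lemma potS_integrand_cont p : continuous (fun q => rho q * v false q * potR q) p.
Proof. apply continuous_Rmult; [apply rho_v_cont|apply potR_cont]. Qed.

Lemma potS_cont p : continuous potS p.
Proof.
  apply continuous_Rplus.
  - apply (continuous_post S0 (fun q : R * R => fst q)); auto; apply continuous_Rfst.
  - apply vint_cont; intros; apply potS_integrand_cont.
Qed.

Lemma potR_pd_y p : 0 < snd p < 1 ->
  is_pd false potR p (rho p * v true p * potR p).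
Proof.
  intros Hp; apply (is_pd_eq _ _ _
    (0 * exp (vint (fun q => rho q * v true q) p)
     + R0 (fst p) * ((rho p * v true p) * exp (vint (fun q => rho q * v true q) p)))).
  { unfold potR; ring. }
  apply (is_pd_mult false (fun q => R0 (fst q))).
  - destruct p as [x y]; apply (is_derive_const (R0 x : R_NormedModule)).
  - apply (is_pd_comp false exp); [apply is_derive_exp|].
    apply (vint_pd_y_everywhere (fun q => rho q * v true q)); auto.
    intros; apply rho_v_cont.
Qed.

Lemma potS_pd_y p : 0 < snd p < 1 ->
  is_pd false potS p (rho p * v false p * potR p).
Proof.
  intros Hp; apply (is_pd_eq _ _ _ (0 + rho p * v false p * potR p)); [ring|].
  apply (is_pd_plus false (fun q => S0 (fst q))).
  - destruct p as [x y]; apply (is_derive_const (S0 x : R_NormedModule)).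
  - apply (vint_pd_y_everywhere (fun q => rho q * v false q * potR q)); auto.
    intros; apply potS_integrand_cont.
Qed.

(* The common value of the mixed derivatives (rho v)_x = (rho u)_y, up to the
   quadratic terms of the imaginary parts. *)
Let cross (i : bool) (q : R * R) : R :=
  rho q ^ 3 * (xi (fst q) * v i q + xi (snd q) * u i q).

(** The real components of [vx] and [uy] coincide, which is the integrability of log R. The
    imaginary ones agree only after the contribution of the derivatives of R to the derivatives of
    rho Im(v) R and rho Im(u) R is added. *)
Let vx (i : bool) (q : R * R) : R :=
  cross i q + rho q ^ 2 * (if i then - (u false q * v false q) else u false q * v true q).

Let uy (i : bool) (q : R * R) : R :=
  cross i q + rho q ^ 2 * (if i then - (u false q * v false q) else v false q * u true q).

Lemma vx_cont i p : continuous (vx i) p.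
Proof.
  assert (Hr := rho_continuous p); assert (Hu := fun i => u_cont i p);
    assert (Hv := fun i => v_cont i p).
  assert (P : forall n, continuous (fun q => rho q ^ n) p).
  { intros n; apply (continuous_post (fun t => t ^ n)); auto.
    apply continuous_diff; auto_derive; auto. }
  assert (X1 : continuous (fun q : R * R => xi (fst q)) p)
    by (apply (continuous_post xi (fun q : R * R => fst q));
        [apply xi_cont|apply continuous_Rfst]).
  assert (X2 : continuous (fun q : R * R => xi (snd q)) p)
    by (apply (continuous_post xi (fun q : R * R => snd q));
        [apply xi_cont|apply continuous_Rsnd]).
  apply continuous_Rplus; apply continuous_Rmult; auto.
  - apply continuous_Rplus; apply continuous_Rmult; auto.
  - destruct i; [|apply continuous_Rmult; auto].
    apply (continuous_post Ropp (fun q => u false q * v false q)).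
    + apply continuous_diff; auto_derive; auto.
    + apply continuous_Rmult; auto.
Qed.

Lemma rho_v_pd_x i p : W p -> is_pd true (fun q => rho q * v i q) p (vx i p).
Proof.
  intros Hp; assert (Hx := Wdom_fst _ _ delta_pos p Hp).
  assert (Hr := rho_pd delta m delta_pos true p Hp Hx).
  destruct (char_sol_pd_x rho coef rho_continuous coupling_cont' (rho_sym delta m) a b u v p sol Hx)
    as [H1 H2].
  assert (Hc : coef (swap p) = xi (snd p) * (rho p * rho p))
    by (unfold coef, coupling; rewrite rho_sym; reflexivity).
  rewrite Hc in H1, H2.
  destruct i; (eapply is_pd_eq; [|apply is_pd_mult; [exact Hr|eassumption]]);
    unfold vx, cross, xi, crd, rho; ring.
Qed.

Lemma rho_u_pd_y i p : U p -> is_pd false (fun q => rho q * u i q) p (uy i p).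
Proof.
  intros Hp; assert (Hy := Udom_crd _ _ delta_pos false p Hp).
  assert (Hr := rho_pd delta m delta_pos false p (Udom_Wdom _ _ _ Hp) Hy).
  destruct (char_sol_pd_y rho coef rho_continuous coupling_cont' a b u v p sol Hy) as [H1 H2].
  assert (Hc : coef p = xi (fst p) * (rho p * rho p)) by reflexivity.
  rewrite Hc in H1, H2.
  destruct i; (eapply is_pd_eq; [|apply is_pd_mult; [exact Hr|eassumption]]);
    unfold uy, cross, xi, crd, rho; ring.
Qed.

Lemma Wdom_col x y s : W (x, y) -> 0 <= s <= clamp y -> W (x, s).
Proof. apply colclosed_Wdom. Qed.

Lemma Udom_col x y s : U (x, y) -> 0 < s <= y -> U (x, s).
Proof.
  intros H Hs; assert (By := Udom_crd _ _ delta_pos false _ H); simpl in By.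
  split; [|simpl; lra]; apply (Wdom_col x y); [apply H|].
  rewrite clamp_id by lra; lra.
Qed.

Lemma Wdom_axis p : W p -> 0 < fst p /\ fst p ^ S m < 1 - delta.
Proof.
  intros Hp; assert (Hx := Wdom_fst _ _ delta_pos p Hp); split; [tauto|].
  destruct (gap_lt_1 _ _ p (proj2 Hp)) as [H _].
  rewrite clamp_id in H by lra; exact H.
Qed.

(** The X-derivative of log R as differentiation under the integral gives it. It makes sense on all
    of W, whereas its closed form rho Re(u) needs the equation for u in Y and is established on
    U. *)
Let dlogR (p : R * R) : R := rho (fst p, 0) * a true (fst p) + vint (vx true) p.

Lemma potR_pd_x_W p : W p -> is_pd true potR p (dlogR p * potR p).
Proof.
  intros Hp; destruct (Wdom_axis p Hp) as [A1 A2].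
  set (e := exp (vint (fun q => rho q * v true q) p)).
  apply (is_pd_eq _ _ _
    ((rho (fst p, 0) * a true (fst p) * R0 (fst p)) * e + R0 (fst p) * (vint (vx true) p * e))).
  { unfold potR, dlogR, e; ring. }
  apply (is_pd_mult true (fun q => R0 (fst q))).
  - apply (is_pd_fst true R0); auto.
  - apply (is_pd_comp true exp); [apply is_derive_exp|].
    apply (vint_pd_x W); auto.
    + apply open_Wdom; auto.
    + apply colclosed_Wdom.
    + intros; apply rho_v_cont.
    + intros; apply vx_cont.
    + intros; apply rho_v_pd_x; auto.
Qed.

(** The integrand [vx true] is also the Y-derivative of rho Re(u), so the integral telescopes down
    to the axis, where u equals a. *)
Lemma dlogR_U p : U p -> dlogR p = rho p * u true p.
Proof.
  destruct p as [x y]; intros Hp; assert (By := Udom_crd _ _ delta_pos false _ Hp); simpl in By.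
  unfold dlogR; rewrite (vint_FTC _ (fun s => rho (x, s) * u true (x, s))).
  - rewrite (char_sol_axis_y rho coef a b u v true x sol); simpl fst; ring.
  - lra.
  - intros; apply vx_cont.
  - intros s _; apply (continuous_vert (fun q => rho q * u true q)), rho_u_cont.
  - intros s Hs; assert (Hq : U (x, s)) by (apply (Udom_col x y); auto; lra).
    change (is_pd false (fun q => rho q * u true q) (x, s) (vx true (x, s))).
    apply (rho_u_pd_y true (x, s) Hq).
Qed.

Lemma potR_pd_x p : U p -> is_pd true potR p (rho p * u true p * potR p).
Proof.
  intros Hp; rewrite <- dlogR_U by auto; apply potR_pd_x_W, Hp.
Qed.

Lemma rho_u_potR_pd_y i p : U p ->
  is_pd false (fun q => rho q * u i q * potR q) p
    (potR p * (uy i p + rho p ^ 2 * (u i p * v true p))).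
Proof.
  intros Hp; assert (By := Udom_crd _ _ delta_pos false _ Hp).
  eapply is_pd_eq.
  2: apply (is_pd_mult false (fun q => rho q * u i q));
     [apply rho_u_pd_y, Hp|apply potR_pd_y, By].
  cbv beta; ring.
Qed.

Lemma potS_pd_x p : U p -> is_pd true potS p (rho p * u false p * potR p).
Proof.
  intros Hp.
  destruct (Wdom_axis p (Udom_Wdom _ _ _ Hp)) as [A1 A2].
  (* On W this is the X-derivative of the integrand of [potS]; on U it is also the Y-derivative of
     rho Im(u) R, so that its integral telescopes. *)
  set (k := fun q => vx false q * potR q + rho q * v false q * (dlogR q * potR q)).
  assert (Cd : forall q, continuous dlogR q).
  { intros q; unfold dlogR; apply continuous_Rplus.
    - apply continuous_Rmult.
      + apply (continuous_post (fun t => rho (t, 0)) (fun q : R * R => fst q)).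
        * apply (continuous_slice rho true (fst q, 0)), rho_continuous.
        * apply continuous_Rfst.
      (* Continuity of a is inherited from u, whose trace on the axis it is. *)
      + apply (continuous_ext (fun q : R * R => u true (fst q, 0))).
        * intros r; apply (char_sol_axis_y rho coef a b u v true _ sol).
        * apply (continuous_post (fun t => u true (t, 0)) (fun q : R * R => fst q)).
          -- apply (continuous_slice (u true) true (fst q, 0)), u_cont.
          -- apply continuous_Rfst.
    - apply vint_cont; intros; apply vx_cont. }
  assert (Ckk : forall q, continuous k q).
  { intros q; unfold k; apply continuous_Rplus; apply continuous_Rmult.
    - apply vx_cont.
    - apply potR_cont.
    - apply rho_v_cont.
    - apply continuous_Rmult; [apply Cd|apply potR_cont]. }
  assert (Jk : vint k p = rho p * u false p * potR p - rho (fst p, 0) * a false (fst p) * R0 (fst p)).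
  { destruct p as [x y]; assert (By := Udom_crd _ _ delta_pos false _ Hp); simpl in By.
    rewrite (vint_FTC _ (fun s => rho (x, s) * u false (x, s) * potR (x, s))); auto.
    - rewrite (char_sol_axis_y rho coef a b u v false x sol); simpl fst.
      replace (potR (x, 0)) with (R0 x); [ring|].
      unfold potR, vint; simpl; rewrite (clamp_id 0) by lra.
      rewrite (RInt_point (V := R_CompleteNormedModule)).
      change (R0 x = R0 x * exp 0); rewrite exp_0; ring.
    - lra.
    - intros s _; apply (continuous_vert (fun q => rho q * u false q * potR q)).
      apply continuous_Rmult; [apply rho_u_cont|apply potR_cont].
    - intros s Hs; assert (Hq : U (x, s)) by (apply (Udom_col x y); auto; lra).
      change (is_pd false (fun q => rho q * u false q * potR q) (x, s) (k (x, s))).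
      eapply is_pd_eq; [|apply (rho_u_potR_pd_y false (x, s) Hq)].
      unfold k; rewrite dlogR_U by auto; unfold vx, uy; ring. }
  apply (is_pd_eq _ _ _ (rho (fst p, 0) * a false (fst p) * R0 (fst p) + vint k p)).
  { rewrite Jk; ring. }
  apply (is_pd_plus true (fun q => S0 (fst q))).
  - apply (is_pd_fst true S0); auto.
  - apply (vint_pd_x W); auto.
    + apply open_Wdom; auto.
    + apply colclosed_Wdom.
    + intros; apply potS_integrand_cont.
    + intros q Hq; apply (is_pd_mult true (fun q => rho q * v false q)).
      * apply rho_v_pd_x, Hq.
      * apply potR_pd_x_W, Hq.
    + apply Hp.
Qed.

Lemma potR_axis_y x : potR (x, 0) = R0 x.
Proof.
  unfold potR, vint; simpl; rewrite (clamp_id 0) by lra.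
  rewrite (RInt_point (V := R_CompleteNormedModule)).
  change (R0 x * exp 0 = R0 x); rewrite exp_0; ring.
Qed.

Lemma potS_axis_y x : potS (x, 0) = S0 x.
Proof.
  unfold potS, vint; simpl; rewrite (clamp_id 0) by lra.
  rewrite (RInt_point (V := R_CompleteNormedModule)).
  change (S0 x + 0 = S0 x); ring.
Qed.

Section Axis.

Variables (R1 S1 : R -> R).
Hypothesis R1_cont : forall x, continuous R1 x.
Hypothesis S1_cont : forall x, continuous S1 x.
Hypothesis R1_pos : forall x, 0 < R1 x.
Hypothesis R1_deriv : forall x, 0 < x -> x ^ S m < 1 - delta ->
  is_derive R1 x (rho (x, 0) * b true x * R1 x).
Hypothesis S1_deriv : forall x, 0 < x -> x ^ S m < 1 - delta ->
  is_derive S1 x (rho (x, 0) * b false x * R1 x).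
Hypothesis corner_R : R0 0 = 1 /\ R1 0 = 1.
Hypothesis corner_S : S0 0 = 0 /\ S1 0 = 0.

Lemma pow_below s y : 0 < s < y -> y ^ S m < 1 - delta -> s ^ S m < 1 - delta.
Proof.
  intros Hs Hy; assert (P := pow_incr s y (S m) ltac:(lra)); lra.
Qed.

Lemma rho_axis s : rho (0, s) = rho (s, 0).
Proof. apply (rho_sym delta m (s, 0)). Qed.

(** On X = 0 the field v equals b, and rho b is the derivative of ln R1 by [R1_deriv]; the corner
    values fix the constant. *)
Lemma potR_axis_x y : 0 <= y -> y ^ S m < 1 - delta -> potR (0, y) = R1 y.
Proof.
  intros H0 H1.
  assert (Hy : y < 1) by (apply (pow_lt_1_inv m); lra).
  unfold potR; rewrite (vint_FTC _ (fun s => ln (R1 s))); simpl fst.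
  - rewrite (proj1 corner_R), (proj2 corner_R), ln_1, Rminus_0_r, exp_ln; auto; ring.
  - lra.
  - intros; apply rho_v_cont.
  - intros s _; apply (continuous_post ln R1); auto.
    apply continuous_diff; auto_derive; auto.
  - intros s Hs.
    rewrite (char_sol_axis_x rho coef a b u v true s sol), rho_axis.
    assert (D1 := R1_deriv s (proj1 Hs) (pow_below s y Hs H1)).
    assert (P := R1_pos s).
    replace (rho (s, 0) * b true s)
      with (scal (rho (s, 0) * b true s * R1 s) (/ R1 s))
      by (unfold scal; simpl; unfold mult; simpl; field; lra).
    apply (is_derive_comp ln R1); auto.
    apply is_derive_ln; auto.
Qed.

Lemma potS_axis_x y : 0 <= y -> y ^ S m < 1 - delta -> potS (0, y) = S1 y.
Proof.
  intros H0 H1.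
  assert (Hy : y < 1) by (apply (pow_lt_1_inv m); lra).
  unfold potS; rewrite (vint_FTC _ S1); simpl fst; auto.
  - rewrite (proj1 corner_S), (proj2 corner_S); ring.
  - lra.
  - intros; apply potS_integrand_cont.
  - intros s Hs.
    assert (Hs' := pow_below s y Hs H1).
    rewrite (char_sol_axis_x rho coef a b u v false s sol), rho_axis.
    rewrite potR_axis_x; auto; [|lra]; apply S1_deriv; lra.
Qed.

End Axis.

(** One order is gained over u and v because all first derivatives are products of [rho], u or v,
    and [potR]. As [potR] occurs in its own derivatives, it is treated first, by induction. *)
Lemma Ck_pot k : (forall i, Ck xdir k W (fun p => a i (fst p))) ->
  (forall i, Ck xdir k W (fun p => b i (fst p))) ->
  Ck alldir (S k) U potR /\ Ck alldir (S k) U potS.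
Proof.
  intros Ha Hb.
  assert (HC := Ck_char delta m delta_pos a b u v k sol Ha Hb).
  assert (KR : forall j, (j <= S k)%nat -> Ck alldir j U potR).
  { induction j as [|j IH]; intros Hj.
    - split; auto; intros; apply potR_cont.
    - apply Ck_intro; [intros; apply potR_cont|].
      assert (Kf : forall i, Ck alldir j U (u i) /\ Ck alldir j U (v i)).
      { intros i; split; (apply (Ck_le alldir j k); [lia|apply HC]). }
      intros [|] _.
      + exists (fun p => rho p * u true p * potR p); split.
        * intros; apply potR_pd_x; auto.
        * apply Ck_mult; [apply Ck_mult; [apply Ck_rho_Udom; auto|apply Kf]|apply IH; lia].
      + exists (fun p => rho p * v true p * potR p); split.
        * intros p Hp; apply potR_pd_y; apply (Udom_crd _ _ delta_pos false p Hp).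
        * apply Ck_mult; [apply Ck_mult; [apply Ck_rho_Udom; auto|apply Kf]|apply IH; lia]. }
  split; auto.
  apply Ck_intro; [intros; apply potS_cont|].
  assert (KR' := KR k ltac:(lia)).
  intros [|] _.
  - exists (fun p => rho p * u false p * potR p); split.
    + intros; apply potS_pd_x; auto.
    + apply Ck_mult; [apply Ck_mult; [apply Ck_rho_Udom; auto|apply HC]|apply KR'].
  - exists (fun p => rho p * v false p * potR p); split.
    + intros p Hp; apply potS_pd_y; apply (Udom_crd _ _ delta_pos false p Hp).
    + apply Ck_mult; [apply Ck_mult; [apply Ck_rho_Udom; auto|apply HC]|apply KR'].
Qed.

End Potential.

(** * Boundary data and change of variables *)

Section Root.

Variable m : nat.

(** The case distinction restores continuity at 0, since [Rpower] takes the default value 1 for a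
    nonpositive base. *)
Definition root (x : R) : R :=
  if Rle_dec x 0 then 0 else Rpower x (/ INR (S m)).

Lemma INR_S_pos : 0 < INR (S m).
Proof. apply lt_0_INR; lia. Qed.

Lemma root_pos x : 0 < x -> 0 < root x.
Proof. intros H; unfold root; destruct Rle_dec; [lra|apply exp_pos]. Qed.

Lemma root_0 : root 0 = 0.
Proof. unfold root; destruct Rle_dec; lra. Qed.

Lemma root_nonneg x : 0 <= root x.
Proof. unfold root; destruct Rle_dec; [lra|apply Rlt_le, exp_pos]. Qed.

Lemma root_pow x : 0 <= x -> root x ^ S m = x.
Proof.
  intros H; unfold root; destruct Rle_dec.
  - simpl; lra.
  - rewrite <- Rpower_pow by apply exp_pos.
    rewrite Rpower_mult, Rinv_l, Rpower_1; [auto|lra|].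
    apply Rgt_not_eq, INR_S_pos.
Qed.

Lemma pow_lt_inv s t : 0 <= t -> s ^ S m < t ^ S m -> 0 <= s -> s < t.
Proof.
  intros Ht H Hs; destruct (Rlt_le_dec s t); auto.
  assert (P := pow_incr t s (S m) ltac:(lra)); lra.
Qed.

Lemma root_deriv x : 0 < x -> is_derive root x (/ (INR (S m) * root x ^ m)).
Proof.
  intros Hx; assert (HN := INR_S_pos); assert (Hr := root_pos x Hx).
  apply (is_derive_ext_loc (fun t => exp (/ INR (S m) * ln t))).
  - apply (filter_imp (fun t => 0 < t)); [|apply (open_gt 0 x Hx)].
    intros t Ht; unfold root; destruct Rle_dec; [lra|reflexivity].
  - replace (/ (INR (S m) * root x ^ m))
      with (scal (/ INR (S m) * / x) (exp (/ INR (S m) * ln x))).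
    + apply (is_derive_comp exp (fun t => / INR (S m) * ln t)).
      * apply is_derive_exp.
      * apply (is_derive_scal ln x (/ INR (S m))), is_derive_ln, Hx.
    + replace (exp (/ INR (S m) * ln x)) with (root x)
        by (unfold root; destruct Rle_dec; [lra|reflexivity]).
      change (/ INR (S m) * / x * root x = / (INR (S m) * root x ^ m) :> R).
      rewrite <- (root_pow x) at 1 by lra.
      rewrite <- tech_pow_Rmult; field; split; [|split]; try lra.
      apply pow_nonzero; lra.
Qed.

Lemma root_cont x : continuous root x.
Proof.
  destruct (Rtotal_order x 0) as [H|[->|H]].
  - apply (continuous_ext_loc _ (fun _ => 0)); [|apply continuous_const].
    apply (filter_imp (fun t => t < 0)); [|apply (open_lt 0 x H)].
    intros t Ht; unfold root; destruct Rle_dec; lra.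
  - apply filterlim_locally; intros [e He].
    assert (Hp : 0 < e ^ S m) by (apply pow_lt; auto).
    exists (mkposreal _ Hp); intros t Ht.
    change (Rabs (t - 0) < e ^ S m) in Ht; change (Rabs (root t - root 0) < e).
    rewrite root_0, Rminus_0_r, Rabs_pos_eq by apply root_nonneg.
    destruct (Rle_dec t 0) as [H|H].
    + unfold root; destruct Rle_dec; lra.
    + apply pow_lt_inv; [lra| |apply root_nonneg].
      rewrite root_pow by lra.
      rewrite Rminus_0_r, Rabs_pos_eq in Ht; lra.
  - apply continuous_diff; eexists; apply root_deriv, H.
Qed.

Lemma root_Rpower x : 0 < x -> Rpower x (INR m / INR (S m)) = root x ^ m.
Proof.
  intros Hx; unfold root; destruct Rle_dec; [lra|].
  rewrite <- Rpower_pow by apply exp_pos; rewrite Rpower_mult; f_equal.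
  unfold Rdiv; ring.
Qed.

Lemma Ck_root A k V d : (forall p, V p -> 0 < crd d p) ->
  Ck A k V (fun p => root (crd d p)).
Proof.
  intros HV.
  assert (C : forall p, V p -> continuous (fun q => root (crd d q)) p).
  { intros p _; destruct d.
    - apply (continuous_post root (fun q : R * R => fst q)); auto using root_cont, continuous_Rfst.
    - apply (continuous_post root (fun q : R * R => snd q)); auto using root_cont, continuous_Rsnd. }
  induction k as [|k IH]; [split; auto|].
  apply Ck_intro; auto; intros e He.
  exists (fun p => (if Bool.eqb d e then 1 else 0) * / (INR (S m) * root (crd d p) ^ m)); split.
  - intros p Hp; assert (D := root_deriv _ (HV p Hp)); destruct d.
    + eapply is_pd_eq; [|apply (is_pd_fst e root p _ D)]; destruct e; simpl; ring.
    + eapply is_pd_eq; [|apply (is_pd_snd e root p _ D)]; destruct e; simpl; ring.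
  - apply Ck_mult; [apply Ck_const|].
    apply Ck_inv; [|apply Ck_mult; [apply Ck_const|apply Ck_pow, IH]].
    intros p Hp; assert (P := root_pos _ (HV p Hp)); assert (HN := INR_S_pos).
    apply Rmult_integral_contrapositive_currified; [lra|].
    apply pow_nonzero; lra.
Qed.

End Root.

(** * Transformation of one boundary datum *)

Definition cpt (i : bool) (z : C) : R := if i then Re z else Im z.

Lemma cpt_Cmod i z : Rabs (cpt i z) <= Cmod z.
Proof.
  destruct z as [x y]; assert (H := Rmax_Cmod (x, y)); simpl in H.
  destruct i; simpl; (eapply Rle_trans; [|exact H]); [apply Rmax_l|apply Rmax_r].
Qed.

Lemma continuous_cpt i z : continuous (T := C_UniformSpace) (cpt i) z.
Proof. destruct z as [x y], i; [apply continuous_fst|apply continuous_snd]. Qed.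

Lemma Ck_Cn1_cpt n (J : R -> Prop) (f : R -> C) : open J -> Cn1 n J f ->
  forall i, Ck xdir n (fun p => J (fst p)) (fun p => cpt i (f (fst p))).
Proof.
  intros HJ Hf i; destruct (Ck_Cn1 n J f HJ Hf); destruct i; assumption.
Qed.

Section Datum.

Variables (delta : R) (m k : nat) (alpha : R) (f : R -> C).
Hypothesis delta_01 : 0 < delta < 1.
(* The weight x^alpha is absorbed by the change of variables x = X^(m+1), with
   a positive power of X to spare. *)
Hypothesis m_large : 0 < INR m - INR (S m) * alpha.
Hypothesis datum : Goursat_datum (S k) alpha f.

Let M := root m (1 - delta).

(** Stopping at M, where t^(m+1) = 1 - delta, keeps the argument of the datum away from 1, near
    which the datum is not controlled. *)
Let cM (t : R) : R := Rmax 0 (Rmin t M).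

(** For 0 < t <= M this is sqrt(1 - x) times the X-derivative of the datum divided by its real part,
    which is the trace prescribed for u or v on an axis. The value 0 is its limit at t = 0 thanks to
    [m_large]. *)
Let density (i : bool) (t : R) : R :=
  if Rle_dec t 0 then 0
  else INR (S m) * t ^ m * cpt i (deriv f (t ^ S m))
       * / (Re (f (t ^ S m)) * rho delta m (t, 0)).

Lemma M_pow : M ^ S m = 1 - delta.
Proof. apply root_pow; lra. Qed.

Lemma M_pos : 0 < M.
Proof. apply root_pos; lra. Qed.

Lemma M_lt_1 : M < 1.
Proof.
  apply (pow_lt_inv m); [lra| |apply Rlt_le, M_pos].
  rewrite M_pow, pow1; lra.
Qed.

Lemma below_M t : 0 <= t -> t ^ S m < 1 - delta -> t < M.
Proof.
  intros H0 H; apply (pow_lt_inv m); auto; [apply Rlt_le, M_pos|rewrite M_pow; auto].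
Qed.

Lemma cM_bounds t : 0 <= cM t <= M.
Proof. assert (H := M_pos); unfold cM, Rmax, Rmin; repeat destruct Rle_dec; lra. Qed.

Lemma cM_id t : 0 <= t <= M -> cM t = t.
Proof. unfold cM, Rmax, Rmin; repeat destruct Rle_dec; lra. Qed.

Lemma cM_cont t : continuous cM t.
Proof.
  apply filterlim_locally; intros e; exists e; intros s Hs.
  apply Rle_lt_trans with (2 := Hs).
  change (Rabs (cM s - cM t) <= Rabs (s - t)).
  assert (H := M_pos).
  unfold cM, Rmax, Rmin, Rabs; repeat destruct Rle_dec; repeat destruct Rcase_abs; lra.
Qed.

Lemma cM_pow t : 0 <= cM t ^ S m < 1.
Proof.
  assert (H := cM_bounds t); split; [apply pow_le; tauto|].
  assert (P := pow_incr _ _ (S m) H); rewrite M_pow in P; lra.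
Qed.

Lemma Re_f_pos s : 0 <= s < 1 -> 0 < Re (f s).
Proof. apply datum. Qed.

Lemma data_cont i t : continuous (fun s => cpt i (f (cM s ^ S m))) t.
Proof.
  assert (H1 : continuous (fun s => cM s ^ S m) t).
  { apply (continuous_post (fun t => t ^ S m)); [|apply cM_cont].
    apply continuous_diff; auto_derive; auto. }
  assert (H2 : continuous (U := C_UniformSpace) (fun s => f (cM s ^ S m)) t).
  { intros P HP.
    assert (H3 := proj1 datum (cM t ^ S m) (cM_pow t) P HP).
    specialize (H1 _ H3); unfold filtermap in H1 |- *.
    refine (filter_imp _ _ _ H1); intros s Hs; apply Hs, cM_pow. }
  apply (continuous_comp (fun s => f (cM s ^ S m)) (cpt i)); auto.
  apply continuous_cpt.
Qed.

Lemma deriv_f i s : 0 < s < 1 -> is_derive (fun t => cpt i (f t)) s (cpt i (deriv f s)).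
Proof.
  intros Hs; destruct datum as [_ [[Hd _] _]]; specialize (Hd s Hs).
  destruct i; apply Derive_correct; [apply ex_derive_Re|apply ex_derive_Im]; auto.
Qed.

Lemma open_01 : open (fun t : R => 0 < t < 1).
Proof. apply open_and; [apply open_gt|apply open_lt]. Qed.

Lemma deriv_f_cont i s : 0 < s < 1 -> continuous (fun t => cpt i (deriv f t)) s.
Proof.
  intros Hs; destruct datum as [_ [[_ Hd] _]].
  assert (K := Ck_Cn1_cpt k (fun t => 0 < t < 1) (deriv f) open_01 Hd i).
  apply (continuous_slice (fun p => cpt i (deriv f (fst p))) true (s, 0)).
  apply (Ck_cont _ _ _ _ K); auto.
Qed.

Lemma pow_01 t : 0 < t < 1 -> 0 < t ^ S m < 1.
Proof.
  intros Ht; split; [apply pow_lt; lra|].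
  destruct (Rlt_le_dec (t ^ S m) 1) as [|H]; auto.
  assert (P := pow_lt_1_compat t (S m) ltac:(lra) ltac:(lia)); lra.
Qed.

Lemma pow_diff t : is_derive (fun s => s ^ S m) t (INR (S m) * t ^ m).
Proof.
  replace (INR (S m) * t ^ m) with (INR (S m) * 1 * t ^ pred (S m)).
  - apply (is_derive_pow (fun s => s)), (is_derive_id (K := R_AbsRing)).
  - rewrite Rmult_1_r; reflexivity.
Qed.

Lemma data_deriv i t : 0 < t -> t ^ S m < 1 - delta ->
  is_derive (fun s => cpt i (f (cM s ^ S m))) t
    (rho delta m (t, 0) * (density i (cM t)) * Re (f (cM t ^ S m))).
Proof.
  intros H0 H1; assert (HM := below_M t ltac:(lra) H1); assert (HM1 := M_lt_1).
  rewrite cM_id by lra.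
  assert (Hs := pow_01 t ltac:(lra)).
  assert (Hf := Re_f_pos (t ^ S m) ltac:(lra)).
  assert (Hr := rho_pos delta m (proj1 delta_01) (t, 0)).
  replace (rho delta m (t, 0) * density i t * Re (f (t ^ S m)))
    with (scal (INR (S m) * t ^ m) (cpt i (deriv f (t ^ S m)))).
  - apply (is_derive_ext_loc (fun s => cpt i (f (s ^ S m)))).
    + apply (filter_imp (fun s => 0 < s /\ s < M)).
      * intros s Hs'; rewrite cM_id; auto; lra.
      * apply (open_and (fun s => 0 < s) (fun s => s < M)); [apply open_gt|apply open_lt|lra].
    + apply (is_derive_comp (fun s => cpt i (f s)) (fun s => s ^ S m)).
      * apply deriv_f; auto.
      * apply pow_diff.
  - unfold density; destruct Rle_dec; [lra|].
    change (INR (S m) * t ^ m * cpt i (deriv f (t ^ S m))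
      = rho delta m (t, 0) * (INR (S m) * t ^ m * cpt i (deriv f (t ^ S m))
          * / (Re (f (t ^ S m)) * rho delta m (t, 0))) * Re (f (t ^ S m)) :> R).
    field; lra.
Qed.

(** Near 0 the continuous extension of the weighted derivative stays close to its value at 0, and
    the real part stays close to f(0) = 1. The 2 in the witness for G covers the factor sqrt 2
    between the modulus and the larger of the two components. *)
Lemma weighted_deriv_bound : exists e G, 0 < e <= 1 /\ 0 <= G /\
  forall s, 0 < s < e -> Rpower s alpha * Cmod (deriv f s) <= G /\ / 2 <= Re (f s).
Proof.
  destruct datum as [Cf [_ [[g [Cg Hg]] [f0 _]]]].
  destruct (proj1 (filterlim_locally _ _) (Cg 0 (conj (Rle_refl 0) Rlt_0_1)) (mkposreal 1 Rlt_0_1))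
    as [[e1 He1] H1].
  destruct (proj1 (filterlim_locally _ _) (Cf 0 (conj (Rle_refl 0) Rlt_0_1)) (mkposreal (/ 2) ltac:(lra)))
    as [[e2 He2] H2].
  exists (Rmin 1 (Rmin e1 e2)), (Cmod (g 0) + 2); split; [|split].
  - split; [repeat apply Rmin_pos; lra|apply Rmin_l].
  - assert (P := Cmod_ge_0 (g 0)); lra.
  - intros s [S0 S1].
    assert (L1 := Rlt_le_trans _ _ _ S1 (Rmin_l _ _)).
    assert (L2 := Rlt_le_trans _ _ _ S1 (Rle_trans _ _ _ (Rmin_r _ _) (Rmin_l _ _))).
    assert (L3 := Rlt_le_trans _ _ _ S1 (Rle_trans _ _ _ (Rmin_r _ _) (Rmin_r _ _))).
    assert (B : forall e (He : 0 < e), s < e -> ball 0 (mkposreal e He) s).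
    { intros e He Hse; change (Rabs (s - 0) < e).
      rewrite Rminus_0_r, Rabs_pos_eq; lra. }
    split.
    + destruct (H1 s (B e1 He1 L2) ltac:(lra)) as [B1 B2].
      change (Rabs (Re (g s) - Re (g 0)) < 1) in B1.
      change (Rabs (Im (g s) - Im (g 0)) < 1) in B2.
      assert (E : Rpower s alpha * Cmod (deriv f s) = Cmod (g s)).
      { rewrite Hg by lra; rewrite Cmod_mult, Cmod_R, Rabs_pos_eq; auto.
        apply Rlt_le, exp_pos. }
      rewrite E; replace (g s) with (g 0 + (g s - g 0))%C by ring.
      apply Rle_trans with (1 := Cmod_triangle _ _).
      apply Rplus_le_compat_l.
      apply Rle_trans with (1 := Cmod_2Rmax _).
      assert (Q : sqrt 2 <= 2) by (rewrite <- (sqrt_Rsqr 2) at 2 by lra;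
                                   apply sqrt_le_1_alt; unfold Rsqr; lra).
      assert (Q' := sqrt_pos 2).
      assert (Rmax (Rabs (fst (g s - g 0)%C)) (Rabs (snd (g s - g 0)%C)) <= 1).
      { apply Rmax_lub; apply Rlt_le; [exact B1|exact B2]. }
      assert (0 <= Rmax (Rabs (fst (g s - g 0)%C)) (Rabs (snd (g s - g 0)%C))).
      { eapply Rle_trans; [|apply Rmax_l]; apply Rabs_pos. }
      nra.
    + destruct (H2 s (B e2 He2 L3) ltac:(lra)) as [B1 _].
      change (Rabs (Re (f s) - Re (f 0)) < / 2) in B1.
      rewrite f0 in B1; simpl in B1; apply Rabs_lt_between in B1; lra.
Qed.

Lemma Rpower_small g : 0 < g -> forall eps, 0 < eps ->
  exists d, 0 < d /\ forall t, 0 < t < d -> Rpower t g < eps.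
Proof.
  intros Hg eps He; exists (Rpower eps (/ g)); split; [apply exp_pos|].
  intros t Ht; rewrite <- (Rpower_1 eps He), <- (Rinv_l g), <- Rpower_mult by lra.
  apply Rlt_Rpower_l; lra.
Qed.

Lemma inv_rho_le_1 p : / rho delta m p <= 1.
Proof.
  unfold rho; rewrite Rinv_inv.
  rewrite <- sqrt_1; apply sqrt_le_1_alt, Rmax_lub; [lra|].
  unfold gap; assert (P1 := pow_le _ (S m) (proj1 (clamp_bounds (fst p))));
    assert (P2 := pow_le _ (S m) (proj1 (clamp_bounds (snd p)))); lra.
Qed.

Lemma density_cont i t : t < 1 -> continuous (density i) t.
Proof.
  intros Ht1; destruct (Rtotal_order t 0) as [H|[->|H]].
  - apply (continuous_ext_loc _ (fun _ => 0)); [|apply continuous_const].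
    apply (filter_imp (fun t => t < 0)); [|apply (open_lt 0 t H)].
    intros s Hs; unfold density; destruct Rle_dec; lra.
  - destruct weighted_deriv_bound as [e [G [He [HG Hb]]]].
    assert (HN := INR_S_pos m).
    apply filterlim_locally; intros [eps Heps].
    (* The density will be bounded by 2 (m+1) G times a positive power of t: the 2 bounds 1 / Re f,
       and 1 / rho is at most 1. Using G + 1 keeps the denominator positive. *)
    destruct (Rpower_small _ m_large (eps / (2 * INR (S m) * (G + 1)))) as [d [Hd Hs]].
    { apply Rdiv_lt_0_compat; auto; nra. }
    assert (Hp : 0 < Rmin d e) by (apply Rmin_pos; lra).
    assert (Main : forall t : R, Rabs t < Rmin d e -> Rabs (density i t) < eps).
    2: { exists (mkposreal _ Hp); intros t Ht.
         change (Rabs (t - 0) < Rmin d e) in Ht; rewrite Rminus_0_r in Ht.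
         change (Rabs (density i t - density i 0) < eps).
         replace (density i 0) with 0 by (unfold density; destruct Rle_dec; lra).
         rewrite Rminus_0_r; auto. }
    intros t Ht.
    destruct (Rle_dec t 0) as [T0|T0].
    { unfold density; destruct Rle_dec; [rewrite Rabs_R0; auto|lra]. }
    assert (T1 := Rlt_le_trans _ _ _ (Rle_lt_trans _ _ _ (Rle_abs t) Ht) (Rmin_l _ _)).
    assert (T2 := Rlt_le_trans _ _ _ (Rle_lt_trans _ _ _ (Rle_abs t) Ht) (Rmin_r _ _)).
    assert (Tp : 0 < t ^ S m < e).
    { split; [apply pow_lt; lra|].
      apply Rle_lt_trans with t; auto.
      rewrite <- tech_pow_Rmult.
      assert (P : t ^ m <= 1) by (rewrite <- (pow1 m); apply pow_incr; lra).
      assert (P' : 0 < t) by lra; nra. }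
    destruct (Hb _ Tp) as [B1 B2].
    (* The Jacobian splits into the weight x^alpha, which tames the derivative of the datum, and the
       spare power that tends to 0. *)
    assert (E : t ^ m = Rpower t (INR m - INR (S m) * alpha) * Rpower (t ^ S m) alpha).
    { rewrite <- (Rpower_pow (S m)) by lra; rewrite Rpower_mult, <- Rpower_plus.
      rewrite <- Rpower_pow by lra; f_equal; ring. }
    unfold density; destruct Rle_dec; [lra|].
    rewrite Rinv_mult, !Rabs_mult, (Rabs_pos_eq (INR (S m))) by lra.
    rewrite (Rabs_pos_eq (t ^ m)) by (apply pow_le; lra).
    rewrite (Rabs_pos_eq (/ Re _)) by (apply Rlt_le, Rinv_0_lt_compat; lra).
    assert (Hr := rho_pos delta m (proj1 delta_01) (t, 0)).
    rewrite (Rabs_pos_eq (/ rho _ _ _)) by (apply Rlt_le, Rinv_0_lt_compat; lra).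
    assert (B3 := cpt_Cmod i (deriv f (t ^ S m))).
    assert (B4 : / Re (f (t ^ S m)) <= 2).
    { rewrite <- (Rinv_inv 2); apply Rinv_le_contravar; lra. }
    assert (B4' : 0 < / Re (f (t ^ S m))) by (apply Rinv_0_lt_compat; lra).
    assert (B5 := inv_rho_le_1 (t, 0)).
    assert (B5' : 0 < / rho delta m (t, 0)) by (apply Rinv_0_lt_compat; lra).
    specialize (Hs t ltac:(lra)).
    set (q := Rpower t (INR m - INR (S m) * alpha)) in *.
    assert (Hq : 0 < q) by apply exp_pos.
    assert (Hqa : 0 < Rpower (t ^ S m) alpha) by apply exp_pos.
    assert (B6 : t ^ m * Rabs (cpt i (deriv f (t ^ S m))) <= q * G).
    { rewrite E, Rmult_assoc; apply Rmult_le_compat_l; [lra|].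
      apply Rle_trans with (2 := B1); apply Rmult_le_compat_l; lra. }
    assert (B7 : / Re (f (t ^ S m)) * / rho delta m (t, 0) <= 2) by nra.
    apply Rle_lt_trans with (INR (S m) * ((q * G) * 2)).
    { rewrite !Rmult_assoc; apply Rmult_le_compat_l; [lra|].
      rewrite <- Rmult_assoc, <- (Rmult_assoc q); apply Rmult_le_compat; auto.
      - apply Rmult_le_pos; [apply pow_le; lra|apply Rabs_pos].
      - apply Rlt_le, Rmult_lt_0_compat; auto. }
    apply Rlt_div_r in Hs; [|apply Rlt_gt, Rmult_lt_0_compat; lra].
    assert (0 < INR (S m) * q) by (apply Rmult_lt_0_compat; auto); lra.
  - apply (continuous_ext_loc _ (fun t => INR (S m) * t ^ m * cpt i (deriv f (t ^ S m))
       * / (Re (f (t ^ S m)) * rho delta m (t, 0)))).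
    { apply (filter_imp (fun t => 0 < t)); [|apply (open_gt 0 t H)].
      intros s Hs; unfold density; destruct Rle_dec; [lra|auto]. }
    assert (Hs := pow_01 t ltac:(lra)).
    assert (Hc : continuous (fun s => s ^ S m) t)
      by (apply continuous_diff; eexists; apply pow_diff).
    apply continuous_Rmult; [apply continuous_Rmult|].
    + apply continuous_diff; auto_derive; auto.
    + apply (continuous_comp (fun s => s ^ S m) (fun s => cpt i (deriv f s))); auto.
      apply deriv_f_cont; auto.
    + apply (continuous_post Rinv).
      * apply continuous_diff; auto_derive; auto.
        apply Rmult_integral_contrapositive_currified; apply Rgt_not_eq.
        -- apply Re_f_pos; lra.
        -- apply rho_pos; lra.
      * apply continuous_Rmult.
        -- apply (continuous_comp (fun s => s ^ S m) (fun s => Re (f s))); auto.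
           apply continuous_diff; eexists; apply (deriv_f true); auto.
        -- apply (continuous_slice (rho delta m) true (t, 0)), rho_cont; lra.
Qed.

Lemma data_density_cont i t : continuous (fun s => density i (cM s)) t.
Proof.
  apply (continuous_post (density i)); [|apply cM_cont].
  apply density_cont; assert (H := cM_bounds t); assert (H' := M_lt_1); lra.
Qed.

Lemma data_density_bound : exists A, forall i t, Rabs (density i (cM t)) <= A.
Proof.
  assert (B : forall i, exists A, forall t, Rabs (density i (cM t)) <= A).
  { intros i; assert (HM := M_pos); assert (HM1 := M_lt_1).
    destruct (continuity_ab_maj (fun t => Rabs (density i t)) 0 M) as [t0 [H0 _]].
    - lra.
    - intros t Ht; apply continuity_pt_filterlim.
      apply (continuous_comp (density i) Rabs); [|apply continuous_Rabs].
      apply density_cont; lra.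
    - exists (Rabs (density i t0)); intros t; apply H0, cM_bounds. }
  destruct (B true) as [A1 H1], (B false) as [A2 H2].
  exists (Rmax A1 A2); intros [|] t.
  - apply Rle_trans with (1 := H1 t), Rmax_l.
  - apply Rle_trans with (1 := H2 t), Rmax_r.
Qed.

Lemma Wdom_base p : Wdom delta m p -> Wdom delta m (fst p, 0).
Proof.
  destruct p as [x y]; intros Hp; apply (colclosed_Wdom delta m x y); auto.
  assert (B := clamp_bounds y); lra.
Qed.

Lemma Ck_density i : Ck xdir k (Wdom delta m) (fun p => density i (cM (fst p))).
Proof.
  assert (dp : 0 < delta) by tauto.
  assert (HO := open_Wdom delta m).
  assert (Hx : forall p, Wdom delta m p -> 0 < fst p < 1) by (intros p; apply Wdom_fst; auto).
  apply (Ck_ext xdir k (Wdom delta m) (fun p => INR (S m) * fst p ^ m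
     * cpt i (deriv f (fst p ^ S m))
     * / (cpt true (f (fst p ^ S m)) * rho delta m (fst p, 0)))); auto.
  { intros [x y] Hp; destruct (Wdom_axis delta m dp (x, y) Hp) as [H0 H1].
    cbn [fst] in *; assert (H2 := below_M x ltac:(lra) H1).
    rewrite cM_id by lra; unfold density; destruct Rle_dec; [lra|reflexivity]. }
  assert (K1 : forall j (g : R -> C), Cn1 j (fun t => 0 < t < 1) g -> forall i,
            Ck xdir j (Wdom delta m) (fun p => cpt i (g (fst p ^ S m)))).
  { intros j g Hg i'.
    apply (Ck_change_vars xdir j (Wdom delta m) (fun p => 0 < fst p < 1)
             (fun d t => if d then t ^ S m else t) (fun d t => if d then INR (S m) * t ^ m else 1)
             (fun p => cpt i' (g (fst p)))).
    - intros p Hp; apply pow_01; auto.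
    - intros d p _; destruct d; [|apply continuous_id].
      apply continuous_diff; eexists; apply pow_diff.
    - intros d p -> _; apply pow_diff.
    - intros d ->; apply Ck_mult; [apply Ck_const|apply Ck_pow, (Ck_crd xdir j _ true)].
    - apply (Ck_Cn1_cpt j (fun t => 0 < t < 1) g open_01 Hg). }
  destruct datum as [_ [Hf _]].
  apply Ck_mult; [apply Ck_mult|].
  - apply Ck_mult; [apply Ck_const|apply Ck_pow, (Ck_crd xdir k _ true)].
  - apply K1, Hf.
  - apply Ck_inv.
    + intros p Hp; apply Rmult_integral_contrapositive_currified; apply Rgt_not_eq.
      * apply Re_f_pos; assert (P := pow_01 (fst p) (Hx p Hp)).
        exact (conj (Rlt_le _ _ (proj1 P)) (proj2 P)).
      * apply rho_pos; auto.
    + apply Ck_mult; [apply Ck_pred, K1, Hf|].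
      (* Restriction to the axis is treated as a change of variables that freezes the second
         coordinate at 0. *)
      apply (Ck_change_vars xdir k (Wdom delta m) (Wdom delta m)
               (fun d t => if d then t else 0) (fun d t => 1) (rho delta m)).
      * apply Wdom_base.
      * intros d p _; destruct d; [apply continuous_id|apply continuous_const].
      * intros d p -> _; apply (is_derive_id (K := R_AbsRing)).
      * intros; apply Ck_const.
      * apply Ck_rho_Wdom; auto.
Qed.

(** This gathers what the characteristic system and the potential require of one datum. It serves
    both axes because [rho] is symmetric. *)
Lemma datum_transform : exists (a : bool -> R -> R) (R0 S0 : R -> R) (A : R),
  (forall i x, continuous (a i) x) /\ (forall i x, Rabs (a i x) <= A) /\
  (forall i, Ck xdir k (Wdom delta m) (fun p => a i (fst p))) /\
  (forall x, continuous R0 x) /\ (forall x, continuous S0 x) /\ (forall x, 0 < R0 x) /\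
  (forall x, 0 < x -> x ^ S m < 1 - delta ->
     is_derive R0 x (rho delta m (x, 0) * a true x * R0 x)) /\
  (forall x, 0 < x -> x ^ S m < 1 - delta ->
     is_derive S0 x (rho delta m (x, 0) * a false x * R0 x)) /\
  R0 0 = 1 /\ S0 0 = 0 /\
  (forall x, 0 <= x < 1 - delta ->
     R0 (root m x) = Re (f x) /\ S0 (root m x) = Im (f x)).
Proof.
  destruct data_density_bound as [A HA].
  assert (Hval : forall x, 0 <= x < 1 - delta -> cM (root m x) ^ S m = x).
  { intros x Hx; rewrite cM_id; [apply root_pow; lra|].
    split; [apply root_nonneg|].
    apply Rlt_le, below_M; [apply root_nonneg|rewrite root_pow; lra]. }
  assert (H0 : cM 0 ^ S m = 0).
  { rewrite cM_id; [apply pow_ne_zero; lia|assert (H := M_pos); lra]. }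
  exists (fun i t => density i (cM t)), (fun t => Re (f (cM t ^ S m))),
    (fun t => Im (f (cM t ^ S m))), A.
  split; [exact data_density_cont|].
  split; [exact HA|].
  split; [exact Ck_density|].
  split; [exact (data_cont true)|].
  split; [exact (data_cont false)|].
  split; [intros x; apply Re_f_pos, cM_pow|].
  split; [exact (data_deriv true)|].
  split; [exact (data_deriv false)|].
  destruct datum as [_ [_ [_ [f0 _]]]].
  rewrite H0, f0.
  split; [reflexivity|].
  split; [reflexivity|].
  intros x Hx; rewrite (Hval x Hx); auto.
Qed.

End Datum.

(** * The Goursat problem *)

Lemma interior_Ddelta delta (p : R * R) : Defs.interior (Ddelta delta) p ->
  0 < fst p /\ 0 < snd p /\ fst p + snd p < 1 - delta.
Proof.
  destruct p as [x y]; intros H.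
  assert (Hp := locally_singleton _ _ H); destruct H as [[e He] H].
  assert (Hx : Ddelta delta (x - e / 2, y)).
  { apply H; split; [|apply ball_center].
    change (Rabs (x - e / 2 - x) < e); apply Rabs_def1; lra. }
  assert (Hy : Ddelta delta (x, y - e / 2)).
  { apply H; split; [apply ball_center|].
    change (Rabs (y - e / 2 - y) < e); apply Rabs_def1; lra. }
  unfold Ddelta, Defs.D in *; simpl in *; lra.
Qed.

Lemma open_interior (S : R * R -> Prop) : open (Defs.interior S).
Proof. intros p Hp; apply (locally_locally p S Hp). Qed.

(** The inequality amounts to m > alpha / (1 - alpha), so alpha < 1 is what makes the change of
    variables possible. *)
Lemma large_exponent alpha : 0 <= alpha < 1 ->
  exists m : nat, 0 < INR m - INR (S m) * alpha.
Proof.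
  intros H; destruct (INR_unbounded (alpha / (1 - alpha))) as [m Hm].
  exists m; rewrite S_INR.
  apply Rlt_div_l in Hm; [|lra]; lra.
Qed.

(** A and B stand for dX/dx and dY/dy, and r for 1 / sqrt(1 - x - y). The cubic terms of the mixed
    derivative cancel the first-order terms of the equation; the quadratic ones form the complex
    product u v and match the right side. *)
Lemma Ernst_algebra (R r u1 u2 v1 v2 A B : R) : 0 < r ->
  let Ex := (A * (r * u1 * R), A * (r * u2 * R)) : C in
  let Ey := (B * (r * v1 * R), B * (r * v2 * R)) : C in
  let Exy := (R * (r ^ 3 / 2 * (B * v1 + A * u1) + r ^ 2 * A * B * (u1 * v1 - u2 * v2)),
              R * (r ^ 3 / 2 * (B * v2 + A * u2) + r ^ 2 * A * B * (u1 * v2 + u2 * v1))) : C in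
  (RtoC R * (Exy - (Ex + Ey) / RtoC (2 / (r * r))) = Ex * Ey)%C.
Proof.
  intros Hr Ex Ey Exy.
  replace ((Ex + Ey) / RtoC (2 / (r * r)))%C with ((Ex + Ey) * RtoC (r * r / 2))%C.
  - unfold Ex, Ey, Exy; apply injective_projections; simpl; field.
  - unfold Cdiv; f_equal; rewrite <- RtoC_inv by (apply Rgt_not_eq, Rdiv_lt_0_compat; nra).
    f_equal; field; lra.
Qed.

Lemma Goursat_solution_lt_1 k delta alpha E0 E1 : 0 < delta < 1 -> 0 <= alpha < 1 ->
  Goursat_datum (S k) alpha E0 -> Goursat_datum (S k) alpha E1 ->
  exists E, Cn_solution (S k) delta E0 E1 E.
Proof.
  intros Hdelta Halpha H0 H1.
  assert (dp : 0 < delta) by tauto.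
  destruct (large_exponent alpha Halpha) as [m Hm].
  destruct (datum_transform delta m k alpha E0 Hdelta Hm H0)
    as [a [R0 [S0 [A0 [Ca [Ba [Ka [CR0 [CS0 [PR0 [DR0 [DS0 [R00 [S00 V0]]]]]]]]]]]]]].
  destruct (datum_transform delta m k alpha E1 Hdelta Hm H1)
    as [b [R1 [S1 [A1 [Cb [Bb [Kb [CR1 [CS1 [PR1 [DR1 [DS1 [R10 [S10 V1]]]]]]]]]]]]]].
  destruct (characteristic_system (rho delta m) (coupling delta m) a b _ _ (Rmax A0 A1)
              (rho_cont delta m dp) (coupling_cont delta m dp) Ca Cb
              (rho_bound delta m dp) (coupling_bound delta m dp))
    as [u [v sol]].
  { intros i x; apply Rle_trans with (1 := Ba i x), Rmax_l. }
  { intros i x; apply Rle_trans with (1 := Bb i x), Rmax_r. }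
  change (char_sol (rho delta m) (coupling delta m) a b u v) in sol.
  set (r := rho delta m) in *.
  set (N := INR (S m)).
  assert (HN : 0 < N) by apply INR_S_pos.
  set (PR := potR delta m v R0); set (PS := potS delta m v R0 S0).
  assert (CPR : forall p, continuous PR p) by (apply (potR_cont delta m a b u v); auto).
  assert (CPS : forall p, continuous PS p) by (apply (potS_cont delta m a b u v); auto).
  assert (PPR : forall p, 0 < PR p) by (apply potR_pos; auto).
  set (Ux := Udom delta m).
  set (psi := fun p : R * R => (root m (fst p), root m (snd p))).
  set (dr := fun t => / (N * root m t ^ m)).
  set (Int := Defs.interior (Ddelta delta) : R * R -> Prop).
  assert (HInt : forall p : R * R, Int p -> 0 < fst p /\ 0 < snd p /\ fst p + snd p < 1 - delta)
    by (intros p; apply interior_Ddelta).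
  assert (OInt : open Int) by apply open_interior.
  assert (root_lt_1 : forall t, 0 < t < 1 -> 0 < root m t < 1).
  { intros t Ht; split; [apply root_pos; lra|].
    apply (pow_lt_1_inv m); [apply root_nonneg|rewrite root_pow; lra]. }
  assert (Hrr : forall p : R * R, Int p -> gap m (psi p) = 1 - fst p - snd p).
  { intros p Hp; apply HInt in Hp; unfold gap, psi; cbn [fst snd].
    assert (L1 := root_lt_1 (fst p) ltac:(lra)); assert (L2 := root_lt_1 (snd p) ltac:(lra)).
    rewrite !clamp_id, !root_pow by lra; ring. }
  assert (HU : forall p : R * R, Int p -> Ux (psi p)).
  { intros p Hp; assert (E := Hrr p Hp); apply HInt in Hp; split; [split|].
    - apply root_pos; tauto.
    - rewrite E; lra.
    - apply root_pos; tauto. }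
  assert (Cpsi : forall (g : R * R -> R) p, (forall q, continuous g q) ->
            continuous (fun q => g (psi q)) p).
  { intros g p Hg; apply (continuous_comp psi g); auto.
    apply continuous_pair.
    - apply (continuous_post (root m) (fun q : R * R => fst q));
        auto using root_cont, continuous_Rfst.
    - apply (continuous_post (root m) (fun q : R * R => snd q));
        auto using root_cont, continuous_Rsnd. }
  assert (chain : forall d g (p : R * R) l, Int p -> is_pd d g (psi p) l ->
            is_pd d (fun q => g (psi q)) p (dr (crd d p) * l)).
  { intros d g p l Hp Hg; apply HInt in Hp; unfold is_pd.
    apply (is_derive_ext (fun t => slice d g (psi p) (root m t))).
    { intros t; destruct d; reflexivity. }
    apply (is_derive_comp (slice d g (psi p)) (root m)).
    - unfold is_pd in Hg; destruct d; exact Hg.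
    - apply root_deriv; destruct d; simpl; tauto. }
  (* The derivatives of E are written as Jacobians [dr] times functions continuous on the whole
     plane. Only [dr] is singular on the axes, so weights that cancel it give the required
     continuous extensions. *)
  set (Fx := fun i q => r q * u i q * PR q).
  set (Fy := fun i q => r q * v i q * PR q).
  set (Fxy := fun (i : bool) q => PR q *
    (r q ^ 3 * (xi m (fst q) * v i q + xi m (snd q) * u i q)
     + r q ^ 2 * (if i then u true q * v true q - u false q * v false q
                  else u true q * v false q + u false q * v true q))).
  assert (CFx : forall i q, continuous (Fx i) q).
  { intros i q; apply continuous_Rmult; [apply continuous_Rmult|]; auto.
    - apply rho_cont; auto.
    - apply sol. }
  assert (CFy : forall i q, continuous (Fy i) q).
  { intros i q; apply continuous_Rmult; [apply continuous_Rmult|]; auto.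
    - apply rho_cont; auto.
    - apply sol. }
  assert (CFxy : forall i q, continuous (Fxy i) q).
  { intros i q.
    assert (Cr : forall n, continuous (fun q => r q ^ n) q).
    { intros n; apply (continuous_post (fun t => t ^ n) r).
      - apply continuous_diff; auto_derive; auto.
      - apply rho_cont; auto. }
    assert (Cu : forall i, continuous (u i) q) by (intros; apply sol).
    assert (Cv : forall i, continuous (v i) q) by (intros; apply sol).
    assert (X1 : continuous (fun q : R * R => xi m (fst q)) q)
      by (apply (continuous_post (xi m) (fun q : R * R => fst q));
          [apply xi_cont|apply continuous_Rfst]).
    assert (X2 : continuous (fun q : R * R => xi m (snd q)) q)
      by (apply (continuous_post (xi m) (fun q : R * R => snd q));
          [apply xi_cont|apply continuous_Rsnd]).
    apply continuous_Rmult; auto.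
    apply continuous_Rplus; apply continuous_Rmult; auto.
    - apply continuous_Rplus; apply continuous_Rmult; auto.
    - destruct i; [apply continuous_Rminus|apply continuous_Rplus];
        apply continuous_Rmult; auto. }
  set (E := fun p => (PR (psi p), PS (psi p)) : C).
  assert (Dx : forall p : R * R, Int p ->
     dx E p = (dr (fst p) * Fx true (psi p), dr (fst p) * Fx false (psi p))).
  { intros p Hp; apply injective_projections.
    - apply (is_pd_unique true (fun q => PR (psi q)) p), (chain true PR); auto.
      apply (potR_pd_x delta m a b u v R0 dp); auto; apply (HU p Hp).
    - apply (is_pd_unique true (fun q => PS (psi q)) p), (chain true PS); auto.
      apply (potS_pd_x delta m a b u v R0 S0 dp); auto; apply (HU p Hp). }
  assert (Dy : forall p : R * R, Int p ->
     dy E p = (dr (snd p) * Fy true (psi p), dr (snd p) * Fy false (psi p))).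
  { intros p Hp; apply injective_projections.
    - apply (is_pd_unique false (fun q => PR (psi q)) p), (chain false PR); auto.
      apply (potR_pd_y delta m a b u v R0 dp sol), (Udom_crd _ _ dp false _ (HU p Hp)).
    - apply (is_pd_unique false (fun q => PS (psi q)) p), (chain false PS); auto.
      apply (potS_pd_y delta m a b u v R0 S0 dp sol CR0), (Udom_crd _ _ dp false _ (HU p Hp)). }
  assert (Dxy : forall p : R * R, Int p ->
     dy (dx E) p = (dr (fst p) * dr (snd p) * Fxy true (psi p),
                    dr (fst p) * dr (snd p) * Fxy false (psi p))).
  { intros p Hp.
    assert (P : forall i, is_pd false (fun q => dr (fst q) * Fx i (psi q)) p
                  (dr (fst p) * dr (snd p) * Fxy i (psi p))).
    { intros i.
      apply (is_pd_eq _ _ _ (0 * Fx i (psi p) + dr (fst p) * (dr (snd p) * Fxy i (psi p))));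
        [ring|].
      apply (is_pd_mult false (fun q => dr (fst q)) (fun q => Fx i (psi q))).
      - destruct p as [x y]; apply (is_derive_const (dr x : R_NormedModule)).
      - apply (chain false (Fx i)); auto.
        eapply is_pd_eq;
          [|apply (rho_u_potR_pd_y delta m a b u v R0 dp sol i (psi p)), HU, Hp].
        unfold Fxy, PR, r; destruct i; ring. }
    apply injective_projections.
    - apply (is_pd_unique false (fun q => Re (dx E q)) p).
      apply (is_pd_ext false Int (fun q => dr (fst q) * Fx true (psi q))); auto.
      intros q Hq; rewrite Dx; auto.
    - apply (is_pd_unique false (fun q => Im (dx E q)) p).
      apply (is_pd_ext false Int (fun q => dr (fst q) * Fx false (psi q))); auto.
      intros q Hq; rewrite Dx; auto. }
  assert (droot : forall t, 0 < t -> root m t ^ m * dr t = / N).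
  { intros t Ht; unfold dr; assert (P := root_pos m t Ht).
    assert (root m t ^ m <> 0) by (apply pow_nonzero; lra); field; lra. }
  assert (Hcont : forall f1 f2 : R * R -> R, (forall q, continuous f1 q) ->
     (forall q, continuous f2 q) -> forall p,
     continuous (U := C_UniformSpace) (fun q => (f1 (psi q), f2 (psi q)) : C) p).
  { intros f1 f2 C1 C2 p; apply continuous_C; simpl; apply Cpsi; auto. }
  exists E; split; [|split; [|split; [|split; [|split; [|split]]]]].
  - apply continuous_on_all; intros p _; apply Hcont; auto.
  - assert (HKt : forall g, Ck alldir (S k) Ux g -> Ck alldir (S k) Int (fun p => g (psi p))).
    { intros g Hg.
      assert (Kr : forall d, Ck alldir (S k) Int (fun p => root m (crd d p))).
      { intros d; apply Ck_root; intros p Hp; apply HInt in Hp; destruct d; simpl; tauto. }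
      apply (Ck_change_vars alldir (S k) Int Ux (fun _ => root m) (fun _ => dr)); auto.
      - intros d p _; apply root_cont.
      - intros d p _ Hp; apply HInt in Hp; apply root_deriv; destruct d; simpl; tauto.
      - intros d _; apply Ck_inv.
        + intros p Hp; apply HInt in Hp.
          apply Rmult_integral_contrapositive_currified; [lra|].
          apply pow_nonzero, Rgt_not_eq, root_pos; destruct d; simpl; tauto.
        + apply Ck_mult; [apply Ck_const|apply Ck_pow, Kr]. }
    destruct (Ck_pot delta m a b u v R0 S0 dp sol CR0 CS0 DR0 DS0 k Ka Kb) as [K1 K2].
    apply (Cn2_Ck (S k) Int E (fun p => PR (psi p)) (fun p => PS (psi p))); auto.
  - intros [x y] Hp; unfold Ernst_at.
    rewrite (Dxy _ Hp), (Dx _ Hp), (Dy _ Hp).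
    assert (HW : Wdom delta m (psi (x, y))) by apply (Udom_Wdom _ _ _ (HU _ Hp)).
    assert (Hr := rho_pos delta m dp (psi (x, y))); fold r in Hr.
    assert (Hr2 : 2 * (1 - x - y) = 2 / (r (psi (x, y)) * r (psi (x, y)))).
    { unfold r; rewrite (rho_sqr delta m dp _ HW).
      assert (Hpos := proj2 HW); rewrite (Hrr _ Hp) in *; simpl fst in *; simpl snd in *.
      field; lra. }
    rewrite Hr2.
    (* The Jacobian dX/dx cancels dx/dX inside [xi], which restores the coefficient 1/2 of the
       original variables. *)
    assert (Hxi : forall t, 0 < t < 1 -> dr t * xi m (root m t) = / 2).
    { intros t Ht; unfold xi; rewrite clamp_id by (assert (L := root_lt_1 t Ht); lra).
      fold N; replace (dr t * (N * root m t ^ m / 2)) with (N * (root m t ^ m * dr t) / 2) by field.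
      rewrite droot by lra; field; lra. }
    assert (Hb := HInt _ Hp); simpl fst in *; simpl snd in *.
    assert (X1 := Hxi x ltac:(lra)); assert (X2 := Hxi y ltac:(lra)).
    refine (eq_trans _ (Ernst_algebra (PR (psi (x, y))) (r (psi (x, y)))
      (u true (psi (x, y))) (u false (psi (x, y)))
      (v true (psi (x, y))) (v false (psi (x, y))) (dr x) (dr y) Hr)).
    unfold E at 1; simpl Re; do 2 f_equal.
    unfold Fxy; cbn [fst snd psi]; apply injective_projections; cbn [fst snd].
    (* Each 1/2 is turned back into dr times [xi], after which both sides are the same
       polynomial. *)
    + match goal with |- _ = ?P * (?c / 2 * (?B * ?v1 + ?A * ?u1) + ?z) =>
        replace (c / 2 * (B * v1 + A * u1)) with
          (c * (dr x * xi m (root m x) * B * v1 + dr y * xi m (root m y) * A * u1))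
          by (rewrite X1, X2; field) end.
      ring.
    + match goal with |- _ = ?P * (?c / 2 * (?B * ?v1 + ?A * ?u1) + ?z) =>
        replace (c / 2 * (B * v1 + A * u1)) with
          (c * (dr x * xi m (root m x) * B * v1 + dr y * xi m (root m y) * A * u1))
          by (rewrite X1, X2; field) end.
      ring.
  (* The change of variables dictates the exponent: x^(m/(m+1)) = X^m cancels the X^(-m) of dX/dx.
     By [Hm] it exceeds the exponent alpha of the data, and it is still below 1. *)
  - exists (INR m / N); split; [|split; [|split]].
    + split; [apply Rdiv_le_0_compat; [apply pos_INR|auto]|].
      apply Rlt_div_l; auto; unfold N; rewrite S_INR; lra.
    + exists (fun p => (/ N * Fx true (psi p), / N * Fx false (psi p))); split.
      * apply continuous_on_all; intros p _.
        apply (Hcont (fun q => / N * Fx true q) (fun q => / N * Fx false q));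
          intros; apply continuous_Rmult; auto using continuous_const.
      * intros p Hp; rewrite (Dx p Hp).
        assert (Hb := HInt p Hp).
        unfold N at 3; rewrite root_Rpower by tauto.
        rewrite <- (droot (fst p)) by tauto.
        apply injective_projections; simpl; ring.
    + exists (fun p => (/ N * Fy true (psi p), / N * Fy false (psi p))); split.
      * apply continuous_on_all; intros p _.
        apply (Hcont (fun q => / N * Fy true q) (fun q => / N * Fy false q));
          intros; apply continuous_Rmult; auto using continuous_const.
      * intros p Hp; rewrite (Dy p Hp).
        assert (Hb := HInt p Hp).
        unfold N at 3; rewrite root_Rpower by tauto.
        rewrite <- (droot (snd p)) by tauto.
        apply injective_projections; simpl; ring.
    + exists (fun p => (/ N * / N * Fxy true (psi p), / N * / N * Fxy false (psi p))); split.
      * apply continuous_on_all; intros p _.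
        apply (Hcont (fun q => / N * / N * Fxy true q) (fun q => / N * / N * Fxy false q));
          intros; apply continuous_Rmult; auto using continuous_const.
      * intros p Hp; rewrite (Dxy p Hp).
        assert (Hb := HInt p Hp).
        unfold N at 5 6; rewrite !root_Rpower by tauto.
        rewrite <- (droot (fst p)) at 1 3 by tauto.
        rewrite <- (droot (snd p)) by tauto.
        apply injective_projections; simpl; ring.
  - intros x Hx; unfold E, psi; cbn [fst snd]; rewrite root_0.
    unfold PR, PS; rewrite potR_axis_y, potS_axis_y.
    destruct (V0 x Hx) as [-> ->]; destruct (E0 x); reflexivity.
  - intros y Hy; unfold E, psi; cbn [fst snd]; rewrite root_0.
    assert (Hy' : root m y ^ S m < 1 - delta) by (rewrite root_pow; lra).
    unfold PR, PS.
    rewrite (potR_axis_x delta m a b u v R0 dp sol R1) by auto using root_nonneg.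
    rewrite (potS_axis_x delta m a b u v R0 S0 dp sol CR0 R1 S1) by auto using root_nonneg.
    destruct (V1 y Hy) as [-> ->]; destruct (E1 y); reflexivity.
  - intros p _; apply PPR.
Qed.

(** The domain is empty and so are the intervals carrying the data, hence any smooth function
    qualifies. *)
Lemma Cn_solution_ge_1 n delta E0 E1 : 1 <= delta ->
  Cn_solution n delta E0 E1 (fun _ => RtoC 1).
Proof.
  intros H; assert (Empty : forall p, ~ Ddelta delta p)
    by (intros p [[H1 [H2 _]] H3]; lra).
  assert (Empty' : forall p, ~ Defs.interior (Ddelta delta) p)
    by (intros p Hp; apply (Empty p), (locally_singleton _ _ Hp)).
  assert (Z : forall S0 f, (forall p, ~ S0 p) -> has_cont_ext S0 (Ddelta delta) f).
  { intros S0 f HS; exists f; split; [intros p Hp; destruct (Empty p Hp)|auto]. }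
  split; [intros p Hp; destruct (Empty p Hp)|].
  split.
  { apply (Cn2_Ck n _ _ (fun _ => 1) (fun _ => 0)); auto using open_interior, Ck_const. }
  split; [intros p Hp; destruct (Empty' p Hp)|].
  split; [exists 0; split; [lra|auto]|].
  split; [intros; lra|].
  split; [intros; lra|].
  intros p Hp; destruct (Empty p Hp).
Qed.

Lemma Goursat_solution n delta alpha E0 E1 : (1 <= n)%nat -> 0 < delta ->
  0 <= alpha < 1 -> Goursat_datum n alpha E0 -> Goursat_datum n alpha E1 ->
  exists E, Cn_solution n delta E0 E1 E.
Proof.
  intros Hn Hd Ha H0 H1; destruct n as [|k]; [lia|].
  destruct (Rlt_le_dec delta 1).
  - apply (Goursat_solution_lt_1 k delta alpha); auto.
  - exists (fun _ => RtoC 1); apply Cn_solution_ge_1; auto.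
Qed.

Theorem theorem3 :
  forall delta : R, 0 < delta ->
  exists c : R, 0 < c /\
  forall (n : nat) (alpha : R) (E0 E1 : R -> C),
    (2 <= n)%nat -> 0 <= alpha < 1 ->
    Goursat_datum n alpha E0 -> Goursat_datum n alpha E1 ->
    (* (a) *)
    (forall (Phi0 Phi1 : R -> C -> sheet -> Mat2)
            (g0 g1 : R -> R -> R -> C) (v : R -> R -> C -> Mat2),
       Volterra (U0 E0) Phi0 -> Volterra (V1 E1) Phi1 ->
       (forall x y : R, Ddelta delta (x, y) ->
          contour x y (g0 x y) (g1 x y) /\
          jump_matrix x y (Phi0 x) (Phi1 y) (g0 x y) (g1 x y) (v x y)) ->
       (forall x y : R, Ddelta delta (x, y) ->
          exists m : C -> Mat2,
            RHP_solution (g0 x y) (g1 x y) (v x y) m) ->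
       exists E : R * R -> C, Cn_solution n delta E0 E1 E) /\
    (* (b) *)
    (forall N0 N1 : R,
       is_L1_norm (fun x => (deriv E0 x / RtoC (Re (E0 x)))%C) (1 - delta) N0 ->
       is_L1_norm (fun y => (deriv E1 y / RtoC (Re (E1 y)))%C) (1 - delta) N1 ->
       N0 < c -> N1 < c ->
       exists E : R * R -> C, Cn_solution n delta E0 E1 E) /\
    (* (c) *)
    ((forall t : R, 0 <= t < 1 - delta ->
        (Im (E0 t) = 0 /\ 0 < Re (E0 t)) /\ (Im (E1 t) = 0 /\ 0 < Re (E1 t))) ->
     exists E : R * R -> C, Cn_solution n delta E0 E1 E).
Proof.
  intros delta Hdelta; exists 1; split; [exact Rlt_0_1|].
  intros n alpha E0 E1 Hn Halpha H0 H1.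
  assert (H : exists E, Cn_solution n delta E0 E1 E)
    by (apply (Goursat_solution n delta alpha); auto; lia).
  split; [|split]; intros; exact H.
Qed.
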